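(* Let $\lambda_1,\ldots,\lambda_n\in P^+$ and, for $m=1,\ldots,n$, let $\pi_m=(\lambda_{(m,1)},\ldots,\lambda_{(m,\kappa_m)};0=a_{(m,0)}<a_{(m,1)}<\cdots<a_{(m,\kappa_m)}=1)\in\mathbb B(\lambda_m)$, and $\pi=\pi_1\otimes\cdots\otimes\pi_n\in\mathbb B(\lambda_1)\otimes\cdots\otimes\mathbb B(\lambda_n)$. Let $\mathfrak I=\{(m,l):1\le m\le n,\ 1\le l\le\kappa_m\}$ with the lexicographic order. Then $\pi$ is standard, i.e. $\pi=F\pi_{\lambda_1}\otimes\cdots\otimes\pi_{\lambda_n}$ for some $F\in\mathcal F$, if and only if there exist $w_{(m,l)}\in\mathcal W$, $(m,l)\in\mathfrak I$, such that (1) $w_{(m,l)}\lambda_m=\lambda_{(m,l)}$ for all $(m,l)\in\mathfrak I$; (2) $w_{(1,1)}\ge\cdots\ge w_{(1,\kappa_1)}\ge w_{(2,1)}\ge\cdots\ge w_{(n-1,\kappa_{n-1})}\ge w_{(n,1)}\ge\cdots\ge w_{(n,\kappa_n)}$ in the Bruhat order of $\mathcal W$; (3) $w_{(m+1,1)}\lambda_m\in\mathcal W_{re}\lambda_m$ for $m=1,\ldots,n-1$; (4) there exists a $1$-chain for $(\lambda_{(m,\kappa_m)},w_{(m+1,1)}\lambda_m)$ in $\mathcal W\lambda_m$ for $m=1,\ldots,n-1$.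
   Context: Borcherds–Cartan datum $(A,\{\alpha_i\},\{\alpha_i^\vee\},P,P^\vee)$ over a countable $I$: $a_{ii}=2$ or $a_{ii}\in\mathbb Z_{\le0}$, $a_{ij}\in\mathbb Z_{\le0}$ ($i\ne j$), $a_{ij}=0\iff a_{ji}=0$, $\alpha_i^\vee(\alpha_j)=a_{ij}$, simple roots/coroots linearly independent; $I^{re}=\{a_{ii}=2\}$, $I^{im}=I\setminus I^{re}$; $P^+$ dominant integral weights; $\Delta^+$ positive roots of the generalized Kac–Moody algebra. $r_i(\mu)=\mu-\alpha_i^\vee(\mu)\alpha_i$; $\mathcal W_{re}=\langle r_i:i\in I^{re}\rangle$; $\Delta^+_{re}=\mathcal W_{re}\{\alpha_i\}_{i\in I^{re}}\cap\Delta^+$; $\Delta_{im}=\mathcal W_{re}\{\alpha_i\}_{i\in I^{im}}$; for $\beta=w\alpha_i$, $\beta^\vee=w\alpha_i^\vee$, $r_\beta=wr_iw^{-1}$. Monoid $\mathcal W$: generators $r_i$, relations $r_i^2=1$ (real $i$), $(r_ir_j)^m=(r_jr_i)^m=1$ (real $i\neq j$, $\mathrm{ord}(r_ir_j)=m\in\{2,3,4,6\}$), $r_ir_j=r_jr_i$ ($i\in I^{im}$, $j\ne i$, $a_{ij}=0$); $\mathcal W_{re}$ is the subgroup generated by real $r_i$ and $r_\beta=wr_iw^{-1}\in\mathcal W$; $\ell$ = length. Bruhat order: $w\to r_\beta w$ if $\beta\in\Delta^+_{re}\sqcup\Delta_{im}$ and $\ell(r_\beta w)>\ell(w)$; $\le$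 its reflexive–transitive closure. Order on $\mathcal W\lambda$ ($\lambda\in P^+$): $\mu\ge\nu$ iff there is $\mu=\lambda_0,\ldots,\lambda_k=\nu$ with $\lambda_{s-1}=r_{\beta_s}\lambda_s$, $\beta_s^\vee(\lambda_s)>0$; $\mu\xleftarrow\beta\nu$ if $\mu=r_\beta\nu$, $\beta^\vee(\nu)>0$ and $\mu$ covers $\nu$; an $a$-chain for $(\mu,\nu)$ ($a\in(0,1]$ rational) is $\mu=\nu_0\xleftarrow{\beta_1}\cdots\xleftarrow{\beta_k}\nu_k=\nu$ with $a\beta_s^\vee(\nu_s)\in\mathbb Z_{>0}$ for real $\beta_s$, $=1$ for imaginary. GLS paths, $\mathbb B(\lambda)$: pairs $(\lambda_1>\cdots>\lambda_k;0=a_0<\cdots<a_k=1)$ in $\mathcal W\lambda$ with rational $a_s$, an $a_s$-chain for $(\lambda_s,\lambda_{s+1})$ and a 1-chain for $(\lambda_k,\lambda)$, viewed as paths $\pi(t)=\sum_{l<s}(a_l-a_{l-1})\lambda_l+(t-a_{s-1})\lambda_s$ on $[a_{s-1},a_s]$. Concatenation $(\pi_1\otimes\cdots\otimes\pi_n)(t)=\sum_{l<m}\pi_l(1)+\pi_m(nt-m+1)$ on $[\frac{m-1}n,\frac mn]$; $\pi_\mu(t)=t\mu$. Root operators $f_i$ on piecewise-linear paths: with $H_i^\pi=\alpha_i^\vee\circ\pi$, $m_i^\pi=\min\{H_i^\pi(t)\in\mathbb Z\}$, $f_+^i=\max\{t:H_i^\pi(t)=m_i^\pi\}$: $f_i\pi=\mathbf0$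 if $f_+^i=1$, else $f_i\pi=\pi$ on $[0,f_+^i]$, $\pi-(H_i^\pi-m_i^\pi)\alpha_i$ on $[f_+^i,f_-^i]$ where $f_-^i=\min\{t\ge f_+^i:H_i^\pi(t)=m_i^\pi+1\}$, and $\pi-\alpha_i$ on $[f_-^i,1]$. $\mathcal F$ = monoid generated by the $f_i$. *)

(* Defs.v *)
From HB Require Import structures.
From mathcomp Require Import all_boot all_order all_algebra.
From mathcomp Require Import reals.
Set Implicit Arguments. Unset Strict Implicit. Unset Printing Implicit Defensive.
Import Order.TTheory GRing.Theory Num.Theory.
Local Open Scope ring_scope.

(* Borcherds-Cartan datum.  V plays the role of P (x) R (the real span in   *)
(* which piecewise-linear paths live), P is the weight lattice inside V,    *)
(* alpha i the simple roots, corr i = alpha_i^vee viewed as a linear form   *)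
(* on V which is integral on P (i.e. alpha_i^vee in P^vee = Hom(P,Z)).      *)
Record BCdatum (R : realType) := {
  bI : countType;
  bV : lmodType R;
  bP : {pred bV};
  bA : bI -> bI -> int;
  alpha : bI -> bV;
  corr : bI -> bV -> R;
  bP0 : 0 \in bP;
  bPB : forall x y, x \in bP -> y \in bP -> x - y \in bP;
  alphaP : forall i, alpha i \in bP;
  corr_lin : forall i (a : R) (u v : bV), corr i (a *: u + v) = a * corr i u + corr i v;
  corr_int : forall i x, x \in bP -> exists z : int, corr i x = z%:~R;
  corr_alpha : forall i j, corr i (alpha j) = (bA i j)%:~R;
  bA_diag : forall i, bA i i = 2 \/ bA i i <= 0;
  bA_off : forall i j, i != j -> bA i j <= 0;
  bA_sym0 : forall i j, bA i j = 0 <-> bA j i = 0;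
  alpha_indep : forall (s : seq bI) (c : bI -> int), uniq s ->
     \sum_(i <- s) (c i)%:~R *: alpha i = 0 -> forall i, i \in s -> c i = 0;
  corr_indep : forall (s : seq bI) (c : bI -> int), uniq s ->
     (forall x, x \in bP -> \sum_(i <- s) (c i)%:~R * corr i x = 0) ->
     forall i, i \in s -> c i = 0
}.

Section BC.
Variable R : realType.
Variable D : BCdatum R.
Local Notation I := (bI D).
Local Notation V := (bV D).
Local Notation A := (@bA R D).
Local Notation a_ := (@alpha R D).
Local Notation cv := (@corr R D).

Definition isreal (i : I) : bool := A i i == 2.

Definition dominant (l : V) : Prop := l \in @bP R D /\ forall i, 0 <= cv i l.

Definition refl (i : I) (mu : V) : V := mu - cv i mu *: a_ i.
Definition act (w : seq I) (mu : V) : V := foldr refl mu w.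
Definition realword (w : seq I) : bool := all isreal w.

(* order of r_i r_j for real i <> j (0 encodes "infinite") *)
Definition ordm (i j : I) : nat :=
  let p := A i j * A j i in
  if p == 0 then 2%N else if p == 1 then 3%N else if p == 2 then 4%N
  else if p == 3 then 6%N else 0%N.

Inductive wrel : seq I -> seq I -> Prop :=
| wr_inv i : isreal i -> wrel [:: i; i] [::]
| wr_braid i j : isreal i -> isreal j -> i != j -> ordm i j != 0%N ->
    wrel (flatten (nseq (ordm i j) [:: i; j])) [::]
| wr_comm i j : ~~ isreal i -> j != i -> A i j = 0 -> wrel [:: i; j] [:: j; i].

(* the congruence on words generated by wrel: W = words / weq *)
Inductive weq : seq I -> seq I -> Prop :=
| weq_refl u : weq u u
| weq_sym u v : weq u v -> weq v u
| weq_trans u v w : weq u v -> weq v w -> weq u w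
| weq_rel x u v y : wrel u v -> weq (x ++ u ++ y) (x ++ v ++ y).

Definition lenlt (w w' : seq I) : Prop :=
  exists u, weq u w /\ forall v, weq v w' -> (size u < size v)%N.

Definition inQplus (v : V) : Prop :=
  exists (s : seq I) (c : I -> nat), v = \sum_(i <- s) (c i)%:R *: a_ i.

(* (u, i) represents a root beta = u alpha_i in Delta^+_re \sqcup Delta_im,
   with u a word in the real simple reflections (an element of W_re). *)
Definition proot (u : seq I) (i : I) : Prop :=
  realword u /\ (isreal i -> inQplus (act u (a_ i))).
Definition rword (u : seq I) (i : I) : seq I := u ++ i :: rev u.
Definition rbeta (u : seq I) (i : I) (mu : V) : V := act (rword u i) mu.
Definition cobeta (u : seq I) (i : I) (mu : V) : R := cv i (act (rev u) mu).

Definition bedge (w w' : seq I) : Prop :=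
  exists u i, proot u i /\ weq w' (rword u i ++ w) /\ lenlt w w'.
Inductive bruhat_le : seq I -> seq I -> Prop :=
| ble_eq w w' : weq w w' -> bruhat_le w w'
| ble_step w w1 w' : bruhat_le w w1 -> bedge w1 w' -> bruhat_le w w'.

Inductive wge (mu : V) : V -> Prop :=
| wge_refl : wge mu mu
| wge_step x y u i : wge mu x -> proot u i -> x = rbeta u i y ->
    0 < cobeta u i y -> wge mu y.

Definition covers (mu nu : V) : Prop :=
  [/\ wge mu nu, mu <> nu &
      forall xi, wge mu xi -> wge xi nu -> xi = mu \/ xi = nu].

Definition aarrow (a : rat) (mu nu : V) : Prop :=
  exists u i, [/\ proot u i, mu = rbeta u i nu, 0 < cobeta u i nu,
     covers mu nu &
     (if isreal i then (exists z : int, (0 < z)%R /\ ratr a * cobeta u i nu = z%:~R)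
      else ratr a * cobeta u i nu = 1)].

Inductive achain (a : rat) (mu : V) : V -> Prop :=
| ach_refl : achain a mu mu
| ach_step x y : achain a mu x -> aarrow a x y -> achain a mu y.

Definition inWorbit (l mu : V) : Prop := exists w, act w l = mu.
Definition inWreorbit (l mu : V) : Prop := exists w, realword w /\ act w l = mu.

Definition GLS (lam : V) (k : nat) (lf : nat -> V) (af : nat -> rat) : Prop :=
  [/\ (0 < k)%N, af 0%N = 0, af k = 1 &
      forall s, (s < k)%N -> af s < af s.+1] /\
  [/\ forall s, (1 <= s <= k)%N -> inWorbit lam (lf s),
      forall s, (1 <= s < k)%N -> wge (lf s) (lf s.+1) /\ lf s <> lf s.+1,
      forall s, (1 <= s < k)%N -> achain (af s) (lf s) (lf s.+1) &
      achain 1 (lf k) lam].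

(* the associated piecewise-linear path: on [af (s-1), af s] it equals
   sum_{l<s} (af l - af (l-1)) lf l + (t - af (s-1)) lf s *)
Definition lsfun (k : nat) (lf : nat -> V) (af : nat -> rat) (t : R) : V :=
  \sum_(1 <= l < k.+1)
     Num.max 0 (Num.min t (ratr (af l)) - ratr (af l.-1)) *: lf l.

Definition straight (mu : V) (t : R) : V := t *: mu.

Definition concat_rel (ps : seq (R -> V)) (p : R -> V) : Prop :=
  let n := size ps in
  forall m : nat, (1 <= m <= n)%N -> forall t : R,
    (m.-1)%:R / n%:R <= t <= m%:R / n%:R ->
    p t = \sum_(l < m.-1) nth (fun _ => 0) ps l 1
          + nth (fun _ => 0) ps m.-1 (n%:R * t - (m.-1)%:R).

(* root operator: fi_rel i p q  <->  f_i p = q  (q <> 0), equality on [0,1] *)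
Definition fi_rel (i : I) (p q : R -> V) : Prop :=
  let H := fun t => cv i (p t) in
  exists (m : int) (fp fm : R),
  [/\ (exists t, 0 <= t <= 1 /\ H t = m%:~R),
      (forall t, 0 <= t <= 1 -> (exists z : int, H t = z%:~R) -> m%:~R <= H t),
      [/\ 0 <= fp, fp < 1, H fp = m%:~R &
          forall t, 0 <= t <= 1 -> H t = m%:~R -> t <= fp],
      [/\ fp <= fm, fm <= 1, H fm = (m + 1)%:~R &
          forall t, fp <= t <= 1 -> H t = (m + 1)%:~R -> fm <= t] &
      forall t, 0 <= t <= 1 ->
        q t = (if t <= fp then p t
               else if t <= fm then p t - (H t - m%:~R) *: a_ i
               else p t - a_ i)].

Inductive Freach (p : R -> V) : (R -> V) -> Prop :=
| fr_refl q : (forall t, 0 <= t <= 1 -> p t = q t) -> Freach p q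
| fr_step q q' i : Freach p q -> fi_rel i q q' -> Freach p q'.

Definition standard (lams : seq V) (p : R -> V) : Prop :=
  exists base, concat_rel [seq straight l | l <- lams] base /\ Freach base p.

End BC.

(* Main.v *)
(* A concatenation of GLS paths on [[0, n]] is encoded by a list of pieces carrying words of the monoid, where
   consecutive pieces are linked by a chain for the weights of their factor and by a Bruhat-type inequality for the
   weights of all factors up to theirs.  Conditions (3) and (4) say exactly that the links at the junctions of two
   factors hold, so the paths admitting a lift as in the theorem are the paths of such lists.

   These lists are stable under the root operators.  For real z, f_z reflects a stretch on which the height H_z
   rises from its minimum m to m + 1, and chains can be reflected since a cover never crosses a wall downwards; for
   imaginary z, H_z is nondecreasing, m = 0, and f_z reflects everything up to the time where H_z reaches 1.
   Hence standard paths lift.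

   Conversely, let a path of such a list be not straight.  If some H_z with z real takes a negative value, e_z
   applies.  Otherwise the first non-straight piece has a dominant direction mu, the first step of its chain must
   then be a simple imaginary reflection mu = r_k x with H_k = 1 at the end of that direction, and replacing mu by x
   inverts f_k.  Both moves lower by 1 the total height of the path below the straight one, so they terminate.

   The positivity facts come from the lemma that, for a dominant weight x, alpha_k^vee(w x) >= 0 as soon as k is
   imaginary or k w is longer than w. *)
Require Import Defs.
From HB Require Import structures.
From mathcomp Require Import all_boot all_order all_algebra.
From mathcomp Require Import boolp functions reals.
From mathcomp Require Import zify ring lra.
Set Implicit Arguments. Unset Strict Implicit. Unset Printing Implicit Defensive.
Import Order.TTheory GRing.Theory Num.Theory.
Local Open Scope ring_scope.

(** * Words and length *)

Section Words.
Variables (R : realType) (D : BCdatum R).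
Local Notation I := (bI D).
Local Notation isr := (@isreal R D).
Implicit Types (u v w : seq I) (i j : I).

(** Imaginary generators have no inverse, and the Cartan matrix is not assumed symmetrizable, so
    neither Coxeter group theory nor an invariant form is at hand. Both are replaced by one
    induction on length, [length_pos], over an abstract reflection module. Dominant weights give
    signs of pairings; the contragredient module gives signs of root coordinates; a regular weight
    in an extended datum gives strict signs, from which a real reflection that should shorten a word
    is shown to do so. Lengths and signs of pairings then determine each other up to zeros. For
    imaginary [j] the weight [- alpha j] is dominant, so the same results govern imaginary roots.

    The zeros are the second difficulty: weights may be singular, and an inequality in one orbit
    forgets most of the word. Words are therefore compared through their action on tuples of
    weights, and true Bruhat inequalities are recovered only at the end, from right to left.

    The coefficient of a chain is the local time inside the current factor. At a junction this is 1,
    so the chains inside a factor and the 1-chains between factors become one condition, and heights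
    are integral wherever a real slope turns from negative to nonnegative. *)

Lemma weq_cat u u' v v' : weq u u' -> weq v v' -> weq (u ++ v) (u' ++ v').
Proof.
have ctx (x a b y : seq I) : weq a b -> weq (x ++ a ++ y) (x ++ b ++ y).
  elim=> {a b} [a|a b _ IH|a b c _ IH1 _ IH2|x' a b y' H].
  - exact: weq_refl.
  - exact: weq_sym.
  - exact: weq_trans IH1 IH2.
  - have := weq_rel (x ++ x') (y' ++ y) H; by rewrite -!catA.
move=> H1 H2; apply: (@weq_trans _ _ _ (u' ++ v)); first exact: (ctx [::] _ _ v H1).
by have := ctx u' _ _ [::] H2; rewrite !cats0.
Qed.

Lemma weq_cons i u v : weq u v -> weq (i :: u) (i :: v).
Proof. move=> H; exact: (@weq_cat [:: i] [:: i] _ _ (weq_refl _) H). Qed.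

Lemma weq_invl i u : isr i -> weq [:: i, i & u] u.
Proof. by move=> ri; have := weq_rel [::] u (wr_inv ri). Qed.

Lemma weq_revr u : realword u -> weq (u ++ rev u) [::].
Proof.
elim: u => [|i u IH] /=; first by move=> _; exact: weq_refl.
case/andP=> ri ru; rewrite rev_cons -cats1 catA.
apply: (@weq_trans _ _ _ ([:: i] ++ [::] ++ [:: i])).
  exact: (@weq_cat [:: i] [:: i] _ _ (weq_refl _) (weq_cat (IH ru) (weq_refl _))).
exact: weq_invl.
Qed.

Lemma realword_rev u : realword (rev u) = realword u.
Proof. by rewrite /realword all_rev. Qed.

Lemma weq_revl u : realword u -> weq (rev u ++ u) [::].
Proof. by move=> ru; have := @weq_revr (rev u); rewrite revK realword_rev; apply. Qed.

(** Every relation has sides of equal length parity (the sign character). This sharpens the length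
    inequalities for a real letter to a change by exactly one. *)
Lemma odd_weq u v : weq u v -> odd (size u) = odd (size v).
Proof.
elim=> {u v} [//|u v _ -> //|u v w _ -> _ -> //|x u v y H].
rewrite !size_cat !oddD; congr (_ (+) (_ (+) _)); case: H => //= i j _ _ _ _.
by elim: (ordm i j) => //= n ->; rewrite negbK.
Qed.

Lemma len_ex w : exists n, `[< exists u, weq u w /\ size u = n >].
Proof. by exists (size w); apply/asboolP; exists w; split => //; exact: weq_refl. Qed.
Definition len w : nat := ex_minn (len_ex w).

Lemma len_reduced w : exists2 u, weq u w & size u = len w.
Proof. by rewrite /len; case: ex_minnP => n /asboolP [u [H <-]] _; exists u. Qed.

Lemma len_le u w : weq u w -> (len w <= size u)%N.
Proof. by move=> H; rewrite /len; case: ex_minnP => n _; apply; apply/asboolP; exists u. Qed.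

Lemma len_weq u w : weq u w -> len u = len w.
Proof.
have le (x y : seq I) : weq x y -> (len x <= len y)%N.
  have [v Hv <-] := len_reduced y => H; apply: len_le.
  exact: weq_trans Hv (weq_sym H).
by move=> H; apply/eqP; rewrite eqn_leq !le //; exact: weq_sym.
Qed.

Lemma lenltE w w' : lenlt w w' <-> (len w < len w')%N.
Proof.
split=> [[u [Hu Hs]]|H].
  have [v Hv <-] := len_reduced w'; apply: leq_ltn_trans (Hs v Hv); exact: len_le.
have [u Hu Hs] := len_reduced w; exists u; split=> // v Hv.
by rewrite Hs; apply: leq_trans H _; exact: len_le.
Qed.

Lemma len_size w : (len w <= size w)%N. Proof. exact: len_le (weq_refl w). Qed.

Lemma len_cat u w : (len (u ++ w) <= size u + len w)%N.
Proof.
have [v Hv <-] := len_reduced w; rewrite -size_cat; apply: len_le.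
exact: weq_cat (weq_refl _) Hv.
Qed.

Lemma len_cons i w : (len (i :: w) <= (len w).+1)%N.
Proof. exact: (len_cat [:: i]). Qed.

Lemma odd_len w : odd (len w) = odd (size w).
Proof. by have [u Hu <-] := len_reduced w; rewrite (odd_weq Hu). Qed.

Lemma len_consK i w : isr i -> (len w <= (len (i :: w)).+1)%N.
Proof. by move=> ri; rewrite -(len_weq (weq_invl w ri)); exact: len_cons. Qed.

Lemma len_realVN i w : isr i -> ~~ (len w < len (i :: w))%N -> (len (i :: w)).+1 = len w.
Proof.
move=> ri; have H1 := len_cons i w; have H2 := len_consK w ri.
have: odd (len (i :: w)) = ~~ odd (len w) by rewrite !odd_len.
lia.
Qed.

Definition reduced w := size w = len w.

Lemma reduced_cons i w : reduced (i :: w) -> reduced w /\ (len w < len (i :: w))%N.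
Proof.
rewrite /reduced /= => H; have H1 := len_cons i w; have := len_size w; lia.
Qed.

Lemma reduced_ex w : exists2 u, reduced u & weq u w.
Proof. by have [u H1 H2] := len_reduced w; exists u => //; rewrite /reduced H2 (len_weq H1). Qed.

Fixpoint alt i j s : seq I := if s is s'.+1 then i :: alt j i s' else [::].

Lemma size_alt i j s : size (alt i j s) = s.
Proof. by elim: s i j => //= s IH i j; rewrite IH. Qed.

Lemma realword_alt i j s : isr i -> isr j -> realword (alt i j s).
Proof.
by move=> ri rj; elim: s i j ri rj => //= s IH i j ri rj; rewrite ri; exact: IH.
Qed.

Lemma alt_cat i j s t :
  alt i j (s + t) = alt i j s ++ (if odd s then alt j i t else alt i j t).
Proof.
by elim: s i j => //= s IH i j; rewrite IH; case: (odd s).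
Qed.

Lemma alt_braid i j m : flatten (nseq m [:: i; j]) = alt i j m.*2.
Proof. by elim: m => //= m ->. Qed.

(** The braid relation has [2m] letters. Cutting it after [m + 1] of them and inverting the rest
    replaces [m + 1] alternating letters by [m - 1]. *)
Lemma alt_short i j s : isr i -> isr j -> i != j -> ordm i j != 0%N ->
  (ordm i j < s)%N -> (len (alt i j s) < s)%N.
Proof.
move=> ri rj nij om lt_s; set m := ordm i j in om lt_s *.
have Hb : weq (alt i j m.*2) [::].
  by rewrite -alt_braid; have := weq_rel [::] [::] (wr_braid ri rj nij om); rewrite /= cats0.
have E : (s = m.+1 + (s - m.+1))%N by lia.
have E2 : (m.*2 = m.+1 + m.-1)%N by move: om; lia.
rewrite E2 alt_cat in Hb; rewrite E alt_cat.
set x := if _ then _ else _ in Hb; set y := if _ then _ else _.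
have rx : realword x by rewrite /x; case: ifP => _; apply: realword_alt.
have Hx : weq (alt i j m.+1) (rev x).
  apply: (@weq_trans _ _ _ (alt i j m.+1 ++ (x ++ rev x))).
    rewrite -{1}[alt i j m.+1]cats0; apply: weq_cat (weq_refl _) _; apply: weq_sym.
    exact: weq_revr.
  rewrite catA; exact: (weq_cat Hb (weq_refl (rev x))).
rewrite -E (leq_ltn_trans (len_le (weq_sym (weq_cat Hx (weq_refl y))))) //.
rewrite size_cat size_rev.
have -> : size x = m.-1 by rewrite /x; case: ifP; rewrite size_alt.
have -> : size y = (s - m.+1)%N by rewrite /y; case: ifP; rewrite size_alt.
by move: om; lia.
Qed.

Lemma len_cat2 u w : (len (u ++ w) <= len u + len w)%N.
Proof.
have [v Hv <-] := len_reduced u.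
by rewrite -(len_weq (weq_cat Hv (weq_refl w))); exact: len_cat.
Qed.

Lemma alt_of_norep i j t : all (mem [:: i; j]) t -> (forall x a y, t <> x ++ [:: a; a] ++ y) ->
  t = alt i j (size t) \/ t = alt j i (size t).
Proof.
elim: t => [|b t IH] /=; first by left.
case/andP=> Hb Ht norep.
have {}IH : t = alt i j (size t) \/ t = alt j i (size t).
  by apply: IH => // x a y E; apply: (norep (b :: x) a y); rewrite E.
move: Hb; rewrite !inE => /orP [/eqP Eb|/eqP Eb]; subst b.
- case: IH => E; [|by left; rewrite -E].
  case: t E norep {Ht} => [|c t] E norep; first by left.
  by case: E => Ec _; case: (norep [::] c t); rewrite Ec.
- case: IH => E; [by right; rewrite -E|].
  case: t E norep {Ht} => [|c t] E norep; first by right.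
  by case: E => Ec _; case: (norep [::] c t); rewrite Ec.
Qed.

End Words.

Lemma le0_mulz (b c : int) (n : nat) : b <= 0 -> c <= 0 -> b * c = n ->
  exists m l : nat, [/\ b = - (m%:Z), c = - (l%:Z) & (m * l = n)%N].
Proof.
move=> b0 c0 H; exists `|b|%N, `|c|%N; split; [lia|lia|].
by rewrite -abszM H.
Qed.

Lemma le0_mulz1 (b c : int) : b <= 0 -> c <= 0 -> b * c = 1 -> b = -1 /\ c = -1.
Proof.
move=> b0 c0 /(@le0_mulz _ _ 1 b0 c0) [m [l [-> -> /eqP]]].
by rewrite muln_eq1 => /andP [/eqP -> /eqP ->].
Qed.

Lemma le0_mulz23 (b c : int) (n : nat) : b <= 0 -> c <= 0 -> b * c = n ->
  n = 2%N \/ n = 3%N -> (b = -1 /\ c = - (n%:Z)) \/ (b = - (n%:Z) /\ c = -1).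
Proof.
move=> b0 c0 /(le0_mulz b0 c0) [m [l [-> -> ml]]] n23.
have lm : (m <= n)%N by case: l ml => [|l] ml; [case: n23 => n23; lia|rewrite -ml leq_pmulr].
case: m ml lm => [|[|[|[|m]]]] ml lm; first (by case: n23; lia); last by case: n23; lia.
- by left; split; lia.
- by case: n23 => n23; [right; split; lia|lia].
- by case: n23 => n23; [lia|right; split; lia].
Qed.

(** * Reflection modules: the action of the monoid and positivity along words *)

Section ReflectionModule.
Variables (R : realType) (D : BCdatum R).
Local Notation I := (bI D).
Local Notation isr := (@isreal R D).
Implicit Types (u v w : seq I) (i j k : I).
Variables (B : I -> I -> int) (M : lmodType R) (a : I -> M) (f : I -> M -> R).
Hypothesis f_lin : forall i (c : R) (u v : M), f i (c *: u + v) = c * f i u + f i v.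
Hypothesis f_a : forall i j, f i (a j) = (B i j)%:~R.
Hypothesis B_re : forall i, isr i -> B i i = 2.
Hypothesis B_im : forall i, ~~ isr i -> B i i <= 0.
Hypothesis B_off : forall i j, i != j -> B i j <= 0.
Hypothesis B_sym0 : forall i j, B i j = 0 -> B j i = 0.
Hypothesis B_prod : forall i j, B i j * B j i = bA i j * bA j i.
Hypothesis B_A0 : forall i j, bA i j = 0 -> B i j = 0.

(** [B] is kept apart from the Cartan matrix because the module is used both with that matrix and
    with its transpose; [B_prod] ensures that the braid orders agree. *)
Definition grefl i (x : M) : M := x - f i x *: a i.
Definition gact w x := foldr grefl x w.

Lemma f_sub k x c y : f k (x - c *: y) = f k x - c * f k y.
Proof. by rewrite addrC -scaleNr f_lin mulNr addrC. Qed.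

Lemma f_grefl k i x : f k (grefl i x) = f k x - f i x * (B k i)%:~R.
Proof. by rewrite /grefl f_sub f_a. Qed.

Lemma gact_cat u v x : gact (u ++ v) x = gact u (gact v x).
Proof. by rewrite /gact foldr_cat. Qed.

Lemma f_gact_cons k i w x :
  f k (gact (i :: w) x) = f k (gact w x) - f i (gact w x) * (B k i)%:~R.
Proof. exact: f_grefl. Qed.

Lemma greflK i : isr i -> involutive (grefl i).
Proof.
move=> ri x; rewrite {1}/grefl f_grefl B_re // /grefl.
rewrite -addrA -opprD -scalerDl.
have -> : f i x + (f i x - f i x * 2%:~R) = 0 by rewrite -[2%:~R]/(2%:R); ring.
by rewrite scale0r subr0.
Qed.

Lemma f_lc k x p q i j :
  f k (x + p *: a i + q *: a j) = f k x + p * (B k i)%:~R + q * (B k j)%:~R.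
Proof.
rewrite addrC f_lin [x + _]addrC f_lin !f_a; ring.
Qed.

Lemma gact_ij i j x p q b c X Y : isr i -> isr j ->
  (B i j)%:~R = b -> (B j i)%:~R = c -> f i x = X -> f j x = Y ->
  gact [:: i; j] (x + p *: a i + q *: a j) =
  x + (- p - X - (- q - Y - p * c) * b) *: a i + (- q - Y - p * c) *: a j.
Proof.
move=> ri rj Eb Ec EX EY; rewrite /= /grefl.
have -> : x + p *: a i + q *: a j - f j (x + p *: a i + q *: a j) *: a j =
   x + p *: a i + (- q - Y - p * c) *: a j.
  rewrite -addrA -scaleNr -scalerDl f_lc (B_re rj) EY Ec; congr (_ + _ *: _).
  rewrite -[2%:~R]/(2%:R); ring.
rewrite f_lc (B_re ri) EX Eb -!addrA; congr (_ + _).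
rewrite addrCA [RHS]addrC; congr (_ + _).
rewrite -scaleNr -scalerDl; congr (_ *: _).
rewrite -[2%:~R]/(2%:R); ring.
Qed.

Lemma gact_weq u v : weq u v -> gact u =1 gact v.
Proof.
elim=> {u v} [//|u v _ IH x|u v w _ IH1 _ IH2 x|x u v y H t].
- by rewrite IH.
- by rewrite IH1.
rewrite !gact_cat; congr gact; move: (gact y t) => {}t; case: H => {u v x y}.
- by move=> i ri; exact: greflK.
- move=> i j ri rj nij om; rewrite [RHS](_ : _ = t + 0); last by rewrite addr0.
  set b : R := (B i j)%:~R; set c : R := (B j i)%:~R.
  set X := f i t; set Y := f j t.
  (* The orbit of [t] stays in [t + span(a i, a j)]. In the coordinates [(p, q)] each braid relation
     is a polynomial identity in [X], [Y] once the Cartan integers are known. *)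
  have step p q : gact [:: i; j] (t + p *: a i + q *: a j) =
    t + (- p - X - (- q - Y - p * c) * b) *: a i + (- q - Y - p * c) *: a j.
    exact: gact_ij.
  have start : t = t + 0 *: a i + 0 *: a j by rewrite !scale0r !addr0.
  have fin p q : p = 0 -> q = 0 -> t + p *: a i + q *: a j = t + 0.
    by move=> -> ->; rewrite !scale0r !addr0.
  have Bij := B_off nij; have Bji : B j i <= 0 by apply: B_off; rewrite eq_sym.
  have Ecat m : gact (flatten (nseq m.+1 [:: i; j])) t =
     gact [:: i; j] (gact (flatten (nseq m [:: i; j])) t) by rewrite -gact_cat.
  have E0 : gact (flatten (nseq 0 [:: i; j])) t = t + 0 *: a i + 0 *: a j by [].
  move: om; rewrite /ordm -B_prod.
  case: (B i j * B j i =P 0) => [H0 _|_].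
    have [b0 c0] : b = 0 /\ c = 0.
      rewrite /b /c; move/eqP: H0; rewrite mulf_eq0 => /orP [/eqP H|/eqP H].
        by rewrite H (B_sym0 H).
      by rewrite H (B_sym0 H).
    rewrite !Ecat E0 !step.
    apply: fin; rewrite b0 c0; ring.
  case: (B i j * B j i =P 1) => [H1 _|_].
    have [b0 c0] : b = -1 /\ c = -1.
      by have [E1 E2] := le0_mulz1 Bij Bji H1; rewrite /b /c E1 E2; split; rewrite rmorphN.
    rewrite !Ecat E0 !step.
    apply: fin; rewrite b0 c0; ring.
  case: (B i j * B j i =P 2) => [H2 _|_].
    have : (b = -1 /\ c = -2) \/ (b = -2 /\ c = -1).
      have := @le0_mulz23 _ _ 2 Bij Bji H2 (or_introl erefl).
      by rewrite /b /c => -[[E1 E2]|[E1 E2]]; [left|right]; rewrite E1 E2; split; rewrite rmorphN.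
    rewrite !Ecat E0 !step.
    by case=> [[b0 c0]|[b0 c0]]; apply: fin; rewrite b0 c0; ring.
  case: (B i j * B j i =P 3) => [H3 _|//].
    have : (b = -1 /\ c = -3) \/ (b = -3 /\ c = -1).
      have := @le0_mulz23 _ _ 3 Bij Bji H3 (or_intror erefl).
      by rewrite /b /c => -[[E1 E2]|[E1 E2]]; [left|right]; rewrite E1 E2; split; rewrite rmorphN.
    rewrite !Ecat E0 !step.
    by case=> [[b0 c0]|[b0 c0]]; apply: fin; rewrite b0 c0; ring.
- move=> i j ni nji /B_A0 Bij; have Bji := B_sym0 Bij.
  rewrite /= {1}/grefl {3}/grefl !f_grefl Bij Bji !mulr0 !subr0.
  by rewrite /grefl -!addrA [- _ - _]addrC.
Qed.

Section Positivity.
Variable P : R -> Prop.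
Hypothesis P_ge0 : forall x, P x -> 0 <= x.
Hypothesis P_add : forall x y, P x -> 0 <= y -> P (x + y).
Variable x0 : M.
Hypothesis x0_dom : forall k, P (f k x0).

Lemma P_lc (x y : R) (p q : nat) : P x -> P y -> (0 < p + q)%N -> P (p%:R * x + q%:R * y).
Proof.
move=> Px Py; case: p => [|p] H.
  case: q H => // q _; rewrite mul0r add0r -addn1 natrD mulrDl mul1r addrC.
  by apply: P_add => //; rewrite mulr_ge0 // P_ge0.
rewrite -addn1 natrD mulrDl mul1r [_ + x]addrC -addrA; apply: P_add => //.
by rewrite addr_ge0 // mulr_ge0 // P_ge0.
Qed.

(* The value of [f i] along alternating words obeys [a_(s+2) = (pq - 2) a_s - a_(s-2)]. *)
Lemma dihedral_pos i j v s : isr i -> isr j -> i != j ->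
  P (f i (gact v x0)) -> P (f j (gact v x0)) ->
  (ordm i j != 0%N -> (s < ordm i j)%N) ->
  P (f i (gact (alt j i s) (gact v x0))).
Proof.
move=> ri rj nij; set y := gact v x0; set X := f i y; set Y := f j y => PX PY.
have Bij := B_off nij; have Bji : B j i <= 0 by apply: B_off; rewrite eq_sym.
set p : int := - B i j; set q : int := - B j i.
pose A s := f i (gact (alt j i s) y); pose C s := f j (gact (alt i j s) y).
have pR : (B i j)%:~R = - p%:~R :> R by rewrite /p rmorphN /= opprK.
have qR : (B j i)%:~R = - q%:~R :> R by rewrite /q rmorphN /= opprK.
have A1 n : A n.+1 = p%:~R * C n + f i (gact (alt i j n) y).
  by rewrite /A /C /= f_grefl pR; ring.
have A2 n : A n.+2 = p%:~R * C n.+1 - A n.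
  rewrite A1; congr (_ + _); rewrite /A /= f_grefl B_re // -[2%:~R]/(2%:R); ring.
have C1 n : C n.+1 = q%:~R * A n + f j (gact (alt j i n) y).
  by rewrite /A /C /= f_grefl qR; ring.
have C2 n : C n.+2 = q%:~R * A n.+1 - C n.
  rewrite C1; congr (_ + _); rewrite /C /= f_grefl B_re // -[2%:~R]/(2%:R); ring.
have eA0 : A 0%N = X by []. have eC0 : C 0%N = Y by [].
have eA1 : A 1%N = p%:~R * Y + X by rewrite A1.
have eC1 : C 1%N = q%:~R * X + Y by rewrite C1.
have eA2 : A 2%N = (p * q - 1)%:~R * X + p%:~R * Y by rewrite A2 eC1 eA0 rmorphB rmorphM /=; ring.
have rec n : A n.+4 = (p * q - 2)%:~R * A n.+2 - A n.
  by rewrite A2 C2 !A2 rmorphB rmorphM /=; ring.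
have eA3 : A 3%N = (p * q - 1)%:~R * X + ((p * q - 2) * p)%:~R * Y.
  by rewrite A2 C2 eA1 eC0 !(rmorphB, rmorphM) /=; ring.
have lc (c d : int) : 0 <= c -> 0 <= d -> 0 < c + d -> P (c%:~R * X + d%:~R * Y).
  case: c => // c _; case: d => // d _ H; apply: P_lc => //; lia.
have PA0 : P (A 0%N) by rewrite eA0.
have p0 : 0 <= p by rewrite /p oppr_ge0. have q0 : 0 <= q by rewrite /q oppr_ge0.
have PA1 : P (A 1%N) by rewrite eA1 addrC -[X]mul1r; apply: (lc 1); lia.
have Epq : bA i j * bA j i = p * q by rewrite -B_prod /p /q mulrNN.
rewrite -/(A s) /ordm Epq.
case: (p * q =P 0) => [_ /(_ isT)|n0]; first by case: s => [|[|s]].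
have [p1 q1] : 0 < p /\ 0 < q by nia.
case: (p * q =P 1) => [pq1 /(_ isT)|n1].
  case: s => [|[|[|s]]] // _; rewrite eA2 pq1; apply: lc; lia.
have PA2 : P (A 2%N) by rewrite eA2; apply: lc; nia.
have PA3 : P (A 3%N) by rewrite eA3; apply: lc; nia.
case: (p * q =P 2) => [pq2 /(_ isT)|n2]; first by case: s => [|[|[|[|s]]]].
case: (p * q =P 3) => [pq3 /(_ isT)|n3].
  case: s => [|[|[|[|[|[|s]]]]]] // _.
    rewrite rec eA2 pq3 eA0 (_ : _ - _ = 1%:~R * X + p%:~R * Y); first by apply: lc; lia.
    rewrite !(rmorphB, rmorphM) /=; ring.
  rewrite rec eA3 pq3 eA1 (_ : _ - _ = 1%:~R * X + 0%:~R * Y); first by apply: lc.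
  rewrite !(rmorphB, rmorphM) /=; ring.
(* Infinite dihedral case: the trace [pq - 2] is at least 2, so by the recurrence the values in each
   parity class increase from a positive start. *)
move=> _; have pq4 : 4 <= p * q by nia.
have mono n : P (A n) /\ A n <= A n.+2.
  have [n2l] := ubnP n; elim: n2l n => // n2l IH [|[|n]] ltn.
  - split=> //; rewrite eA0 eA2 -subr_ge0 (_ : _ - _ = (p * q - 2)%:~R * X + p%:~R * Y).
      by apply/P_ge0/lc; lia.
    by rewrite !rmorphB /=; ring.
  - split=> //; rewrite eA1 eA3 -subr_ge0.
    rewrite (_ : _ - _ = (p * q - 2)%:~R * X + ((p * q - 3) * p)%:~R * Y).
      by apply/P_ge0/lc; nia.
    rewrite !(rmorphB, rmorphM) /=; ring.
  have [Pn le] := IH n ltac:(lia).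
  have Pn2 : P (A n.+2) by rewrite -(subrK (A n) (A n.+2)) addrC; apply: P_add; rewrite // subr_ge0.
  split=> //; rewrite rec.
  have : (2%:R : R) <= (p * q - 2)%:~R by rewrite -[2%:R]/(2%:~R) ler_int; lia.
  have := P_ge0 Pn2; nra.
by have [] := mono s.
Qed.

(** Induction on the length, removing the first letter [j] of a reduced word. An imaginary letter
    only adds nonnegative terms; for two real letters the problem reduces to the dihedral pair. [P]
    stands for nonnegativity or for strict positivity. *)
Theorem length_pos w k :
  (isr k -> (len w < len (k :: w))%N) -> P (f k (gact w x0)).
Proof.
have [n] := ubnP (len w); elim: n w k => // n IH w k ltn Hk.
have [u Ru Hu] := reduced_ex w.
move: Ru Hu; case: u => [|j w'] Ru Hu; first by rewrite -(gact_weq Hu); exact: x0_dom.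
have [Rw' lw'] := reduced_cons Ru; have Elw := len_weq Hu.
have lt' : (len w' < n)%N by move: lw' ltn; rewrite Elw; lia.
have IHj : P (f j (gact w' x0)) by exact: IH.
rewrite -(gact_weq Hu).
have imag : P (f k (gact w' x0)) -> B k j <= 0 -> P (f k (gact (j :: w') x0)).
  move=> Pk B0; rewrite f_gact_cons -mulrN; apply: P_add => //.
  by apply: mulr_ge0; [exact: P_ge0|rewrite oppr_ge0 lerz0].
case: (boolP (isr k)) => [rk|ik]; last first.
  apply: imag; first by apply: IH; rewrite ?(negbTE ik).
  by case: (eqVneq k j) => [<-|/B_off //]; exact: B_im.
have {}Hk := Hk rk.
have nkj : k != j.
  apply/eqP => Ekj; move: Hk lw'; rewrite -Elw -(len_weq (weq_cons k Hu)) Ekj.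
  by rewrite (len_weq (weq_invl w' _)) -?Ekj // Ekj; lia.
case: (boolP (isr j)) => [rj|ij]; last first.
  case: (ltnP (len w') (len (k :: w'))) => [lt|ge].
    by apply: imag; [exact: IH|exact: B_off].
  have El := len_realVN rk (negbT (leq_gtF ge)); set w2 := k :: w' in El.
  have Hw2 : weq (k :: w2) w' by exact: weq_invl.
  clearbody w2; have Pc : P (f k (gact w2 x0)).
    by apply: IH => [|_]; rewrite ?(len_weq Hw2); lia.
  have Pd : P (f j (gact w2 x0)) by apply: IH; rewrite ?(negbTE ij) //; lia.
  rewrite f_gact_cons -(gact_weq Hw2) !f_gact_cons B_re //.
  set c := f k _ in Pc *; set d := f j _ in Pd *.
  (* Orthogonal letters commute, and [k w] would shorten to [j w2]. Otherwise both Cartan integers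
     are at most -1, so the negative term [- c] left by the double reflection in [k] is absorbed by
     [B j k * B k j * c]. *)
  case: (B k j =P 0) => [B0|/eqP B0].
    have A0 : bA j k = 0.
      by have := B_prod k j; rewrite B0 mul0r => /esym/eqP; rewrite mulf_eq0 => /orP [/eqP/bA_sym0|/eqP].
    suff : (len (k :: w) <= len w')%N by move: Hk lw'; rewrite Elw; lia.
    have H : weq (k :: w) (j :: w2).
      apply: (@weq_trans _ _ _ [:: k, k, j & w2]); last exact: weq_invl.
      apply: weq_cons; apply: (weq_trans (weq_sym Hu)).
      apply: (@weq_trans _ _ _ [:: j, k & w2]); first exact: weq_cons (weq_sym Hw2).
      exact: (@weq_rel _ _ [::] _ _ w2 (wr_comm ij nkj A0)).
    by rewrite (len_weq H) -El; exact: len_cons.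
  have Bkj : B k j <= -1 by have := B_off nkj; lia.
  have Bjk : B j k <= -1.
    have := B_off (i := j) (j := k); rewrite eq_sym => /(_ nkj).
    by case: (B j k =P 0) => [/B_sym0 E|]; [rewrite E in B0|lia].
  have -> : c - c * 2%:~R - (d - c * (B j k)%:~R) * (B k j)%:~R =
     d + ((- B k j - 1)%:~R * d + (B j k * B k j - 1)%:~R * c).
    rewrite !(rmorphB, rmorphN, rmorphM) /=; ring.
  apply: P_add => //; apply: addr_ge0; apply: mulr_ge0; rewrite ?ler0z; first [exact: P_ge0|nia].
(* Parabolic factorization [w = t v] with additive lengths, [t] a word in [k] and [j], and [v] as
   short as possible. Minimality makes both [k v] and [j v] longer than [v]. *)
pose Q l := `[< exists t v, [/\ all (mem [:: k; j]) t, weq (t ++ v) w,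
   (size t + len v = len w)%N & len v = l] >].
have exQ : exists l, Q l.
  exists (len w'); apply/asboolP; exists [:: j], w'; split => //=.
    by rewrite !inE eqxx orbT.
  by rewrite -Elw; move: Ru Rw'; rewrite /reduced /=; lia.
case: (ex_minnP exQ) => l /asboolP [t [v [At Hv Es El]]] minl.
have lev : (l <= len w')%N.
  apply: minl; apply/asboolP; exists [:: j], w'; split => //=.
    by rewrite !inE eqxx orbT.
  by rewrite -Elw; move: Ru Rw'; rewrite /reduced /=; lia.
have ltv : (len v < n)%N by rewrite El; lia.
have up i : i \in [:: k; j] -> isr i -> (len v < len (i :: v))%N.
  move=> Hi ri; case: ltnP => // ge.
  have E := len_realVN ri (negbT (leq_gtF ge)).
  suff : (l <= len (i :: v))%N by rewrite -El; lia.
  apply: minl; apply/asboolP; exists (t ++ [:: i]), (i :: v); split=> //.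
  - by rewrite all_cat At /= Hi.
  - rewrite -catA; apply: weq_trans Hv; apply: weq_cat (weq_refl _) _; exact: weq_invl.
  - by rewrite size_cat /= -Es -E addn1 addnS addSn.
have rt i : i \in [:: k; j] -> isr i by rewrite !inE => /orP [] /eqP ->.
have noshort t' : weq (t' ++ v) w -> (size t <= size t')%N.
  by move=> /len_weq E; have := len_cat t' v; rewrite E; lia.
have norep x b y : t <> x ++ [:: b; b] ++ y.
  move=> Et; have rb : isr b by apply: rt; apply: (allP At); rewrite Et mem_cat !inE eqxx orbT.
  have : weq ((x ++ y) ++ v) w.
    apply: weq_trans Hv; rewrite Et -!catA; apply: weq_cat (weq_refl _) _.
    exact: weq_sym (weq_invl _ rb).
  by move/noshort; rewrite Et !size_cat /=; lia.
(* [t] has no repeated letter, so it alternates. It cannot begin with [k], since [k w] would then be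
   shorter than [w]. *)
have Et : t = alt j k (size t).
  case: (alt_of_norep At norep) => // Et; case: (t =P [::]) => [->//|/eqP nt].
  have [t' Et'] : exists t', t = k :: t'.
    by case: (t) Et nt => [|b t'] //= -[-> _] _; exists t'.
  have : weq (t' ++ v) (k :: w).
    apply: (@weq_trans _ _ _ [:: k, k & t' ++ v]); first exact: weq_sym (weq_invl _ rk).
    by apply: weq_cons; rewrite -cat_cons -Et'.
  move/len_weq => E; have := len_cat t' v; rewrite E; move: Es Hk; rewrite Et' /=; lia.
rewrite (gact_weq Hu) -(gact_weq Hv) gact_cat Et.
apply: dihedral_pos => //.
- by apply: IH => // _; apply: up; rewrite ?inE ?eqxx.
- by apply: IH => // _; apply: up; rewrite ?inE ?eqxx ?orbT.
(* If [t] reached the braid order, the alternating word [k t] would not be reduced and [k w] would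
   not be longer than [w]. *)
move=> om; rewrite ltnNge; apply/negP => ge.
have := @alt_short _ _ k j (size t).+1 rk rj nkj om; rewrite ltnS => /(_ ge) lt.
have := len_cat2 (alt k j (size t).+1) v; rewrite /= -Et.
rewrite (len_weq (weq_cons k Hv)); move: lt; rewrite /= -Et => lt le.
move: le; rewrite leqNgt => /negP; apply; apply: leq_trans Hk.
by rewrite ltnS -Es leq_add2r.
Qed.

End Positivity.
End ReflectionModule.

(** * Roots and weights *)

Section RootLattice.
Variables (R : realType) (D : BCdatum R).
Local Notation I := (bI D).
Local Notation V := (bV D).
Local Notation A := (@bA R D).
Local Notation a_ := (@alpha R D).
Local Notation cv := (@corr R D).
Local Notation isr := (@isreal R D).
Implicit Types (u v w : seq I) (i j k z : I) (x y : V).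

Lemma A_re i : isr i -> A i i = 2. Proof. by move/eqP. Qed.
Lemma A_im i : ~~ isr i -> A i i <= 0.
Proof. by rewrite /isreal; case: (bA_diag i) => [->|//]; rewrite eqxx. Qed.
Lemma A_im_le0 i j : ~~ isr i -> A i j <= 0.
Proof. by move=> ii; case: (eqVneq i j) => [<-|/bA_off //]; exact: A_im. Qed.
Lemma A_sym0 i j : A i j = 0 -> A j i = 0. Proof. by move/bA_sym0. Qed.

Lemma cvB k x c y : cv k (x - c *: y) = cv k x - c * cv k y.
Proof. by rewrite addrC -scaleNr corr_lin mulNr addrC. Qed.
Lemma cvZ k c x : cv k (c *: x) = c * cv k x.
Proof. by have := cvB k 0 (- c) x; rewrite scaleNr opprK add0r => ->; rewrite -[X in cv _ X](subrr 0) -{2}[0]scale1r cvB; ring. Qed.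
Lemma cv0 k : cv k 0 = 0. Proof. by rewrite -(scale0r 0) cvZ mul0r. Qed.
Lemma cvN k x : cv k (- x) = - cv k x. Proof. by rewrite -scaleN1r cvZ mulN1r. Qed.
Lemma cvD k x y : cv k (x + y) = cv k x + cv k y.
Proof. by rewrite -[x]scale1r corr_lin mul1r scale1r. Qed.
Lemma cv_sum k (T : Type) (s : seq T) (F : T -> V) :
  cv k (\sum_(t <- s) F t) = \sum_(t <- s) cv k (F t).
Proof. by elim/big_ind2: _ => [|? ? ? ? <- <-|//]; rewrite ?cv0 ?cvD. Qed.

Lemma cv_refl k z x : cv k (refl z x) = cv k x - cv z x * (A k z)%:~R.
Proof. by rewrite /refl cvB corr_alpha. Qed.

Lemma reflK z : isr z -> involutive (@refl R D z).
Proof. exact: (greflK (@corr_lin R D) (@corr_alpha R D) A_re). Qed.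

Lemma act_weq u v : weq u v -> @act R D u =1 @act R D v.
Proof.
apply: (gact_weq (@corr_lin R D) (@corr_alpha R D) A_re (@bA_off R D) A_sym0) => //.
Qed.

Lemma act_cat u v x : act (u ++ v) x = act u (act v x).
Proof. by rewrite /act foldr_cat. Qed.

Lemma act_lin w (c : R) x y : act w (c *: x + y) = c *: act w x + act w y.
Proof.
by elim: w => //= z w ->; rewrite /refl corr_lin scalerBr scalerA scalerDl opprD addrACA.
Qed.
Lemma act0 w : act w (0 : V) = 0.
Proof. by have := act_lin w (-1) 0 0; rewrite scaler0 addr0 scaleN1r addNr. Qed.
Lemma actZ w c x : act w (c *: x) = c *: act w x.
Proof. by rewrite -[c *: x]addr0 act_lin act0 addr0. Qed.
Lemma actN w x : act w (- x) = - act w x.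
Proof. by rewrite -!scaleN1r actZ. Qed.
Lemma actB w x y : act w (x - y) = act w x - act w y.
Proof. by rewrite addrC -scaleN1r act_lin scaleN1r addrC. Qed.

Lemma act_revK u x : realword u -> act (rev u) (act u x) = x.
Proof. by move=> ru; rewrite -act_cat (act_weq (weq_revl ru)). Qed.
Lemma act_revKV u x : realword u -> act u (act (rev u) x) = x.
Proof. by move=> ru; rewrite -act_cat (act_weq (weq_revr ru)). Qed.

Lemma PN x : x \in @bP R D -> - x \in @bP R D.
Proof. by move=> Px; rewrite -[- x]add0r; apply: bPB; first exact: bP0. Qed.
Lemma PD x y : x \in @bP R D -> y \in @bP R D -> x + y \in @bP R D.
Proof. by move=> Px Py; rewrite -[y]opprK; apply: bPB => //; exact: PN. Qed.
Lemma PZ (m : int) x : x \in @bP R D -> m%:~R *: x \in @bP R D.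
Proof.
move=> Px; have H (n : nat) : n%:R *: x \in @bP R D.
  by elim: n => [|n IH]; rewrite ?scale0r ?bP0 // -addn1 natrD scalerDl scale1r PD.
by case: m => n; [exact: H|rewrite NegzE rmorphN scaleNr /= PN // H].
Qed.
Lemma P_act w x : x \in @bP R D -> act w x \in @bP R D.
Proof.
move=> Px; elim: w => //= z w IH; have [m E] := corr_int z IH.
by rewrite /refl E; apply: bPB => //; apply: PZ; exact: alphaP.
Qed.

(* [Qv x c h]: [x] lies in the root lattice, [c] are its coordinates and [h] its height. *)
Definition Qv x (c : I -> int) (h : int) := exists l : seq (I * int),
  [/\ x = \sum_(p <- l) (p.2)%:~R *: a_ p.1,
      forall k, c k = \sum_(p <- l | p.1 == k) p.2 & h = \sum_(p <- l) p.2].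

Lemma sum_by_key (W : zmodType) (l : seq (I * int)) (F : I * int -> W) :
  \sum_(p <- l) F p = \sum_(k <- undup (map fst l)) \sum_(p <- l | p.1 == k) F p.
Proof.
rewrite (exchange_big_dep xpredT) //= !big_seq; apply: eq_bigr => p pl.
rewrite (eq_bigl (fun k => k == p.1)); last by move=> k; rewrite eq_sym.
rewrite -big_filter filter_pred1_uniq ?undup_uniq ?mem_undup ?map_f //.
by rewrite big_seq1.
Qed.

Lemma Qv_keys l : \sum_(p <- l) (p.2)%:~R *: a_ p.1 =
  \sum_(k <- undup (map fst l)) (\sum_(p <- l | p.1 == k) p.2)%:~R *: a_ k.
Proof.
rewrite sum_by_key; apply: eq_bigr => k _.
rewrite raddf_sum /= scaler_suml; apply: eq_bigr => p /eqP ->; by [].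
Qed.

Lemma Qv0_coord c h : Qv 0 c h -> (forall k, c k = 0) /\ h = 0.
Proof.
case=> l [E Ec ->].
have H k : c k = 0.
  case: (boolP (k \in map fst l)) => kl.
    rewrite Ec; move: E; rewrite Qv_keys => /esym E.
    by apply: (alpha_indep (undup_uniq _) E); rewrite mem_undup.
  rewrite Ec big_seq_cond big1 // => p /andP [pl /eqP Ek].
  by rewrite -Ek map_f in kl.
split=> //; rewrite sum_by_key big1 // => k _.
by rewrite -Ec.
Qed.

Lemma QvD x y c d h g : Qv x c h -> Qv y d g -> Qv (x + y) (fun k => c k + d k) (h + g).
Proof.
move=> [l [-> Ec ->]] [l' [-> Ed ->]]; exists (l ++ l'); rewrite !big_cat /=.
by split=> // k; rewrite big_cat /= Ec Ed.
Qed.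
Lemma QvZ (m : int) x c h : Qv x c h -> Qv (m%:~R *: x) (fun k => m * c k) (m * h).
Proof.
move=> [l [-> Ec ->]]; exists [seq (p.1, m * p.2) | p <- l]; split.
- by rewrite scaler_sumr big_map; apply: eq_bigr => p _; rewrite scalerA -intrM.
- by move=> k; rewrite Ec mulr_sumr big_map.
- by rewrite mulr_sumr big_map.
Qed.
Lemma Qv_ext x c d h : Qv x c h -> c =1 d -> Qv x d h.
Proof. by move=> [l [-> Ec ->]] E; exists l; split=> // k; rewrite -E. Qed.
Lemma QvN x c h : Qv x c h -> Qv (- x) (fun k => - c k) (- h).
Proof.
move=> /(QvZ (-1)); rewrite rmorphN scaleN1r mulN1r => H.
by apply: Qv_ext H _ => k /=; rewrite mulN1r.
Qed.
Lemma QvB x y c d h g : Qv x c h -> Qv y d g -> Qv (x - y) (fun k => c k - d k) (h - g).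
Proof. by move=> H /QvN; exact: QvD. Qed.
Lemma Qv0 : Qv 0 (fun => 0) 0.
Proof. by exists [::]; split => [|k|]; rewrite big_nil. Qed.
Lemma Qv_alpha i : Qv (a_ i) (fun k => (i == k)%:R) 1.
Proof.
exists [:: (i, 1)]; split => [|k|]; rewrite ?big_cons ?big_nil /= ?addr0 //.
  by rewrite scale1r.
by case: eqP; rewrite ?addr0.
Qed.
Lemma Qv_zalpha (m : int) i : Qv (m%:~R *: a_ i) (fun k => m * (i == k)%:R) m.
Proof. by have := QvZ m (Qv_alpha i); rewrite mulr1. Qed.

Lemma Qv_uniq x c d h g : Qv x c h -> Qv x d g -> c =1 d /\ h = g.
Proof.
move=> H1 H2; have := QvB H1 H2; rewrite subrr => /Qv0_coord [E1 E2]; split.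
  by move=> k; apply/eqP; rewrite -subr_eq0; apply/eqP.
by apply/eqP; rewrite -subr_eq0; apply/eqP.
Qed.

Lemma Qv_eq0 x c h : Qv x c h -> (forall k, c k = 0) -> x = 0.
Proof.
by case=> l [-> Ec _] E; rewrite Qv_keys big1 // => k _; rewrite -Ec E scale0r.
Qed.

Lemma Qv_cv x c h z : Qv x c h -> exists l : seq (I * int), [/\
  cv z x = \sum_(k <- undup (map fst l)) (c k * A z k)%:~R & forall k, k \notin undup (map fst l) -> c k = 0].
Proof.
case=> l [-> Ec _]; exists l; split.
  by rewrite Qv_keys cv_sum; apply: eq_bigr => k _; rewrite cvZ corr_alpha Ec intrM.
move=> k; rewrite mem_undup => kl; rewrite Ec big_seq_cond big1 // => p /andP [pl /eqP Ek].
by rewrite -Ek map_f in kl.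
Qed.

Lemma inQplusE x : inQplus x <-> exists c h, Qv x c h /\ forall k, 0 <= c k.
Proof.
split=> [[s [c ->]]|[c [h [[l [-> Ec _]] c0]]]].
  pose l := [seq (i, (c i)%:Z) | i <- s].
  exists (fun k => \sum_(p <- l | p.1 == k) p.2), (\sum_(p <- l) p.2); split.
    by exists l; split=> //; rewrite /l big_map.
  by move=> k; rewrite /l big_map; apply: sumr_ge0.
exists (undup (map fst l)), (fun k => `|c k|%N); rewrite Qv_keys; apply: eq_bigr => k _.
by rewrite -Ec; congr (_ *: _); rewrite -[in LHS](gez0_abs (c0 k)).
Qed.

Lemma Qv_height_ge0 x c h : Qv x c h -> (forall k, 0 <= c k) -> 0 <= h.
Proof.
case=> l [_ Ec ->] c0; rewrite sum_by_key; apply: sumr_ge0 => k _.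
by rewrite -Ec.
Qed.

Lemma Qv_height_gt0 x c h k : Qv x c h -> (forall k, 0 <= c k) -> 0 < c k -> 0 < h.
Proof.
move=> Q c0 ck; have Q' := QvB Q (Qv_alpha k).
have : 0 <= h - 1; last by lia.
apply: (Qv_height_ge0 Q') => l /=; case: eqP => [<-|_]; last by have := c0 l; lia.
by lia.
Qed.

Lemma Qv_act_sub w x : x \in @bP R D -> exists c h, Qv (x - act w x) c h.
Proof.
move=> Px; elim: w => [|z w [c [h H]]] /=.
  by exists (fun=> 0), 0; rewrite subrr; exact: Qv0.
have [m E] := corr_int z (P_act w Px).
exists (fun k => c k + m * (z == k)%:R), (h + m).
by rewrite /refl opprB addrCA addrC E; exact: QvD (Qv_zalpha m z).
Qed.

End RootLattice.

Section Roots.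
Variables (R : realType) (D : BCdatum R).
Local Notation I := (bI D).
Local Notation V := (bV D).
Local Notation A := (@bA R D).
Local Notation a_ := (@alpha R D).
Local Notation cv := (@corr R D).
Local Notation isr := (@isreal R D).
Local Notation dom := (@dominant R D).
Implicit Types (u v w : seq I) (i j k z : I) (x y la : V).

Lemma cv_dom_ge0 la w k : dom la -> (isr k -> (len w < len (k :: w))%N) ->
  0 <= cv k (act w la).
Proof.
case=> _ dla H; exact: (length_pos (@corr_lin R D) (@corr_alpha R D) (@A_re R D)
  (@A_im R D) (@bA_off R D) (@A_sym0 R D) (fun i j => erefl) (fun i j H => H)
  (P := fun t => 0 <= t) (fun t Ht => Ht) (fun s t => @addr_ge0 R s t) dla H).
Qed.

Lemma cv_im_ge0 la w k : dom la -> ~~ isr k -> 0 <= cv k (act w la).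
Proof. by move=> dla ik; apply: cv_dom_ge0 => //; rewrite (negbTE ik). Qed.

Lemma act_fix la w : all (fun k => cv k la == 0) w -> act w la = la.
Proof.
by elim: w => //= z w IH /andP [/eqP H /IH ->]; rewrite /refl H scale0r subr0.
Qed.

Lemma refl_cvP la z : la \in @bP R D -> exists2 m : int, cv z la = m%:~R & refl z la = la - m%:~R *: a_ z.
Proof. by move=> Pl; have [m E] := corr_int z Pl; exists m; rewrite // /refl E. Qed.

(** Each letter of a reduced word subtracts a nonnegative multiple of its simple root. The rightmost
    letter that does not kill [la] meets [la] itself, hence occurs with a positive coefficient. *)
Lemma reduced_stab la w : dom la -> reduced w -> exists c h, [/\
  Qv (la - act w la) c h, forall k, 0 <= c k, forall k, k \notin w -> c k = 0 &
  all (fun k => cv k la == 0) w \/ exists2 k, 0 < cv k la & 0 < c k].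
Proof.
move=> dla; elim: w => [_|z w IH /reduced_cons [rw lt]].
  exists (fun => 0), 0; split=> //; rewrite ?subrr; [exact: Qv0|by left].
have [c [h [Q c0 cw H]]] := IH rw.
have [m Em Er] := refl_cvP z (P_act w (proj1 dla)).
have m0 : 0 <= m by rewrite -(ler0z R) -Em; apply: cv_dom_ge0.
exists (fun k => c k + m * (z == k)%:R), (h + m); split.
- rewrite [act _ _]Er opprB addrCA addrC; exact: QvD (Qv_zalpha m z).
- by move=> k; rewrite addr_ge0 // mulr_ge0.
- move=> k; rewrite inE negb_or eq_sym => /andP [/negbTE -> /cw ->].
  by rewrite mulr0 addr0.
case: H => [al|[k k1 k2]]; last first.
  by right; exists k => //; rewrite ltr_wpDr // mulr_ge0.
move: Em; rewrite (act_fix al) => Em.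
case: (ltrgtP m 0) m0 => // m1 _; last by left; rewrite /= al andbT Em m1.
right; exists z; first by rewrite Em ltr0z.
by rewrite eqxx mulr1 ltr_wpDl.
Qed.

Lemma orbit_down la w : dom la -> exists c h, Qv (la - act w la) c h /\ forall k, 0 <= c k.
Proof.
move=> dla; have [v rv /act_weq <-] := reduced_ex w.
by have [c [h [Q c0 _ _]]] := reduced_stab dla rv; exists c, h.
Qed.

Lemma stabilizer la w : dom la ->
  (exists v, [/\ weq v w, reduced v & all (fun k => cv k la == 0) v]) \/
  (exists k c h, [/\ Qv (la - act w la) c h, forall k, 0 <= c k, 0 < cv k la & 0 < c k]).
Proof.
move=> dla; have [v rv Hv] := reduced_ex w; rewrite -(act_weq Hv).
have [c [h [Q c0 _ [al|[k k1 k2]]]]] := reduced_stab dla rv; first by left; exists v.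
by right; exists k, c, h.
Qed.

Local Notation tact := (@gact R D ((I -> R^o) : lmodType R) (fun z k => (A z k)%:~R) (fun i xi => xi i)).

(** Coordinates of a root are values of the contragredient action on functions on [I]. This makes
    them accessible to the positivity theorem for the transposed matrix. *)
Lemma alpha_pairing u i : exists l : seq (I * int),
  act u (a_ i) = \sum_(p <- l) (p.2)%:~R *: a_ p.1 /\
  forall xi : I -> R, \sum_(p <- l) (p.2)%:~R * xi p.1 = tact (rev u) xi i.
Proof.
elim: u => [|z u [l [E pr]]] /=.
  exists [:: (i, 1)]; split=> [|xi]; rewrite big_seq1 ?scale1r ?mul1r //.
exists ((z, - \sum_(p <- l) p.2 * A z p.1) :: l); split=> [|xi]; rewrite big_cons /=.
  rewrite /refl [RHS]addrC E rmorphN scaleNr; congr (_ - _ *: _).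
  rewrite cv_sum raddf_sum /=; apply: eq_bigr => p _.
  by rewrite cvZ corr_alpha intrM.
rewrite rev_cons -cats1 gact_cat -pr /= /grefl rmorphN /= raddf_sum /= mulNr addrC.
rewrite mulr_suml -sumrB; apply: eq_bigr => p _.
rewrite intrM -[(xi - _) _]/(xi p.1 - xi z * (A z p.1)%:~R); ring.
Qed.

Lemma tact_ge0 w k (xi : I -> R) : (forall i, 0 <= xi i) ->
  (isr k -> (len w < len (k :: w))%N) -> 0 <= tact w xi k.
Proof.
move=> xi0 H; refine (length_pos (R := R) (D := D) (B := fun i j => A j i)
  (M := ((I -> R^o) : lmodType R)) (a := fun z k => (A z k)%:~R) (f := fun i xi => xi i)
   (P := fun t => 0 <= t) _ _ _ _ _ _ _ _ (fun t Ht => Ht) (fun s t => @addr_ge0 R s t) xi0 H) => //.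
- by move=> i ri; apply: A_re.
- by move=> i; apply: A_im.
- by move=> i j nij; apply: bA_off; rewrite eq_sym.
- by move=> i j; exact: A_sym0.
- by move=> i j; rewrite mulrC.
- by move=> i j; exact: A_sym0.
Qed.

Lemma root_coords u i : exists c h, Qv (act u (a_ i)) c h /\
  forall k, (c k)%:~R = tact (rev u) (fun j => (j == k)%:R) i.
Proof.
have [l [E pr]] := alpha_pairing u i.
exists (fun k => \sum_(p <- l | p.1 == k) p.2), (\sum_(p <- l) p.2); split; first by exists l.
move=> k; rewrite -pr raddf_sum /= big_mkcond /=; apply: eq_bigr => p _.
by case: eqP; rewrite ?mulr1 ?mulr0.
Qed.

Lemma root_pos u i : (isr i -> (len (rev u) < len (i :: rev u))%N) ->
  exists c h, Qv (act u (a_ i)) c h /\ forall k, 0 <= c k.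
Proof.
move=> H; have [c [h [Q Ec]]] := root_coords u i; exists c, h; split=> // k.
by rewrite -(ler0z R) Ec; apply: tact_ge0 => // j; rewrite ler0n.
Qed.

(** Here [rev u = i v] with [v] shorter, and [r_i] negates the value at [i]. The coordinates are
    thus opposite to the nonnegative ones obtained from [v]. *)
Lemma root_neg u i : isr i -> ~~ (len (rev u) < len (i :: rev u))%N ->
  exists c h, Qv (act u (a_ i)) c h /\ forall k, c k <= 0.
Proof.
move=> ri H; have [c [h [Q Ec]]] := root_coords u i; exists c, h; split=> // k.
have El := len_realVN ri H; set v := i :: rev u in El.
have Hv : weq (i :: v) (rev u) by exact: weq_invl.
have E : forall xi : I -> R, tact (rev u) xi i = - tact v xi i.
  move=> xi; rewrite -[LHS](_ : tact (i :: v) xi i = _).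
    rewrite [LHS]/= /grefl -[LHS]/(tact v xi i - tact v xi i * (A i i)%:~R).
    by rewrite A_re // -[2%:~R]/(2%:R : R); ring.
  congr (_ i); apply: (gact_weq (R := R) (D := D) (B := fun i j => A j i)
  (M := ((I -> R^o) : lmodType R)) (a := fun z k => (A z k)%:~R) (f := fun i xi => xi i)) Hv _ => //.
  - by move=> j rj; apply: A_re.
  - by move=> j j' nij; apply: bA_off; rewrite eq_sym.
  - by move=> j j'; exact: A_sym0.
  - by move=> j j'; rewrite mulrC.
  - by move=> j j'; exact: A_sym0.
rewrite -(lerz0 R) Ec E oppr_le0; apply: tact_ge0 => [j|_]; first by rewrite ler0n.
by rewrite (len_weq Hv) -El.
Qed.

Lemma alpha_neq0 i : a_ i <> 0.
Proof.
by move=> E; have := Qv_alpha i; rewrite E => /Qv0_coord [/(_ i)]; rewrite eqxx.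
Qed.

Lemma root_neq0 u i : realword u -> act u (a_ i) <> 0.
Proof.
move=> ru E; have := act_revK (a_ i) ru; rewrite E act0 => /esym; exact: alpha_neq0.
Qed.

Lemma proot_coords u i : proot u i ->
  exists c h, [/\ Qv (act u (a_ i)) c h, forall k, 0 <= c k & exists k, 0 < c k].
Proof.
case=> ru H; have [c [h [Q c0]]] : exists c h, Qv (act u (a_ i)) c h /\ forall k, 0 <= c k.
  case: (boolP (isr i)) => [ri|ii]; first by apply/inQplusE; exact: H.
  by apply: root_pos; rewrite (negbTE ii).
exists c, h; split=> //; apply: contrapT => H1.
apply: (root_neq0 (i := i) ru); apply: (Qv_eq0 Q) => k; apply/eqP; rewrite eq_le c0 andbT leNgt.
by apply/negP => ck; apply: H1; exists k.
Qed.

Lemma proot_lenP u i : realword u -> isr i ->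
  proot u i <-> (len (rev u) < len (i :: rev u))%N.
Proof.
move=> ru ri; split=> [p|lt]; last first.
  by split=> // _; apply/inQplusE; apply: root_pos.
apply: contrapT => /negP H; have [c [h [Q c0 [k ck]]]] := proot_coords p.
have [d [g [Q' d0]]] := root_neg ri H.
by have [/(_ k) E _] := Qv_uniq Q Q'; have := d0 k; rewrite -E; lia.
Qed.

Lemma cobetaB u i x c y : cobeta u i (x - c *: y) = cobeta u i x - c * cobeta u i y.
Proof. by rewrite /cobeta actB actZ cvB. Qed.
Lemma cobetaN u i x : cobeta u i (- x) = - cobeta u i x.
Proof. by rewrite /cobeta actN cvN. Qed.

Lemma rbetaE u i x : realword u -> rbeta u i x = x - cobeta u i x *: act u (a_ i).
Proof.
move=> ru; rewrite /rbeta /rword act_cat /= /refl actB actZ act_revKV //.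
Qed.

Lemma act_rword u i w x : act (rword u i ++ w) x = rbeta u i (act w x).
Proof. by rewrite act_cat. Qed.

Lemma cobeta_root u i : realword u -> cobeta u i (act u (a_ i)) = (A i i)%:~R.
Proof. by move=> ru; rewrite /cobeta act_revK // corr_alpha. Qed.

Lemma cobeta_rbeta u i x : realword u ->
  cobeta u i (rbeta u i x) = cobeta u i x * (1 - (A i i)%:~R).
Proof. by move=> ru; rewrite rbetaE // cobetaB cobeta_root //; ring. Qed.

Lemma cobeta_int u i x : x \in @bP R D -> exists m : int, cobeta u i x = m%:~R.
Proof. by move=> Px; apply: corr_int; apply: P_act. Qed.

Lemma cobeta_act u i w x : cobeta u i (act w x) = cv i (act (rev u ++ w) x).
Proof. by rewrite /cobeta act_cat. Qed.

Lemma cobeta_im_ge0 u i w la : dom la -> ~~ isr i -> 0 <= cobeta u i (act w la).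
Proof. by move=> dla ii; rewrite cobeta_act; exact: cv_im_ge0. Qed.

Lemma cobeta_dom_ge0 u i la : proot u i -> dom la -> 0 <= cobeta u i la.
Proof.
move=> p dla; case: (boolP (isr i)) => [ri|ii]; last exact: (cobeta_im_ge0 u [::]).
have := cobeta_act u i [::] la; rewrite /= => ->; rewrite cats0.
by apply: cv_dom_ge0 => // _; apply/(proot_lenP (proj1 p) ri).
Qed.

Lemma cobeta_up u i w la : dom la -> (isr i -> (len (rev u ++ w) < len (i :: rev u ++ w))%N) ->
  0 <= cobeta u i (act w la).
Proof. by move=> dla H; rewrite cobeta_act; apply: cv_dom_ge0. Qed.

Lemma cobeta_down u i w la : dom la -> isr i -> ~~ (len (rev u ++ w) < len (i :: rev u ++ w))%N ->
  cobeta u i (act w la) <= 0.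
Proof.
move=> dla ri H; have El := len_realVN ri H.
have Hv := weq_invl (rev u ++ w) ri; rewrite cobeta_act -(act_weq Hv).
rewrite [act _ _]/= cv_refl A_re // -[2%:~R]/(2%:R : R).
have : 0 <= cv i (act (i :: rev u ++ w) la).
  by apply: cv_dom_ge0 => // _; rewrite (len_weq Hv) -El.
rewrite /=; lra.
Qed.

(** This opens the results on dominant weights, in particular on stabilizers, to imaginary simple
    roots. *)
Lemma dominant_Nalpha j : ~~ isr j -> dom (- a_ j).
Proof.
move=> ij; split=> [|i]; first by apply/PN/alphaP.
rewrite cvN corr_alpha oppr_ge0 lerz0.
by case: (eqVneq i j) => [->|/bA_off //]; exact: A_im.
Qed.

Lemma root_real_im u i c h k : realword u -> isr i -> ~~ isr k ->
  Qv (act u (a_ i)) c h -> c k = 0.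
Proof.
move=> ru ri ik; elim: u c h ru => [|z u IH] c h /=.
  move=> _ Q; have [-> _] := Qv_uniq Q (Qv_alpha i).
  by case: eqP => // E; rewrite E (negbTE ik) in ri.
case/andP=> rz ru Q; have Pu : act u (a_ i) \in @bP R D by apply/P_act/alphaP.
have [m Em] := corr_int z Pu; have [d [g [Qd _]]] := root_coords u i.
have Q' := QvB Qd (Qv_zalpha m z).
move: Q; rewrite /refl Em => Q; have [-> _] := Qv_uniq Q Q'.
rewrite (IH _ _ ru Qd) /=.
case: eqP => [E|_]; last by rewrite mulr0 subr0.
by rewrite E (negbTE ik) in rz.
Qed.

Lemma root_im_le0 u i j : proot u i -> ~~ isr j -> cv j (act u (a_ i)) <= 0.
Proof.
move=> p ij; have [c [h [Q c0 _]]] := proot_coords p.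
have [l [-> _]] := Qv_cv j Q; apply: sumr_le0 => k _.
by rewrite lerz0; apply: mulr_ge0_le0 => //; exact: A_im_le0.
Qed.

Lemma root_im_lt0 u i j c h k : proot u i -> ~~ isr j -> Qv (act u (a_ i)) c h ->
  0 < c k -> A j k != 0 -> cv j (act u (a_ i)) < 0.
Proof.
move=> p ij Q ck Ajk; have [d [g [Qd d0 _]]] := proot_coords p.
have c0 l : 0 <= c l by have [-> _] := Qv_uniq Q Qd.
have [l [-> nl]] := Qv_cv j Q.
have kl : k \in undup (map fst l) by apply/negPn/negP => /nl E; rewrite E in ck.
rewrite (big_rem k) //=; have A0 : A j k < 0 by rewrite lt_neqAle Ajk A_im_le0.
rewrite ltr_wnDr //.
  by apply: sumr_le0 => i' _; rewrite lerz0; apply: mulr_ge0_le0 => //; exact: A_im_le0.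
by rewrite ltrz0 pmulr_rlt0.
Qed.

(** A substitute for symmetry of an invariant form. If [r_beta] moves [- alpha j], the difference is
    a positive multiple of [beta] and contains some [alpha k] with [A k j < 0]. Then [A j k < 0] as
    well, which makes [alpha_j^vee(beta)] negative. *)
Lemma cobeta_root_im0 u i j : proot u i -> ~~ isr j -> cv j (act u (a_ i)) = 0 ->
  cobeta u i (a_ j) = 0.
Proof.
move=> p ij E0; have ru := proj1 p; have dj := dominant_Nalpha ij.
have Ex : - a_ j - rbeta u i (- a_ j) = cobeta u i (- a_ j) *: act u (a_ i).
  by rewrite rbetaE // opprB addrC subrK.
case: (stabilizer (rword u i) dj) => [[v [Hv _ al]]|[k [c [h [Q c0 k1 k2]]]]].
  have Efix : rbeta u i (- a_ j) = - a_ j by rewrite /rbeta -(act_weq Hv) act_fix.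
  move: Ex; rewrite Efix subrr => /esym/eqP; rewrite scaler_eq0 => /orP [/eqP|/eqP H].
    by rewrite cobetaN => /eqP; rewrite oppr_eq0 => /eqP.
  by case: (root_neq0 (i := i) ru).
have [m Em] := cobeta_int u i (proj1 dj).
have [d [g [Qd d0 _]]] := proot_coords p.
rewrite -/(rbeta u i _) Ex Em in Q; have [Ec _] := Qv_uniq Q (QvZ m Qd).
have m0 : 0 <= m by rewrite -(ler0z R) -Em; exact: cobeta_dom_ge0.
have dk : 0 < d k by move: k2; rewrite Ec; have := d0 k; nia.
have : cv j (act u (a_ i)) < 0; last by rewrite E0 ltxx.
apply: (root_im_lt0 p ij Qd dk); apply/eqP => /A_sym0 Akj.
by move: k1; rewrite cvN corr_alpha Akj oppr0 ltxx.
Qed.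

Lemma cobeta_alpha_im_le0 u i j : proot u i -> ~~ isr j -> cobeta u i (a_ j) <= 0.
Proof.
move=> p ij; have := cobeta_dom_ge0 p (dominant_Nalpha ij).
by rewrite cobetaN oppr_ge0.
Qed.

(** [r_beta] fixes [- alpha j], so it is a word in letters orthogonal to [alpha j]. Such a word
    preserves [alpha_j^vee], while [r_beta] negates [beta]. *)
Lemma cv_root_real0 u i j : proot u i -> isr i -> ~~ isr j -> cobeta u i (a_ j) = 0 ->
  cv j (act u (a_ i)) = 0 /\ exists v, [/\ weq v (rword u i) & all (fun k => cv k (a_ j) == 0) v].
Proof.
move=> p ri ij E0; have ru := proj1 p; have dj := dominant_Nalpha ij.
have Efix : act (rword u i) (- a_ j) = - a_ j.
  by rewrite -/(rbeta u i _) rbetaE // cobetaN E0 oppr0 scale0r subr0.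
case: (stabilizer (rword u i) dj) => [[v [Hv _ al]]|[k [c [h [Q c0 k1 k2]]]]]; last first.
  by move: Q; rewrite Efix subrr => /Qv0_coord [E _]; rewrite E ltxx in k2.
have al' : all (fun k => cv k (a_ j) == 0) v.
  by apply: sub_all al => k; rewrite cvN oppr_eq0.
split; last by exists v.
have Hfix x : cv j (act v x) = cv j x.
  elim: v al' {Hv al} => //= z v IH /andP [/eqP z0 /IH {}IH]; rewrite cv_refl IH.
  move: z0; rewrite corr_alpha => /eqP; rewrite intr_eq0 => /eqP /A_sym0 ->.
  by rewrite mulr0 subr0.
have : cv j (act u (a_ i)) = - cv j (act u (a_ i)); last by lra.
rewrite -{1}Hfix (act_weq Hv) -/(rbeta u i _) rbetaE // cobeta_root // A_re //.
by rewrite -cvN; congr (cv j _); rewrite -{1}[act u _]scale1r -scalerBl -scaleN1r; congr (_ *: _); rewrite -[2%:~R]/(2%:R); ring.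
Qed.

End Roots.

Section Reflections.
Variables (R : realType) (D : BCdatum R).
Local Notation I := (bI D).
Local Notation V := (bV D).
Local Notation a_ := (@alpha R D).
Local Notation cv := (@corr R D).
Local Notation isr := (@isreal R D).
Local Notation dom := (@dominant R D).
Implicit Types (u v w : seq I) (i j k z : I) (x y la : V).

Lemma weq_realword u v : weq u v -> realword u = realword v.
Proof.
elim=> {u v} [//|u v _ -> //|u v w _ -> _ -> //|x u v y H].
rewrite /realword !all_cat; congr (_ && (_ && _)).
case: H => [i ri|i j ri rj _ _|i j _ _ _] /=; rewrite ?andbT.
- by rewrite ri.
- by elim: (ordm i j) => //= n ->; rewrite ri rj.
- by rewrite andbC.
Qed.

Lemma act_rev_weq u v x : realword u -> weq u v -> act (rev u) x = act (rev v) x.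
Proof.
move=> ru Huv; have rv : realword v by rewrite -(weq_realword Huv).
by rewrite -[LHS](act_revK _ rv) -(act_weq Huv) act_revKV.
Qed.

(** A real simple reflection changes only the coordinate at [z]. A positive root made negative by it
    is thus a multiple of [alpha z], and integrality of its preimage forces the multiple to be 1. *)
Lemma proot_cons u i z : proot u i -> isr z ->
  (isr i /\ act u (a_ i) = a_ z) \/ proot (z :: u) i.
Proof.
move=> p rz; have ru := proj1 p.
have rzu : realword (z :: u) by rewrite /= rz.
case: (boolP (isr i)) => [ri|ii]; last by right; split=> //; rewrite (negbTE ii).
case: (boolP (len (rev (z :: u)) < len (i :: rev (z :: u)))%N) => [lt|H].
  by right; apply/(proot_lenP rzu ri).
left; split=> //; have [d [g [Qd d0]]] := root_neg ri H.
have [c [h [Q c0 [k ck]]]] := proot_coords p.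
have [m Em] := corr_int z (P_act u (alphaP i)).
have Q' := QvB Q (Qv_zalpha m z).
move: Qd; rewrite /= /refl Em => Qd; have [E _] := Qv_uniq Q' Qd.
have cz l : l != z -> c l = 0.
  by move=> nl; have := d0 l; rewrite -E eq_sym (negbTE nl) mulr0 subr0; have := c0 l; lia.
have Ea : act u (a_ i) = (c z)%:~R *: a_ z.
  apply/eqP; rewrite -subr_eq0; apply/eqP; apply: (Qv_eq0 (QvB Q (Qv_zalpha (c z) z))) => l.
  by case: (eqVneq z l) => [<-|nl]; rewrite ?mulr1 ?subrr // mulr0 subr0 cz // eq_sym.
(* Transporting [beta = c z alpha z] back by [rev u] gives [alpha i], whose [i]-th coordinate reads
   [c z * e i = 1] in integers. *)
have [e [f [Qe _]]] := root_coords (rev u) z.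
have := QvZ (c z) Qe; rewrite -actZ -Ea act_revK // => Qi.
have [/(_ i)] := Qv_uniq Qi (Qv_alpha i); rewrite eqxx /= => ce _.
have c1 : c z = 1.
  have e0 : 0 <= e i by rewrite leNgt; apply/negP => e0; have := c0 z; move: ce; nia.
  move: ce (c0 z) e0; case: (c z) => // p1; case: (e i) => // p2 /eqP + _ _.
  by rewrite -PoszM eqz_nat muln_eq1 => /andP [/eqP -> _].
by rewrite Ea c1 scale1r.
Qed.

Section SameRoot.
Variables (u : seq I) (i z : I).
Hypotheses (ru : realword u) (ri : isr i) (rz : isr z) (E : act u (a_ i) = a_ z).

Let cobeta_z : cobeta u i (a_ z) = 2.
Proof. by rewrite -E cobeta_root // A_re. Qed.

(** Both coroots take the value 2 on [alpha z], so the product of the two reflections is a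
    transvection along [alpha z] measured by the difference of the coroots. *)
Lemma two_reflections y :
  act (rword u i ++ [:: z]) y = y + (cv z y - cobeta u i y) *: a_ z /\
  act (z :: rword u i) y = y + (cobeta u i y - cv z y) *: a_ z.
Proof.
split.
  rewrite act_rword /= rbetaE // E /refl cobetaB cobeta_z -addrA -opprD -scalerDl -scaleNr.
  by congr (_ + _ *: _); ring.
rewrite [LHS]/= -/(rbeta u i y) rbetaE // E /refl cvB corr_alpha A_re //.
rewrite -addrA -opprD -scalerDl -scaleNr -[2%:~R]/(2%:R).
by congr (_ + _ *: _); ring.
Qed.

Let iter_tr (T : seq I) (s : R) y n :
  (forall y, act T y = y + (s * (cv z y - cobeta u i y)) *: a_ z) ->
  act (flatten (nseq n T)) y = y + (s * (cv z y - cobeta u i y) *+ n) *: a_ z.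
Proof.
move=> HT; elim: n => [|n IH] /=; first by rewrite mulr0n scale0r addr0.
rewrite act_cat IH HT cvD cvZ.
have Hc c : cobeta u i (y + c *: a_ z) = cobeta u i y + c * 2.
  by rewrite -[c]opprK scaleNr cobetaB cobeta_z; ring.
rewrite Hc.
rewrite corr_alpha A_re // -addrA -scalerDl; congr (_ + _ *: _).
by rewrite mulrS -[2%:~R]/(2%:R); ring.
Qed.

(* Otherwise the orbit of a dominant weight would contain an unbounded arithmetic progression along [a_ z]. *)
Lemma cobeta_same_root la w : dom la -> cobeta u i (act w la) = cv z (act w la).
Proof.
move=> dla; set y := act w la; have Py : y \in @bP R D by apply: P_act; case: dla.
have [m Em] := corr_int z Py; have [m' Em'] := cobeta_int u i Py.
have [c [h [Q c0]]] := orbit_down w dla.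
have key (T : seq I) (s : int) :
  (forall y, act T y = y + (s%:~R * (cv z y - cobeta u i y)) *: a_ z) -> s * (m - m') <= 0.
  (* Each iteration lowers the [z]-coordinate of the distance to [la] by at least one, so
     [|c z| + 1] iterations make it negative, which is impossible in the orbit of a dominant
     weight. *)
  move=> HT; rewrite leNgt; apply/negP => s0; pose n := `|c z|.+1%N.
  have [d [g [Qd d0]]] := orbit_down (flatten (nseq n T) ++ w) dla.
  move: Qd; rewrite act_cat -/y (iter_tr _ _ HT) Em Em' => Qd.
  have Q2 := QvB Q (Qv_zalpha (s * (m - m') *+ n) z).
  have [|/(_ z) Ed _] := Qv_uniq Qd (Qv_ext (c := fun k => c k - s * (m - m') *+ n * (z == k)%:R) (h := h - s * (m - m') *+ n) _ (fun k => erefl)).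
    move: Q2; rewrite -addrA -opprD; congr (Qv (_ - (_ + _ *: _)) _ _).
    by rewrite rmorphMn rmorphM /= rmorphB.
  have := d0 z; rewrite Ed eqxx mulr1 /n; have := c0 z; rewrite -mulr_natr; nia.
have k1 := key (rword u i ++ [:: z]) 1 (fun y => _).
have k2 := key (z :: rword u i) (-1) (fun y => _).
have H : m = m'.
  have {}k1 : 1 * (m - m') <= 0 by apply: k1 => y'; rewrite mul1r; case: (two_reflections y').
  have {}k2 : -1 * (m - m') <= 0.
    by apply: k2 => y'; rewrite rmorphN mulN1r opprB; case: (two_reflections y').
  lia.
by rewrite Em Em' H.
Qed.

End SameRoot.

Lemma root_flip u i : realword u -> isr i ->
  [/\ proot u i \/ proot (u ++ [:: i]) i, act (u ++ [:: i]) (a_ i) = - act u (a_ i) &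
      forall x, cobeta (u ++ [:: i]) i x = - cobeta u i x].
Proof.
move=> ru ri; have E1 : refl i (a_ i) = - a_ i.
  rewrite /refl corr_alpha A_re // -{1}[a_ i]scale1r -scalerBl -scaleN1r; congr (_ *: _).
  by rewrite -[2%:~R]/(2%:R); ring.
have E : act (u ++ [:: i]) (a_ i) = - act u (a_ i) by rewrite act_cat /= E1 actN.
split=> // [|x]; last first.
  rewrite /cobeta rev_cat /= cv_refl A_re // -[2%:~R]/(2%:R); ring.
case: (boolP (len (rev u) < len (i :: rev u))%N) => [lt|H].
  by left; apply/(proot_lenP ru ri).
right; split; first by rewrite /realword all_cat -/(realword u) ru /= ri.
move=> _; rewrite E; apply/inQplusE; have [c [h [Q c0]]] := root_neg ri H.
by exists (fun k => - c k), (- h); split; [exact: QvN|move=> k; rewrite oppr_ge0].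
Qed.

(** Transport by [rev u] compares the real root [rev u alpha_z] with the imaginary simple root
    [alpha j]. A positive pairing shows that this real root is negative, and [cobeta_root_im0]
    excludes the value zero for the other pairing. *)
Lemma cv_imroot_gt0 u j z : realword u -> ~~ isr j -> isr z ->
  0 < cv z (act u (a_ j)) -> 0 < cobeta u j (a_ z).
Proof.
move=> ru ij rz H; have rru : realword (rev u) by rewrite realword_rev.
have Eco : cobeta (rev u) z (a_ j) = cv z (act u (a_ j)) by rewrite /cobeta revK.
have [[p|p] E1 E2] := root_flip rru rz.
  by have := cobeta_alpha_im_le0 p ij; rewrite Eco; lra.
have := root_im_le0 p ij; rewrite E1 cvN -/(cobeta u j (a_ z)) => le.
have : cobeta u j (a_ z) <> 0; last by lra.
move=> E0; have := cobeta_root_im0 p ij; rewrite E1 cvN -/(cobeta u j (a_ z)) E0 oppr0 => /(_ erefl).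
by rewrite E2 Eco; lra.
Qed.

Lemma cv_imroot_eq0 u j z : realword u -> ~~ isr j -> isr z ->
  cv z (act u (a_ j)) = 0 -> cobeta u j (a_ z) = 0.
Proof.
move=> ru ij rz H; have rru : realword (rev u) by rewrite realword_rev.
have Eco : cobeta (rev u) z (a_ j) = 0 by rewrite /cobeta revK.
have [[p|p] E1 E2] := root_flip rru rz.
  by have [] := cv_root_real0 p rz ij Eco.
have [] := cv_root_real0 p rz ij; first by rewrite E2 Eco oppr0.
by rewrite E1 cvN -/(cobeta u j (a_ z)) => /eqP; rewrite oppr_eq0 => /eqP.
Qed.

Lemma imroot_simple_or u j : realword u -> ~~ isr j ->
  (act u (a_ j) = a_ j /\ forall x, cobeta u j x = cv j x) \/
  exists2 z, isr z & 0 < cv z (act u (a_ j)).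
Proof.
have [n] := ubnP (len u); elim: n u => // n IH u ltn ru ij.
have [v rv Hv] := reduced_ex u.
have rwv : realword v by rewrite (weq_realword Hv).
have Eco x : cobeta u j x = cobeta v j x by rewrite /cobeta (act_rev_weq _ rwv Hv).
move: ltn; rewrite -(len_weq Hv) -(act_weq Hv) => ltn {Hv ru}.
case: v rv rwv Eco ltn => [|z t] rv rwv Eco ltn; first by left; split.
move: rwv => /andP [rz rt]; have [rt' lt] := reduced_cons rv.
have := cv_dom_ge0 (w := t) (k := z) (dominant_Nalpha ij) (fun _ => lt).
rewrite actN cvN oppr_ge0 le_eqVlt => /orP [/eqP E0|lt0]; last first.
  by right; exists z => //=; rewrite cv_refl A_re // -[2%:~R]/(2%:R); lra.
have Ea : act (z :: t) (a_ j) = act t (a_ j) by rewrite /= /refl E0 scale0r subr0.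
have [|[H1 H2]|[z' rz' H]] := IH t _ rt ij; first by move: lt ltn; lia.
- left; split=> [|x]; first by rewrite Ea.
  rewrite Eco /cobeta rev_cons -cats1 act_cat /= -/(cobeta t j _) /refl cobetaB.
  by rewrite (cv_imroot_eq0 rt ij rz E0) mulr0 subr0.
- by right; exists z' => //; rewrite Ea.
Qed.

End Reflections.

(** * Regular weights and shortening by real reflections *)

Section RegularWeight.
Variables (R : realType) (D : BCdatum R).
Local Notation I := (bI D).
Local Notation A := (@bA R D).
Local Notation a_ := (@alpha R D).
Local Notation cv := (@corr R D).
Local Notation isr := (@isreal R D).
Implicit Types (u v w : seq I) (i j k s : I).
Variable rho : bV D.
Hypothesis P_rho : rho \in @bP R D.
Hypothesis cv_rho : forall k, cv k rho = 1.

Let dom_rho : dominant rho.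
Proof. by split=> // k; rewrite cv_rho. Qed.

Lemma cv_rho_gt0 w k : (isr k -> (len w < len (k :: w))%N) -> 0 < cv k (act w rho).
Proof.
move=> H; have Hr k' : 0 < cv k' rho by rewrite cv_rho.
have add (b c : R) : 0 < b -> 0 <= c -> 0 < b + c by lra.
exact: (length_pos (@corr_lin R D) (@corr_alpha R D) (@A_re R D)
  (@A_im R D) (@bA_off R D) (@A_sym0 R D) (fun i j => erefl) (fun i j H => H)
  (P := fun t => 0 < t) (fun t Ht => ltW Ht) add Hr H).
Qed.

Lemma act_rho_faithful u : act u rho = rho -> weq u [::].
Proof.
move=> E; have [v rv Hv] := reduced_ex u; apply: weq_trans (weq_sym Hv) _.
have [c [h [Q _ _ H]]] := reduced_stab dom_rho rv.
move: Q; rewrite (act_weq Hv) E subrr => /Qv0_coord [E0 _].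
case: H => [|[k _]]; last by rewrite E0 ltxx.
by case: (v) => [|k v'] /=; [move=> _; exact: weq_refl|rewrite cv_rho oner_eq0].
Qed.

Lemma weq_comm_letters v s : realword v -> ~~ isr s -> all (fun k => cv k (a_ s) == 0) v ->
  weq (v ++ [:: s]) (s :: v).
Proof.
move=> + is_; elim: v => [|k v IH] /=; first by move=> _ _; exact: weq_refl.
case/andP=> rk rv /andP [k0 al]; apply: (@weq_trans _ _ _ [:: k, s & v]).
  by apply: weq_cons; exact: IH.
have nks : k != s by apply: contraTneq rk => ->.
have Ask : A s k = 0 by apply: A_sym0; move: k0; rewrite corr_alpha intr_eq0 => /eqP.
exact: weq_sym (@weq_rel _ _ [::] _ _ v (wr_comm is_ nks Ask)).
Qed.

Lemma realword_rword u i : realword u -> isr i -> realword (rword u i).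
Proof. by move=> ru ri; rewrite /rword /realword all_cat /= all_rev ri -/(realword u) ru. Qed.

(** The pairing of [beta] with [w rho] is strictly negative. Removing the first letter [s] of a
    reduced [w], one replaces [beta] by [s beta] if [s] is real; if [beta = alpha s], the product
    [r_beta s] is trivial by regularity. An imaginary [s] is shown to commute with [r_beta]. *)
Lemma rword_shorter u i w : proot u i -> isr i ->
  ~~ (len (rev u ++ w) < len (i :: rev u ++ w))%N -> (len (rword u i ++ w) < len w)%N.
Proof.
have [n] := ubnP (len w); elim: n w u => // n IH w u ltn p ri H.
have ru := proj1 p; have [w1 rw1 Hw1] := reduced_ex w.
case: w1 rw1 Hw1 => [|s w'] rw1 Hw1.
  case/negP: H; have E1 : weq (rev u ++ w) (rev u).
    by have := weq_cat (weq_refl (rev u)) (weq_sym Hw1); rewrite cats0.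
  by rewrite (len_weq (weq_cons i E1)) (len_weq E1); apply/(proot_lenP ru ri).
have [rw' lt] := reduced_cons rw1.
have sign : cobeta u i (act w rho) < 0.
  have El := len_realVN ri H; have Hv := weq_invl (rev u ++ w) ri.
  rewrite cobeta_act -(act_weq Hv) [act _ _]/= cv_refl A_re // -[2%:~R]/(2%:R : R).
  have : 0 < cv i (act (i :: rev u ++ w) rho).
    by apply: cv_rho_gt0 => _; rewrite (len_weq Hv) -El.
  rewrite /=; lra.
rewrite (len_weq (weq_cat (weq_refl (rword u i)) (weq_sym Hw1))) -(len_weq Hw1).
have Ew := act_weq Hw1 rho; rewrite -Ew in sign.
have lw' : (len w' < n)%N by move: lt ltn; rewrite (len_weq Hw1); lia.
case: (boolP (isr s)) => [rs|is_].
  case: (proot_cons p rs) => [[_ Eas]|p'].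
    have Hr : weq (rword u i ++ [:: s]) [::].
      apply: act_rho_faithful; have [-> _] := two_reflections ru ri rs Eas rho.
      have := cobeta_same_root ru ri rs Eas [::] dom_rho => /= ->.
      by rewrite subrr scale0r addr0.
    apply: leq_ltn_trans lt; rewrite -cat1s catA.
    by rewrite (len_weq (weq_cat Hr (weq_refl w'))).
  have H' : ~~ (len (rev (s :: u) ++ w') < len (i :: rev (s :: u) ++ w'))%N.
    apply/negP => up; have := cobeta_up (w := w') dom_rho (fun _ => up).
    have -> : cobeta (s :: u) i (act w' rho) = cobeta u i (act (s :: w') rho).
      by rewrite !cobeta_act rev_cons cat_rcons.
    by move=> /(lt_le_trans sign); rewrite ltxx.
  have := IH w' (s :: u) lw' p' ri H'.
  have E : weq (rword u i ++ s :: w') (s :: (rword (s :: u) i ++ w')).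
    rewrite /rword rev_cons /= -!catA /= cat_rcons; exact: weq_sym (weq_invl _ rs).
  rewrite (len_weq E); have := len_cons s (rword (s :: u) i ++ w'); move: lt; lia.
set b := cobeta u i (act w' rho); set a := cv s (act w' rho); set e := cobeta u i (a_ s).
have a0 : 0 < a by apply: cv_rho_gt0; rewrite (negbTE is_).
have e0 : e <= 0 by exact: cobeta_alpha_im_le0.
have Eb : cobeta u i (act (s :: w') rho) = b - a * e by rewrite /= /refl cobetaB.
rewrite Eb in sign.
have Ps : cv s (act (rword u i ++ w') rho) = a - b * cv s (act u (a_ i)).
  by rewrite act_rword rbetaE // cvB.
have Pge := cv_im_ge0 (rword u i ++ w') dom_rho is_; rewrite Ps in Pge.
have [em Em] := cobeta_int u i (alphaP s); have [f Ef] := corr_int s (P_act u (alphaP i)).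
have f0 := root_im_le0 p is_.
(* If [e < 0], integrality makes [e] and [alpha_s^vee(beta)] at most -1. Then [b < - a], so
   [a - b alpha_s^vee(beta)] is negative, against nonnegativity of imaginary coroots on the orbit of
   [rho]. *)
have {}e0 : e = 0.
  apply/eqP; rewrite eq_le e0 /= leNgt; apply/negP => elt.
  have e1 : e <= -1.
    by rewrite /e Em -[-1 : R]/((-1)%:~R) ler_int; move: elt; rewrite /e Em ltrz0; lia.
  have f1 : cv s (act u (a_ i)) <= -1.
    have fn : f <> 0 by move=> E; move: elt; rewrite /e cobeta_root_im0 ?ltxx // Ef E.
    by move: f0; rewrite Ef -[-1 : R]/((-1)%:~R) ler_int lerz0; lia.
  have h1 : 0 <= a * (-1 - e) by apply: mulr_ge0; [exact: ltW|rewrite subr_ge0].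
  have bn : b < - a by move: sign h1; rewrite mulrBr mulrN1; lra.
  have h2 : 0 <= (- b) * (-1 - cv s (act u (a_ i))).
    by apply: mulr_ge0; [move: bn a0; lra|rewrite subr_ge0].
  by move: Pge h2 bn; rewrite mulrBr mulrN1 mulNr; lra.
rewrite e0 mulr0 subr0 in sign.
(* [r_beta] is now a real word in letters orthogonal to [alpha s], each of which commutes with the
   imaginary letter [s]. *)
have [_ [v [Hv al]]] := cv_root_real0 p ri is_ e0.
have rv : realword v by rewrite (weq_realword Hv) realword_rword.
have H' : ~~ (len (rev u ++ w') < len (i :: rev u ++ w'))%N.
  apply/negP => up; have := cobeta_up (w := w') dom_rho (fun _ => up).
  by move=> /(lt_le_trans sign); rewrite ltxx.
have := IH w' u lw' p ri H'.
have E : weq (rword u i ++ s :: w') (s :: (rword u i ++ w')).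
  rewrite -cat1s catA -cat_cons; apply: weq_cat (weq_refl _).
  apply: (@weq_trans _ _ _ (v ++ [:: s])); first exact: weq_cat (weq_sym Hv) (weq_refl _).
  apply: (@weq_trans _ _ _ (s :: v)); first exact: weq_comm_letters.
  exact: weq_cons.
rewrite (len_weq E); have := len_cons s (rword u i ++ w'); move: lt; lia.
Qed.

End RegularWeight.

(* Adjoining the coordinates [I -> R] to [bV D], fixed by all reflections, gives a datum with the same
   monoid and roots that has a weight [rho] with all coordinates equal to 1. *)
Section Extension.
Variables (R : realType) (D : BCdatum R).
Local Notation I := (bI D).
Local Notation isr := (@isreal R D).
Local Notation W := ((bV D * (I -> R^o))%type : lmodType R).

Definition extP : {pred W} :=
  [pred x : W | (x.1 \in @bP R D) && `[< forall k, exists m : int, x.2 k = m%:~R >]].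
Definition ext_alpha (i : I) : W := (alpha i, 0).
Definition ext_corr (i : I) (x : W) : R := corr i x.1 + x.2 i.

Lemma extP0 : 0 \in extP.
Proof. by rewrite inE bP0; apply/asboolP => k; exists 0. Qed.
Lemma extPB x y : x \in extP -> y \in extP -> x - y \in extP.
Proof.
rewrite !inE => /andP [Px /asboolP Ix] /andP [Py /asboolP Iy].
rewrite bPB //; apply/asboolP => k; have [m Em] := Ix k; have [m' Em'] := Iy k.
by exists (m - m'); rewrite rmorphB /= -Em -Em'.
Qed.
Lemma ext_alphaP i : ext_alpha i \in extP.
Proof. by rewrite inE alphaP; apply/asboolP => k; exists 0. Qed.
Lemma ext_corr_lin i (c : R) (x y : W) :
  ext_corr i (c *: x + y) = c * ext_corr i x + ext_corr i y.
Proof. rewrite /ext_corr /= corr_lin -[(_ + _) i]/(c * x.2 i + y.2 i); ring. Qed.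
Lemma ext_corr_int i x : x \in extP -> exists m : int, ext_corr i x = m%:~R.
Proof.
rewrite inE => /andP [Px /asboolP Ix]; have [m Em] := Ix i; have [m' Em'] := corr_int i Px.
by exists (m' + m); rewrite rmorphD /= -Em -Em'.
Qed.
Lemma ext_corr_alpha i j : ext_corr i (ext_alpha j) = (bA i j)%:~R.
Proof. by rewrite /ext_corr corr_alpha addr0. Qed.
Lemma ext_alpha_indep (s : seq I) (c : I -> int) : uniq s ->
  \sum_(i <- s) (c i)%:~R *: ext_alpha i = 0 -> forall i, i \in s -> c i = 0.
Proof.
move=> us /(congr1 fst) E; apply: (alpha_indep us); rewrite -[RHS]E.
by elim/big_ind2: _ => // [[x1 x2] y1 [z1 z2] y2 /= <- <-].
Qed.
Lemma ext_corr_indep (s : seq I) (c : I -> int) : uniq s ->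
  (forall x, x \in extP -> \sum_(i <- s) (c i)%:~R * ext_corr i x = 0) ->
  forall i, i \in s -> c i = 0.
Proof.
move=> us E i si; pose x : W := (0, fun k => (k == i)%:R).
have Px : x \in extP by rewrite inE bP0; apply/asboolP => k; exists (k == i)%:R; rewrite rmorph_nat.
move: (E x Px); rewrite (bigD1_seq i) //= /ext_corr /x /= cv0 add0r eqxx mulr1 big1.
  by rewrite addr0 => /eqP; rewrite intr_eq0 => /eqP.
by move=> j /negbTE nj; rewrite cv0 nj addr0 mulr0.
Qed.

Definition ext_datum : BCdatum R := Build_BCdatum extP0 extPB ext_alphaP ext_corr_lin
  ext_corr_int ext_corr_alpha (@bA_diag R D) (@bA_off R D) (@bA_sym0 R D) ext_alpha_indep ext_corr_indep.

Lemma ext_weq (u v : seq I) : @weq R D u v <-> @weq R ext_datum u v.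
Proof.
split; elim=> [w|w w' _|w w' w'' _ H1 _|x w w' y H]; try by first [exact: weq_refl|exact: weq_sym|exact: weq_trans H1].
- by apply: (@weq_rel R ext_datum); case: H => *; [apply: wr_inv|apply: wr_braid|apply: wr_comm].
- by apply: (@weq_rel R D); case: H => *; [apply: wr_inv|apply: wr_braid|apply: wr_comm].
Qed.

Lemma ext_len (u : seq I) : @len R D u = @len R ext_datum u.
Proof.
apply/eqP; rewrite eqn_leq; apply/andP; split.
  by have [v Hv <-] := @len_reduced R ext_datum u; apply: len_le; apply/ext_weq.
by have [v Hv <-] := @len_reduced R D u; apply: len_le; apply/ext_weq.
Qed.

Lemma ext_act (w : seq I) (x : bV D) : @act R ext_datum w (x, 0) = (act w x, 0).
Proof.
elim: w => //= z w ->; rewrite /refl /= /ext_corr /= addr0.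
by apply/pair_equal_spec; split=> //=; rewrite scaler0 subr0.
Qed.

Lemma ext_proot u i : @proot R D u i -> @proot R ext_datum u i.
Proof.
case=> ru H; split=> // ri; have [s [c E]] := H ri; exists s, c.
rewrite [LHS](ext_act u (alpha i)) E.
elim/big_rec2: _ => // k x y _ Ey.
by rewrite -Ey; apply/pair_equal_spec; split=> //=; rewrite scaler0 addr0.
Qed.

(** Only words, lengths and positivity of roots occur, and these pass from [D] to its extension,
    where a regular weight exists. *)
Lemma real_reflection_shorter (u : seq I) i (w : seq I) : @proot R D u i -> isr i ->
  ~~ (len (rev u ++ w) < len (i :: rev u ++ w))%N -> (len (rword u i ++ w) < len w)%N.
Proof.
move=> /ext_proot p ri; rewrite !ext_len.
apply: (@rword_shorter R ext_datum (0, fun=> 1)) => //.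
  by rewrite inE bP0; apply/asboolP => k; exists 1.
by move=> k; rewrite /= /ext_corr /= cv0 add0r.
Qed.

End Extension.

(** * Bruhat edges *)

Section Edges.
Variables (R : realType) (D : BCdatum R).
Local Notation I := (bI D).
Local Notation isr := (@isreal R D).
Local Notation dom := (@dominant R D).
Implicit Types (u v w : seq I) (i j k z : I) (la : bV D).

Lemma cat_eq_split (T : Type) (p r x y : seq T) (t : T) : p ++ r = x ++ t :: y ->
  (exists2 p2, p = x ++ t :: p2 & y = p2 ++ r) \/ (exists2 x2, x = p ++ x2 & r = x2 ++ t :: y).
Proof.
elim: p x => [|b p IH] [|c x] //=.
- by move=> ->; right; exists [::].
- by move=> ->; right; exists (c :: x).
- by case=> -> <-; left; exists p.
- case=> -> /IH [[p2 -> ->]|[x2 -> ->]]; first by left; exists p2.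
  by right; exists x2.
Qed.

(* Relations only permute the imaginary letters of a word, so such a letter can be traced and deleted. *)
Lemma weq_delete_im i u v : ~~ isr i -> weq u v ->
  (forall x y, u = x ++ i :: y -> exists x' y', v = x' ++ i :: y' /\ weq (x' ++ y') (x ++ y)) /\
  (forall x y, v = x ++ i :: y -> exists x' y', u = x' ++ i :: y' /\ weq (x' ++ y') (x ++ y)).
Proof.
move=> ii; elim=> {u v} [u|u v _ [H1 H2]|u v w _ [H1 H2] _ [H3 H4]|p u v q H].
- by split=> x y E; exists x, y; split=> //; exact: weq_refl.
- by split.
- split=> x y E.
    have [x' [y' [E' H']]] := H1 x y E; have [x2 [y2 [E2 H2']]] := H3 _ _ E'.
    by exists x2, y2; split=> //; exact: weq_trans H2' H'.
  have [x' [y' [E' H']]] := H4 x y E; have [x2 [y2 [E2 H2']]] := H2 _ _ E'.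
  by exists x2, y2; split=> //; exact: weq_trans H2' H'.
have core (a b : seq I) : (forall c d, weq (c ++ a ++ d) (c ++ b ++ d)) ->
   (forall x y, a = x ++ i :: y -> exists x' y', b = x' ++ i :: y' /\ x' ++ y' = x ++ y) ->
   forall x y, p ++ a ++ q = x ++ i :: y ->
   exists x' y', p ++ b ++ q = x' ++ i :: y' /\ weq (x' ++ y') (x ++ y).
  move=> Hab Hi x y E; case: (cat_eq_split E) => [[p2 Ep Ey]|[x2 Ex E2]].
    subst p y.
    exists x, (p2 ++ b ++ q); split; first by rewrite -catA.
    by have := weq_sym (Hab (x ++ p2) q); rewrite -!catA.
  case: (cat_eq_split E2) => [[a2 Ea Ey]|[q2 Ex2 Eq]]; subst x.
  - have [x' [y' [-> E']]] := Hi _ _ Ea; exists (p ++ x'), (y' ++ q).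
    rewrite Ey -!catA; split=> //; rewrite [x' ++ _]catA E' -!catA; exact: weq_refl.
  - by exists (p ++ b ++ q2), y; rewrite Ex2 Eq -!catA; split=> //; apply: weq_sym.
have noreal (a x y : seq I) : realword a -> a <> x ++ i :: y.
  by move=> ra E; move: ra; rewrite E /realword all_cat /= (negbTE ii) andbF.
have swap (a b : I) x y : [:: a; b] = x ++ i :: y ->
    exists x' y', [:: b; a] = x' ++ i :: y' /\ x' ++ y' = x ++ y.
  case: x => [|c [|d [|? x]]] //= [].
    by move=> -> <-; exists [:: b], [::].
  by move=> -> -> <-; exists [::], [:: c].
have rbraid j k n : isr j -> isr k -> realword (flatten (nseq n [:: j; k])).
  by move=> rj rk; elim: n => //= n ->; rewrite rj rk.
split; apply: core.
- by move=> c d; exact: weq_rel.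
- case: H => [j rj|j k rj rk _ _|j k _ _ _] x y; last exact: swap.
    by move/noreal; case; rewrite /= rj.
  by move/noreal; case; exact: rbraid.
- by move=> c d; apply: weq_sym; exact: weq_rel.
- case: H => [j rj|j k rj rk _ _|j k _ _ _] x y; last exact: swap.
    by case: x.
  by case: x.
Qed.

(** In a reduced word for [u i u^-1 w] the traced letter [i] can be deleted. What remains represents
    [u u^-1 w = w]. *)
Lemma im_reflection_longer u i w : realword u -> ~~ isr i -> (len w < len (rword u i ++ w))%N.
Proof.
move=> ru ii; have [z rz Hz] := reduced_ex (rword u i ++ w).
rewrite -(len_weq Hz) -rz; have [_ /(_ u (rev u ++ w))] := weq_delete_im ii Hz.
rewrite /rword -catA => /(_ erefl) [x [y [-> H]]].
rewrite size_cat /= addnS ltnS -size_cat; apply: len_le; apply: (weq_trans H).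
rewrite catA; exact: (weq_cat (weq_revr ru) (weq_refl w)).
Qed.

(** With [cobeta_gt0_lenlt] this is the dictionary between Bruhat edges and signs. Only the weak
    sign survives in this direction, as [la] may be singular. *)
Lemma lenlt_cobeta_ge0 u i w la : proot u i -> dom la -> lenlt w (rword u i ++ w) ->
  0 <= cobeta u i (act w la).
Proof.
move=> p dla /lenltE lt; apply: cobeta_up => // ri; apply: contrapT => /negP H.
by have := real_reflection_shorter p ri H; move: lt; lia.
Qed.

Lemma cobeta_gt0_lenlt u i w la : proot u i -> dom la -> 0 < cobeta u i (act w la) ->
  lenlt w (rword u i ++ w).
Proof.
move=> p dla gt0; apply/lenltE; have ru := proj1 p.
case: (boolP (isr i)) => [ri|ii]; last exact: im_reflection_longer.
case: (boolP (len (rev u ++ w) < len (i :: rev u ++ w))%N) => [up|H]; last first.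
  by have := cobeta_down dla ri H; rewrite leNgt gt0.
have E2 : weq (rev u ++ rword u i ++ w) (i :: rev u ++ w).
  rewrite /rword -catA catA -(cat1s i) -[X in weq _ X]cat0s.
  exact: weq_cat (weq_revl ru) (weq_refl _).
have E3 : weq (rword u i ++ rword u i ++ w) w.
  apply: (@weq_trans _ _ _ (u ++ i :: rev u ++ rword u i ++ w)).
    by rewrite {1}/rword -catA; exact: weq_refl.
  apply: (@weq_trans _ _ _ (u ++ i :: i :: rev u ++ w)).
    by apply: weq_cat (weq_refl _) _; exact: weq_cons.
  apply: (@weq_trans _ _ _ (u ++ rev u ++ w)).
    by apply: weq_cat (weq_refl _) _; exact: weq_invl.
  rewrite catA; exact: (weq_cat (weq_revr ru) (weq_refl w)).
(* The shortening lemma is applied to [r_beta w], whose reflection is [w]. *)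
rewrite -{1}(len_weq E3); apply: real_reflection_shorter => //.
by rewrite (len_weq (weq_cons i E2)) (len_weq E2) (len_weq (weq_invl _ ri)) -leqNgt ltnW.
Qed.

End Edges.

(** * The order on tuples of weights and its lifting properties *)

Section TupleOrder.
Variables (R : realType) (D : BCdatum R).
Local Notation I := (bI D).
Local Notation V := (bV D).
Local Notation a_ := (@alpha R D).
Local Notation cv := (@corr R D).
Local Notation isr := (@isreal R D).
Local Notation dom := (@dominant R D).
Implicit Types (u w x y : seq I) (i j k z : I) (mu nu xi la : V).

Lemma proot_nil i : proot [::] i.
Proof.
split=> // _; apply/inQplusE; exists (fun k => (i == k)%:R), 1; split; first exact: Qv_alpha.
by [].
Qed.

Lemma cobeta_nil i mu : cobeta [::] i mu = cv i mu. Proof. by []. Qed.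

Lemma rbeta_cons u i z mu : isr z -> rbeta (z :: u) i (refl z mu) = refl z (rbeta u i mu).
Proof.
move=> rz; rewrite /rbeta /rword rev_cons -cats1 /= -[i :: _ ++ _]/((i :: rev u) ++ [:: z]).
by rewrite catA act_cat /= reflK.
Qed.

Lemma cobeta_cons u i z mu : isr z -> cobeta (z :: u) i (refl z mu) = cobeta u i mu.
Proof. by move=> rz; rewrite /cobeta rev_cons -cats1 act_cat /= reflK. Qed.

(** A strict sign on one dominant weight decides the comparison of lengths, which in turn bounds the
    sign on every other dominant weight. *)
Lemma cobeta_coherent u i w la la' : proot u i -> dom la -> dom la' ->
  0 < cobeta u i (act w la) -> 0 <= cobeta u i (act w la').
Proof.
by move=> p dl dl' H; apply: lenlt_cobeta_ge0 => //; exact: (cobeta_gt0_lenlt p dl H).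
Qed.

Lemma cv_coherent z w la la' : isr z -> dom la -> dom la' ->
  cv z (act w la) < 0 -> cv z (act w la') <= 0.
Proof.
move=> rz dl dl' H; rewrite leNgt; apply/negP => H'.
have := cobeta_coherent (proot_nil z) dl' dl H'; rewrite cobeta_nil; lra.
Qed.

Variable lam : nat -> V.

(* The order generated by positive reflections on the orbit of the tuple [lam 1, ..., lam m]: weights of a
   single [lam q] do not determine a coset of words, so the Bruhat order is tracked on words through this order. *)
Inductive tge (m : nat) (w : seq I) : seq I -> Prop :=
| tge_refl x : (forall q, (1 <= q <= m)%N -> act w (lam q) = act x (lam q)) -> tge m w x
| tge_step x y u i : tge m w x -> proot u i ->
    (forall q, (1 <= q <= m)%N -> act x (lam q) = rbeta u i (act y (lam q))) ->
    (exists2 q, (1 <= q <= m)%N & 0 < cobeta u i (act y (lam q))) -> tge m w y.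

Lemma tge_eqr m w x y : (forall q, (1 <= q <= m)%N -> act x (lam q) = act y (lam q)) ->
  tge m w x -> tge m w y.
Proof.
move=> E H; case: H E => {x} [x E1|x x' u i H p E1 [q hq E2]] E.
  by apply: tge_refl => q hq; rewrite E1 // E.
apply: tge_step H p _ _ => [q' hq'|]; first by rewrite E1 // E.
by exists q => //; rewrite -E.
Qed.

Lemma tge_trans m w x y : tge m w x -> tge m x y -> tge m w y.
Proof.
move=> H; elim=> {y} [y E|y y' u i _ IH p E1 E2]; first exact: tge_eqr H.
exact: tge_step IH p E1 E2.
Qed.

Lemma tge_eql m w x y : (forall q, (1 <= q <= m)%N -> act w (lam q) = act x (lam q)) ->
  tge m x y -> tge m w y.
Proof. by move=> E; apply: tge_trans; apply: tge_refl. Qed.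

Lemma tge_id m w : tge m w w. Proof. exact: tge_refl. Qed.

Lemma tge_one m x y u i : proot u i ->
  (forall q, (1 <= q <= m)%N -> act x (lam q) = rbeta u i (act y (lam q))) ->
  (exists2 q, (1 <= q <= m)%N & 0 < cobeta u i (act y (lam q))) -> tge m x y.
Proof. exact: tge_step (tge_id _ _). Qed.

Variable n : nat.
Hypothesis lam_dom : forall q, (1 <= q <= n)%N -> dom (lam q).

Lemma le_n q m : (m <= n)%N -> (1 <= q <= m)%N -> (1 <= q <= n)%N.
Proof. by move=> mn /andP [-> qm]; rewrite (leq_trans qm mn). Qed.

Lemma wge_trans mu nu xi : wge mu nu -> wge nu xi -> wge mu xi.
Proof. by move=> H; elim=> // x y u i _ IH p E C; exact: wge_step IH p E C. Qed.

Lemma tge_wge m w x q : (m <= n)%N -> (1 <= q <= m)%N -> tge m w x ->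
  wge (act w (lam q)) (act x (lam q)).
Proof.
move=> mn hq; elim=> {x} [x ->|x y u i _ IH p E [q' hq' H]] //; first exact: wge_refl.
have : 0 <= cobeta u i (act y (lam q)).
  by apply: (cobeta_coherent p _ _ H); apply: lam_dom; lia.
rewrite le_eqVlt => /orP [/eqP E0|H2]; last by apply: wge_step IH p _ H2; rewrite E.
by move: IH; rewrite E // rbetaE -?E0 ?scale0r ?subr0 //; case: p.
Qed.

Lemma tge_cons_up m z w : (m <= n)%N -> (forall q, (1 <= q <= m)%N -> 0 <= cv z (act w (lam q))) ->
  tge m (z :: w) w.
Proof.
move=> mn H; case: (pselect (exists2 q, (1 <= q <= m)%N & 0 < cv z (act w (lam q)))) => [H'|H'].
  exact: (tge_one (proot_nil z)).
apply: tge_refl => q hq /=; rewrite /refl.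
have := H q hq; rewrite le_eqVlt => /orP [/eqP <-|H2]; first by rewrite scale0r subr0.
by case: H'; exists q.
Qed.

Lemma tge_cons_down m z w : (m <= n)%N -> isr z ->
  (forall q, (1 <= q <= m)%N -> cv z (act w (lam q)) <= 0) -> tge m w (z :: w).
Proof.
move=> mn rz H; apply: (tge_eql (x := [:: z, z & w])) => [q hq|].
  by rewrite /= reflK.
apply: tge_cons_up => // q hq; rewrite /= cv_refl A_re // -[2%:~R]/(2%:R : R).
by have := H q hq; lra.
Qed.

(* [star z w] is the larger, [circ z w] the smaller of [w] and [z :: w]; coherence of signs on the orbits of
   all the dominant [lam q] makes the choice independent of [q]. *)
Definition star z w := if has (fun q => cv z (act w (lam q)) < 0) (iota 1 n) then w else z :: w.
Definition circ z w := if has (fun q => 0 < cv z (act w (lam q))) (iota 1 n) then w else z :: w.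
Definition vstar z mu := if cv z mu < 0 then mu else refl z mu.
Definition vcirc z mu := if 0 < cv z mu then mu else refl z mu.

Lemma mem_iota1 q : (q \in iota 1 n) = (1 <= q <= n)%N.
Proof. by rewrite mem_iota add1n ltnS. Qed.

Lemma refl0 z mu : cv z mu = 0 -> refl z mu = mu.
Proof. by rewrite /refl => ->; rewrite scale0r subr0. Qed.

Lemma starP z w : isr z ->
  (star z w = w /\ forall q, (1 <= q <= n)%N -> cv z (act w (lam q)) <= 0) \/
  (star z w = z :: w /\ forall q, (1 <= q <= n)%N -> 0 <= cv z (act w (lam q))).
Proof.
move=> rz; rewrite /star; case: ifP => [/hasP [q]|/hasPn H].
  rewrite mem_iota1 => hq H; left; split=> // q' hq'.
  exact: (cv_coherent rz (lam_dom hq) (lam_dom hq') H).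
by right; split=> // q hq; rewrite leNgt; apply: H; rewrite mem_iota1.
Qed.

Lemma circP z w : isr z ->
  (circ z w = w /\ forall q, (1 <= q <= n)%N -> 0 <= cv z (act w (lam q))) \/
  (circ z w = z :: w /\ forall q, (1 <= q <= n)%N -> cv z (act w (lam q)) <= 0).
Proof.
move=> rz; rewrite /circ; case: ifP => [/hasP [q]|/hasPn H].
  rewrite mem_iota1 => hq H; left; split=> // q' hq'.
  exact: (cobeta_coherent (proot_nil z) (lam_dom hq) (lam_dom hq') H).
by right; split=> // q hq; rewrite leNgt; apply: H; rewrite mem_iota1.
Qed.

Lemma star_self z w : (exists2 q, (1 <= q <= n)%N & cv z (act w (lam q)) < 0) -> star z w = w.
Proof. by case=> q hq H; rewrite /star ifT //; apply/hasP; exists q; rewrite ?mem_iota1. Qed.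
Lemma circ_self z w : (exists2 q, (1 <= q <= n)%N & 0 < cv z (act w (lam q))) -> circ z w = w.
Proof. by case=> q hq H; rewrite /circ ifT //; apply/hasP; exists q; rewrite ?mem_iota1. Qed.

Lemma act_star z w q : isr z -> (1 <= q <= n)%N -> act (star z w) (lam q) = vstar z (act w (lam q)).
Proof.
move=> rz hq; rewrite /vstar; have [[-> H]|[-> H]] := starP w rz; have := H q hq.
  by rewrite le_eqVlt => /orP [/eqP H0|->] //; rewrite H0 ltxx refl0.
by rewrite leNgt => /negbTE ->.
Qed.

Lemma act_circ z w q : isr z -> (1 <= q <= n)%N -> act (circ z w) (lam q) = vcirc z (act w (lam q)).
Proof.
move=> rz hq; rewrite /vcirc; have [[-> H]|[-> H]] := circP w rz; have := H q hq.
  by rewrite le_eqVlt => /orP [/eqP H0|->] //; rewrite -H0 ltxx refl0.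
by rewrite leNgt => /negbTE ->.
Qed.

Lemma tge_star_l m z w : (m <= n)%N -> isr z -> tge m (star z w) w.
Proof.
move=> mn rz; have [[-> H]|[-> H]] := starP w rz; first exact: tge_id.
by apply: tge_cons_up => // q hq; apply: H; exact: le_n hq.
Qed.
Lemma tge_star_cons m z w : (m <= n)%N -> isr z -> tge m (star z w) (z :: w).
Proof.
move=> mn rz; have [[-> H]|[-> H]] := starP w rz; last exact: tge_id.
by apply: tge_cons_down => // q hq; apply: H; exact: le_n hq.
Qed.
Lemma tge_circ_r m z w : (m <= n)%N -> isr z -> tge m w (circ z w).
Proof.
move=> mn rz; have [[-> H]|[-> H]] := circP w rz; first exact: tge_id.
by apply: tge_cons_down => // q hq; apply: H; exact: le_n hq.
Qed.
Lemma tge_circ_cons m z w : (m <= n)%N -> isr z -> tge m (z :: w) (circ z w).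
Proof.
move=> mn rz; have [[-> H]|[-> H]] := circP w rz; last exact: tge_id.
by apply: tge_cons_up => // q hq; apply: H; exact: le_n hq.
Qed.

(** Either [beta = alpha z], and equality of coroots makes the step [r_z] itself, or [r_z beta] is
    still positive and the whole step can be conjugated. *)
Lemma step_reflect m x y u i z : (m <= n)%N -> isr z -> proot u i ->
  (forall q, (1 <= q <= m)%N -> act x (lam q) = rbeta u i (act y (lam q))) ->
  (exists2 q, (1 <= q <= m)%N & 0 < cobeta u i (act y (lam q))) ->
  (forall q, (1 <= q <= m)%N -> act x (lam q) = act (z :: y) (lam q)) \/ tge m (z :: x) (z :: y).
Proof.
move=> mn rz p E [q hq H]; case: (proot_cons p rz) => [[ri Ea]|p'].
  left=> q' hq'; rewrite E // rbetaE; last by case: p.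
  by rewrite Ea (cobeta_same_root (proj1 p) ri rz Ea) //; exact: lam_dom (le_n mn hq').
right; apply: (tge_one p') => [q' hq'|]; first by rewrite /= rbeta_cons // E.
by exists q => //; rewrite /= cobeta_cons.
Qed.

(** The lifting property of the Bruhat order in tuple form; [tge_circ] is its mirror image. It
    suffices to treat one step, where [step_reflect] offers two cases. *)
Lemma tge_star m z w x : (m <= n)%N -> isr z -> tge m w x -> tge m (star z w) (star z x).
Proof.
move=> mn rz; elim=> {x} [x E|x y u i _ IH p E H].
  by apply: tge_refl => q hq; rewrite !act_star ?E //; exact: le_n hq.
apply: tge_trans IH _; have [[-> _]|[-> _]] := starP y rz.
  by apply: tge_trans (tge_star_l x mn rz) _; exact: tge_one p E H.
case: (step_reflect mn rz p E H) => [E'|H'].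
  by apply: tge_eqr E' _; exact: tge_star_l.
exact: tge_trans (tge_star_cons x mn rz) H'.
Qed.

Lemma tge_circ m z w x : (m <= n)%N -> isr z -> tge m w x -> tge m (circ z w) (circ z x).
Proof.
move=> mn rz; elim=> {x} [x E|x y u i _ IH p E H].
  by apply: tge_refl => q hq; rewrite !act_circ ?E //; exact: le_n hq.
apply: tge_trans IH _; have [[-> _]|[-> _]] := circP x rz.
  by apply: tge_trans (tge_circ_r y mn rz); exact: tge_one p E H.
case: (step_reflect mn rz p E H) => [E'|H'].
  apply: (tge_trans (x := y)); last exact: tge_circ_r.
  by apply: tge_refl => q hq; rewrite /= E' //= reflK.
exact: tge_trans H' (tge_circ_cons y mn rz).
Qed.

Lemma cv_root_im_le0 u i j mu : proot u i -> ~~ isr j -> 0 <= cobeta u i mu ->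
  cv j mu <= cv j (rbeta u i mu).
Proof.
move=> p ij H; rewrite rbetaE ?cvB; last by case: p.
by have := root_im_le0 p ij; nra.
Qed.

Lemma wge_cv_im j mu nu : ~~ isr j -> wge mu nu -> cv j nu <= cv j mu.
Proof.
move=> ij; elim=> // x y u i _ IH p E H; apply: le_trans IH.
by rewrite E; apply: cv_root_im_le0 => //; exact: ltW.
Qed.

(** An unchanged [alpha_j^vee] means [alpha_j^vee(beta) = 0]. Orthogonality then holds on the other
    side too, so [r_beta] commutes with [r_j]. *)
Lemma im_step_perp u i j mu : proot u i -> ~~ isr j -> 0 < cobeta u i mu ->
  cv j (rbeta u i mu) = cv j mu -> cv j (act u (a_ i)) = 0 /\ cobeta u i (a_ j) = 0.
Proof.
move=> p ij H; have ru := proj1 p; rewrite rbetaE // cvB => E.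
have c0 : cv j (act u (a_ i)) = 0.
  have : cobeta u i mu * cv j (act u (a_ i)) = 0 by lra.
  by move/eqP; rewrite mulf_eq0 gt_eqF //= => /eqP.
by split=> //; exact: cobeta_root_im0.
Qed.

Lemma perp_commute u i j mu : realword u -> cv j (act u (a_ i)) = 0 -> cobeta u i (a_ j) = 0 ->
  [/\ refl j (rbeta u i mu) = rbeta u i (refl j mu), cobeta u i (refl j mu) = cobeta u i mu &
      cv j (rbeta u i mu) = cv j mu].
Proof.
move=> ru c0 d0; have Ec : cobeta u i (refl j mu) = cobeta u i mu.
  by rewrite /refl cobetaB d0 mulr0 subr0.
have Ej : cv j (rbeta u i mu) = cv j mu by rewrite rbetaE // cvB c0 mulr0 subr0.
by split=> //; rewrite !rbetaE // Ec /refl cvB c0 mulr0 subr0 addrAC.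
Qed.

(** Imaginary heights are monotone along the order. Equal values at the ends are therefore equal
    throughout, and every step commutes with [r_j]. *)
Lemma tge_im m w x j : (m <= n)%N -> ~~ isr j -> tge m w x ->
  (forall q, (1 <= q <= m)%N -> cv j (act w (lam q)) = cv j (act x (lam q))) ->
  tge m (j :: w) (j :: x).
Proof.
move=> mn ij; elim=> {x} [x E|x y u i Hx IH p E [q hq H]] Ej.
  by apply: tge_refl => q hq; rewrite /= E.
have Ejx q' : (1 <= q' <= m)%N -> cv j (act x (lam q')) = cv j (act y (lam q')).
  move=> hq'; apply/eqP; rewrite eq_le -{1}(Ej q' hq') (wge_cv_im ij (tge_wge mn hq' Hx)) /=.
  rewrite E //; apply: cv_root_im_le0 => //.
  by apply: (cobeta_coherent p _ _ H); apply: lam_dom; lia.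
have H1 : tge m (j :: w) (j :: x) by apply: IH => q' hq'; rewrite Ej // Ejx.
apply: tge_trans H1 _.
have [c0 d0] := im_step_perp p ij H (etrans (congr1 (cv j) (esym (E q hq))) (Ejx q hq)).
have ru := proj1 p; apply: (tge_one p) => [q' hq'|].
  by rewrite /= E //; case: (perp_commute (act y (lam q')) ru c0 d0).
by exists q => //=; case: (perp_commute (act y (lam q)) ru c0 d0) => _ ->.
Qed.

End TupleOrder.

(** * The order on weights and chains *)

Section WeightOrder.
Variables (R : realType) (D : BCdatum R).
Local Notation I := (bI D).
Local Notation V := (bV D).
Local Notation a_ := (@alpha R D).
Local Notation cv := (@corr R D).
Local Notation isr := (@isreal R D).
Local Notation dom := (@dominant R D).
Implicit Types (u w x y : seq I) (i j k z : I) (mu nu xi : V).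
Variable la : V.
Hypothesis la_dom : dom la.
Local Notation orb := (@inWorbit R D la).
Let lam : nat -> V := fun=> la.
Let lam_dom q : (1 <= q <= 1)%N -> dom (lam q). Proof. by []. Qed.

(** Reads the order on one orbit as the tuple order of a single weight, so that [tge_star],
    [tge_circ] and [tge_im] apply to it. *)
Lemma wge_words mu y : wge mu (act y la) -> exists2 x, mu = act x la & tge lam 1 x y.
Proof.
have H nu : wge mu nu -> forall y, nu = act y la -> exists2 x, mu = act x la & tge lam 1 x y.
  2: by move=> H'; exact: (H _ H').
elim=> {nu y} [|x' y' u i _ IH p E C] y Ey; first by exists y => //; exact: tge_id.
have [x Ex Hx] := IH (rword u i ++ y) ltac:(by rewrite act_rword -Ey E).
exists x => //; apply: tge_step Hx p _ _ => [q _|]; first by rewrite act_rword.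
by exists 1%N => //; rewrite /lam -Ey.
Qed.

Lemma orb_act w : orb (act w la). Proof. by exists w. Qed.

Lemma orb_refl z nu : orb nu -> orb (refl z nu).
Proof. by case=> w <-; exists (z :: w). Qed.

Lemma orb_rbeta u i nu : orb nu -> orb (rbeta u i nu).
Proof. by case=> w <-; exists (rword u i ++ w); rewrite act_rword. Qed.

Lemma orb_wge mu nu : orb nu -> wge mu nu -> orb mu.
Proof. by case=> y <- /wge_words [x -> _]; exact: orb_act. Qed.

Lemma orb_P nu : orb nu -> nu \in @bP R D.
Proof. by case=> y <-; apply: P_act; case: la_dom. Qed.

Lemma words_wge x y : tge lam 1 x y -> wge (act x la) (act y la).
Proof. exact: (tge_wge lam_dom (q := 1)). Qed.

Lemma wge_star z mu nu : orb nu -> isr z -> wge mu nu -> wge (vstar z mu) (vstar z nu).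
Proof.
case=> y <- rz /wge_words [x -> H].
have := words_wge (tge_star lam_dom (leqnn 1) rz H).
by rewrite -[la]/(lam 1) !(act_star lam_dom).
Qed.

Lemma wge_circ z mu nu : orb nu -> isr z -> wge mu nu -> wge (vcirc z mu) (vcirc z nu).
Proof.
case=> y <- rz /wge_words [x -> H].
have := words_wge (tge_circ lam_dom (leqnn 1) rz H).
by rewrite -[la]/(lam 1) !(act_circ lam_dom).
Qed.

Lemma wge_up z nu : 0 < cv z nu -> wge (refl z nu) nu.
Proof. by move=> H; apply: (wge_step (wge_refl _) (proot_nil z)). Qed.

Lemma wge_down z mu : isr z -> cv z mu < 0 -> wge mu (refl z mu).
Proof.
move=> rz H; have := @wge_up z (refl z mu); rewrite reflK //; apply.
rewrite cv_refl A_re // -[2%:~R]/(2%:R : R); lra.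
Qed.

Lemma step_coords u i nu : proot u i -> orb nu -> 0 < cobeta u i nu ->
  exists c h, [/\ Qv (nu - rbeta u i nu) c h, forall k, 0 <= c k & 0 < h].
Proof.
move=> p onu H; have ru := proj1 p; have [m Em] := cobeta_int u i (orb_P onu).
have [c [h [Q c0 [k ck]]]] := proot_coords p; rewrite Em ltr0z in H.
exists (fun k => m * c k), (m * h); split.
- by rewrite rbetaE // opprB addrC subrK Em; exact: QvZ.
- by move=> l; rewrite mulr_ge0 // ltW.
- by rewrite mulr_gt0 // (Qv_height_gt0 Q c0 ck).
Qed.

Lemma wge_coords mu nu : orb nu -> wge mu nu ->
  exists c h, [/\ Qv (nu - mu) c h, forall k, 0 <= c k & mu = nu \/ 0 < h].
Proof.
move=> + H; elim: H => {nu} [|x y u i Hx IH p E C] ony.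
  by exists (fun=> 0), 0; rewrite subrr; split; [exact: Qv0| |left].
have onx : orb x by rewrite E; exact: orb_rbeta.
have [c [h [Q c0 h0]]] := IH onx; have [d [g [Qd d0 g0]]] := step_coords p ony C.
exists (fun k => d k + c k), (g + h); split.
- by have := QvD Qd Q; rewrite -E addrA subrK.
- by move=> k; rewrite addr_ge0.
- by right; have := Qv_height_ge0 Q c0; lia.
Qed.

Lemma wge_antisym mu nu : orb nu -> wge mu nu -> wge nu mu -> mu = nu.
Proof.
move=> onu H1 H2; have omu := orb_wge onu H1.
have [c [h [Q _ [//|h0]]]] := wge_coords onu H1.
have [d [g [Q' d0 _]]] := wge_coords omu H2.
have := QvN Q; rewrite opprB => QN; have [_ E] := Qv_uniq QN Q'.
by have := Qv_height_ge0 Q' d0; lia.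
Qed.

Lemma refl_neq z nu : cv z nu != 0 -> refl z nu <> nu.
Proof.
move=> /eqP H /(congr1 (fun t => nu - t)); rewrite /refl opprB addrC subrK subrr => /eqP.
by rewrite scaler_eq0 => /orP [/eqP //|/eqP]; exact: alpha_neq0.
Qed.

Lemma cv_refl_re z nu : isr z -> cv z (refl z nu) = - cv z nu.
Proof. by move=> rz; rewrite cv_refl A_re // -[2%:~R]/(2%:R : R); ring. Qed.

Section CoversReflect.
Variables (z i : I) (u : seq I) (mu nu : V).
Hypotheses (onu : orb nu) (rz : isr z) (p : proot (z :: u) i).
Hypotheses (E : mu = rbeta u i nu) (C : 0 < cobeta u i nu) (cov : covers mu nu).

Lemma wge_refl_refl : wge (refl z mu) (refl z nu).
Proof. by apply: (wge_step (wge_refl _) p); rewrite ?rbeta_cons ?cobeta_cons // E. Qed.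

(** The reflected pair is ordered as well. With the excluded signs, [mu >= r_z mu >= r_z nu >= nu]
    would be a chain inside the cover, with a strict step at one end at least. *)
Lemma covers_sign : ~ (cv z mu <= 0 /\ 0 < cv z nu) /\ ~ (cv z mu < 0 /\ 0 <= cv z nu).
Proof.
have [H1 nH Hx] := cov; have H := wge_refl_refl.
have N : refl z mu <> refl z nu by move/(can_inj (reflK rz)).
split=> -[s1 s2].
  have H2 : wge mu (refl z mu).
    by move: s1; rewrite le_eqVlt => /orP [/eqP s1|s1]; [rewrite refl0 //; exact: wge_refl|exact: wge_down].
  case: (Hx _ (wge_trans H2 H) (wge_up s2)) => E2; last by apply: (refl_neq _ E2); rewrite ?(gt_eqF s2) ?(lt_eqF s1).
  have E3 : refl z mu = nu by rewrite -E2 reflK.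
  by apply: nH; apply: (wge_antisym onu H1); move: H; rewrite E3 E2.
have H2 : wge (refl z nu) nu.
  by move: s2; rewrite le_eqVlt => /orP [/eqP s2|s2]; [rewrite refl0 //; exact: wge_refl|exact: wge_up].
case: (Hx _ (wge_down rz s1) (wge_trans H H2)) => E2; first by apply: (refl_neq _ E2); rewrite ?(gt_eqF s2) ?(lt_eqF s1).
apply: N; rewrite E2; apply: (wge_antisym (orb_refl z onu)) => //.
by move: H; rewrite E2.
Qed.

(** The monotone map [vcirc z], or [vstar z] for the other sign, carries the interval between the
    reflected weights back into the interval from [nu] to [mu], which has only its two ends. *)
Lemma covers_refl : (0 < cv z mu /\ 0 < cv z nu) \/ (cv z mu < 0 /\ cv z nu < 0) ->
  covers (refl z mu) (refl z nu).
Proof.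
have [H1 nH Hx] := cov; move=> sgn; split; [exact: wge_refl_refl|by move/(can_inj (reflK rz))|].
move=> xi Ha Hb; have oxi : orb xi by exact: orb_wge (orb_refl z onu) Hb.
have ormu : orb (refl z mu) by exact: orb_wge oxi Ha.
case: sgn => [[s1 s2]|[s1 s2]].
  have := wge_circ oxi rz Ha; have := wge_circ (orb_refl z onu) rz Hb.
  rewrite /vcirc !cv_refl_re // !oppr_gt0 !(lt_gtF s1, lt_gtF s2) !reflK // -/(vcirc z xi) => Hb' Ha'.
  case: (Hx _ Ha' Hb'); rewrite /vcirc; case: ifP => sx Ex; try first [by left; rewrite -Ex reflK|by right; rewrite -Ex reflK].
    case: (Hx (refl z nu)) => [||E2|E2].
    - by rewrite -Ex.
    - exact: wge_up.
    - by move: s1; rewrite -E2 cv_refl_re // oppr_gt0 (lt_gtF s2).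
    - by case: (refl_neq _ E2); rewrite gt_eqF.
  case: (refl_neq (z := z) (nu := nu)); first by rewrite gt_eqF.
  by apply: (wge_antisym onu); [exact: wge_up|rewrite -{1}Ex].
have := wge_star oxi rz Ha; have := wge_star (orb_refl z onu) rz Hb.
rewrite /vstar !cv_refl_re // !oppr_lt0 !(lt_gtF s1, lt_gtF s2) !reflK // -/(vstar z xi) => Hb' Ha'.
case: (Hx _ Ha' Hb'); rewrite /vstar; case: ifP => sx Ex; try first [by left; rewrite -Ex reflK|by right; rewrite -Ex reflK].
  case: (refl_neq (z := z) (nu := mu)); first by rewrite lt_eqF.
  apply: (wge_antisym (orb_wge onu H1)); first by rewrite -{2}Ex.
  exact: wge_down.
case: (Hx (refl z mu)) => [||E2|E2].
- exact: wge_down.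
- by rewrite -Ex.
- by case: (refl_neq _ E2); rewrite lt_eqF.
- by move: s2; rewrite -E2 cv_refl_re // oppr_lt0 (lt_gtF s1).
Qed.

End CoversReflect.

(** [vcirc z] is monotone and sends both ends to [nu], hence sends all that lies between them to
    [nu]. *)
Lemma covers_up z nu : orb nu -> isr z -> 0 < cv z nu -> covers (refl z nu) nu.
Proof.
move=> onu rz s; split; [exact: wge_up|by apply: refl_neq; rewrite gt_eqF|].
move=> xi Ha Hb; have oxi := orb_wge onu Hb.
have := wge_circ oxi rz Ha; have := wge_circ onu rz Hb.
rewrite /vcirc !cv_refl_re // !oppr_gt0 s (lt_gtF s) reflK // -/(vcirc z xi) => Hb' Ha'.
have := wge_antisym onu Hb' Ha'; rewrite /vcirc; case: ifP => _ Ex; first by right.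
by left; rewrite -Ex reflK.
Qed.

Lemma root_im_coord u i c h k : realword u -> ~~ isr k ->
  Qv (act u (a_ i)) c h -> c k = (i == k)%:R.
Proof.
move=> ru ik; elim: u c h ru => [|z u IH] c h /=.
  by move=> _ Q; have [-> _] := Qv_uniq Q (Qv_alpha i).
case/andP=> rz ru Q; have Pu : act u (a_ i) \in @bP R D by apply/P_act/alphaP.
have [m Em] := corr_int z Pu; have [d [g [Qd _]]] := root_coords u i.
have Q' := QvB Qd (Qv_zalpha m z).
move: Q; rewrite /refl Em => Q; have [-> _] := Qv_uniq Q Q'; rewrite (IH _ _ ru Qd) /=.
case: (z =P k) => [E|_]; last by rewrite mulr0 subr0.
by rewrite E (negbTE ik) in rz.
Qed.

(** [nu - r_j nu] is a multiple of [alpha j], so the root of a first step above [nu] has no other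
    coordinate. It cannot be real, and an imaginary one has [j]-coordinate 1; hence it is [alpha j],
    with the simple coroot by [imroot_simple_or]. *)
Lemma covers_im_up j nu : orb nu -> ~~ isr j -> 0 < cv j nu -> covers (refl j nu) nu.
Proof.
move=> onu ij s; split; [exact: wge_up|by apply: refl_neq; rewrite gt_eqF|] => xi Ha Hb.
have [E|[x [u [i [Hx p E C]]]]] : xi = nu \/ exists (x : V) u i,
    [/\ wge xi x, proot u i, x = rbeta u i nu & 0 < cobeta u i nu].
- by case: Hb => [|x y u i Hx p E C]; [left|right; exists x, u, i].
- by right.
left; suff Ex : x = refl j nu.
  by apply: (wge_antisym (orb_refl j onu)) => //; rewrite -Ex.
have ru := proj1 p; have [m Em] := cobeta_int u i (orb_P onu).
have [c [h [Q c0 [k ck]]]] := proot_coords p.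
have [m' Em'] := corr_int j (orb_P onu).
have ox : orb x by rewrite E; exact: orb_rbeta.
have [d [g [Qd d0 _]]] := wge_coords ox (wge_trans Ha Hx).
have m0 : 0 < m by rewrite -(ltr0z R) -Em.
have Q1 : Qv (nu - refl j nu) (fun k => m * c k + d k) (m * h + g).
  have := QvD (QvZ m Q) Qd; rewrite -Em; congr (Qv _ _ _).
  by rewrite E rbetaE // addrA [_ *: _ + _]addrC subrK.
have Q2 : Qv (nu - refl j nu) (fun k => m' * (j == k)%:R) m'.
  by rewrite /refl opprB addrC subrK Em'; exact: Qv_zalpha.
have [Ec _] := Qv_uniq Q1 Q2.
have c_j l : l != j -> c l = 0.
  move=> nl; have := Ec l; rewrite eq_sym (negbTE nl) mulr0 /=.
  by have := c0 l; have := d0 l; nia.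
case: (boolP (isr i)) => [ri|ii].
  by case: (eqVneq k j) => Ek; move: ck; rewrite ?(c_j _ Ek) // (root_real_im ru ri _ Q) // Ek.
have Ei : i = j.
  by apply/eqP/negPn/negP => /c_j; rewrite (root_im_coord ru ii Q) eqxx.
subst i; have Ea : act u (a_ j) = a_ j.
  apply/eqP; rewrite -subr_eq0; apply/eqP; apply: (Qv_eq0 (QvB Q (Qv_alpha j))) => l.
  case: (eqVneq j l) => [<-|nl]; last by rewrite c_j ?subr0 // eq_sym.
  by rewrite (root_im_coord ru ij Q) eqxx subrr.
case: (imroot_simple_or ru ij) => [[_ Ecob]|[z rz]].
  by rewrite E rbetaE // Ecob Ea.
rewrite Ea corr_alpha ltr0z => A0; have nzj : z != j by apply: contraNneq ij => <-.
by move: A0; rewrite ltNge bA_off.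
Qed.

(** [r_j] is not invertible. It can still be undone above [r_j eta] while [alpha_j^vee] keeps its
    value, since each step then commutes with it. *)
Lemma wge_im_inv j xi t : ~~ isr j -> wge xi t -> forall eta, orb eta -> t = refl j eta ->
 cv j xi = cv j t -> exists xi', [/\ wge xi' eta, xi = refl j xi' & cv j xi' = cv j eta].
Proof.
move=> ij; elim=> {t} [|x y u i Hx IH p E C] eta oeta Ey Exi.
  by exists eta; split=> //; exact: wge_refl.
have ru := proj1 p; have Ex : cv j x = cv j y.
  apply/eqP; rewrite eq_le -{1}Exi (wge_cv_im ij Hx) /= E.
  by apply: cv_root_im_le0 => //; exact: ltW.
have [c0 d0] := im_step_perp p ij C (etrans (congr1 (cv j) (esym E)) Ex).
have [E1 E2 E3] := perp_commute eta ru c0 d0.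
have [||xi' [H1' H2' H3']] := IH (rbeta u i eta) (orb_rbeta u i oeta).
- by rewrite E1 E Ey.
- by rewrite Exi Ex.
exists xi'; split=> //; last by rewrite H3'.
by apply: (wge_step H1' p erefl); rewrite -E2 -Ey.
Qed.

Lemma covers_im_refl j mu nu : orb nu -> ~~ isr j -> covers mu nu -> cv j mu = cv j nu ->
  covers (refl j mu) (refl j nu).
Proof.
move=> onu ij [Hge nH Hx] Ej.
have up xi : wge xi nu -> cv j xi = cv j nu -> wge (refl j xi) (refl j nu).
  have H := @tge_im _ _ lam 1 lam_dom 1.
  case: onu => y <- /wge_words [x -> Hxy] E; apply: (words_wge (x := j :: x) (y := j :: y)).
  by apply: H.
have inj xi : cv j xi = cv j nu -> refl j xi = xi - cv j nu *: a_ j by rewrite /refl => ->.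
split; first exact: up.
  by rewrite !inj // => /addIr.
move=> xi Ha Hb.
have Exi : cv j xi = cv j (refl j nu).
  apply/eqP; rewrite eq_le (wge_cv_im ij Hb) andbT.
  by apply: le_trans (wge_cv_im ij Ha) _; rewrite !cv_refl Ej.
have [xi' [H1' H2' H3']] := wge_im_inv ij Hb onu erefl Exi.
have Emu : cv j (refl j mu) = cv j xi by rewrite Exi !cv_refl Ej.
have [xi2 [H1 H2 H3]] := wge_im_inv ij Ha (orb_wge onu H1') H2' Emu.
have E2 : xi2 = mu.
  by move/(congr1 (fun t => t + cv j nu *: a_ j)): H2; rewrite /refl H3 H3' Ej !subrK.
rewrite E2 in H1; by case: (Hx _ H1 H1') => E; [left|right]; rewrite H2' E.
Qed.

Definition isint (r : R) : Prop := exists m : int, r = m%:~R.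
Lemma isint0 : isint 0. Proof. by exists 0. Qed.
Lemma isintD (r s : R) : isint r -> isint s -> isint (r + s).
Proof. by move=> [m ->] [m' ->]; exists (m + m'); rewrite rmorphD. Qed.
Lemma isintN (r : R) : isint r -> isint (- r).
Proof. by move=> [m ->]; exists (- m); rewrite rmorphN. Qed.
Lemma isintB (r s : R) : isint r -> isint s -> isint (r - s).
Proof. by move=> Hr /isintN; exact: isintD. Qed.
Lemma isintM (r s : R) : isint r -> isint s -> isint (r * s).
Proof. by move=> [m ->] [m' ->]; exists (m * m'); rewrite rmorphM. Qed.

End WeightOrder.

Section Chains.
Variables (R : realType) (D : BCdatum R).
Local Notation I := (bI D).
Local Notation V := (bV D).
Local Notation A := (@bA R D).
Local Notation a_ := (@alpha R D).
Local Notation cv := (@corr R D).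
Local Notation isr := (@isreal R D).
Local Notation dom := (@dominant R D).
Implicit Types (u w : seq I) (i j k z : I) (mu nu xi x y : V) (a : R).

(** The coefficient is real here: it will be a local time, and the cut points produced by root
    operators are only known as real numbers. The rational form is recovered for [a = 1]. *)
Definition rarrow a mu nu : Prop := exists u i, [/\ proot u i, mu = rbeta u i nu,
  0 < cobeta u i nu, covers mu nu &
  (if isr i then (exists m : int, (0 < m)%R /\ a * cobeta u i nu = m%:~R)
   else a * cobeta u i nu = 1)].

Inductive rchain a mu : V -> Prop :=
| rch_refl : rchain a mu mu
| rch_step x y : rchain a mu x -> rarrow a x y -> rchain a mu y.

Lemma achain_rchain (a : rat) mu nu : achain a mu nu -> rchain (ratr a) mu nu.
Proof. by elim=> [|x y _ IH H]; [exact: rch_refl|exact: rch_step IH H]. Qed.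

Lemma rchain_achain1 mu nu : rchain 1 mu nu -> achain 1 mu nu.
Proof.
elim=> [|x y _ IH H]; first exact: ach_refl.
by apply: ach_step IH _; rewrite /aarrow rmorph1.
Qed.

Lemma rchain_trans a mu nu xi : rchain a mu nu -> rchain a nu xi -> rchain a mu xi.
Proof. by move=> H; elim=> // x y _ IH H'; exact: rch_step IH H'. Qed.

Lemma rchain_one a mu nu : rarrow a mu nu -> rchain a mu nu.
Proof. exact: rch_step (rch_refl _ _). Qed.

Lemma rchain_head a mu nu : rchain a mu nu -> mu = nu \/ exists2 x, rarrow a mu x & rchain a x nu.
Proof.
elim=> [|x y _ IH H]; first by left.
right; case: IH => [->|[x' H1 H2]]; first by exists y => //; exact: rch_refl.
by exists x' => //; exact: rch_step H2 H.
Qed.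

Lemma rchain_wge a mu nu : rchain a mu nu -> wge mu nu.
Proof.
by elim=> [|x y _ IH [u [i [p E C _ _]]]]; [exact: wge_refl|exact: wge_step IH p E C].
Qed.

Lemma rarrow_step a mu nu : rarrow a mu nu -> exists u i, [/\ proot u i, mu = rbeta u i nu,
  0 < cobeta u i nu & exists2 m : int, 0 < m & a * cobeta u i nu = m%:~R].
Proof.
case=> u [i [p E C _]]; case: ifP => _ H; exists u, i; split=> //.
  by case: H => m [m0 H]; exists m.
by exists 1.
Qed.

Lemma rarrow_cv a mu nu k : rarrow a mu nu -> isint (a * cv k mu - a * cv k nu).
Proof.
move=> /rarrow_step [u [i [p E C [m _ Em]]]]; rewrite E rbetaE ?cvB; last by case: p.
have [f Ef] := corr_int k (P_act u (alphaP i)).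
rewrite (_ : _ - _ = - (a * cobeta u i nu * cv k (act u (a_ i)))); last by ring.
by apply/isintN/isintM; [exists m|exists f].
Qed.

Lemma rchain_cv a mu nu k : rchain a mu nu -> isint (a * cv k mu - a * cv k nu).
Proof.
elim=> [|x y _ IH H]; first by rewrite subrr; exact: isint0.
by have := isintD IH (rarrow_cv k H); rewrite addrA subrK.
Qed.

Lemma rchain_cv_int' a mu nu k : rchain a mu nu -> isint (a * cv k mu) -> isint (a * cv k nu).
Proof. by move=> /(rchain_cv k) H1 H2; have := isintB H2 H1; rewrite opprB addrC subrK. Qed.

Variable la : V.
Hypothesis la_dom : dom la.
Local Notation orb := (@inWorbit R D la).

Lemma orb_rarrow a x y : orb y -> rarrow a x y -> orb x.
Proof. by move=> oy [u [i [_ -> _ _ _]]]; exact: orb_rbeta. Qed.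

Lemma orb_rchain a x y : orb y -> rchain a x y -> orb x.
Proof. by move=> oy /rchain_wge; exact: orb_wge. Qed.

Lemma rarrow_cases a mu nu z : orb nu -> isr z -> rarrow a mu nu ->
  [/\ mu = refl z nu, 0 < cv z nu & isint (a * cv z nu)] \/
  [/\ ~ (cv z mu <= 0 /\ 0 < cv z nu), ~ (cv z mu < 0 /\ 0 <= cv z nu) &
     (0 < cv z mu /\ 0 < cv z nu) \/ (cv z mu < 0 /\ cv z nu < 0) ->
     rarrow a (refl z mu) (refl z nu)].
Proof.
move=> onu rz H; have [u [i [p E C cov Hint]]] := H.
case: (proot_cons p rz) => [[ri Ea]|p'].
  left; have Ecob : cobeta u i nu = cv z nu.
    by case: onu => w <-; exact: (cobeta_same_root (proj1 p) ri rz Ea).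
  rewrite -Ecob; split=> //; first by rewrite E rbetaE ?Ecob ?Ea //; case: p.
  by move: Hint; rewrite ri => -[m [_ ->]]; exists m.
right; have [S1 S2] := covers_sign la_dom onu rz p' E C cov; split=> // sgn.
exists (z :: u), i; split=> //; rewrite ?rbeta_cons ?cobeta_cons ?E //.
by rewrite -E; exact: (covers_refl la_dom onu rz p' E C cov).
Qed.

Lemma isint_opp (r : R) : isint (- r) -> isint r.
Proof. by move/isintN; rewrite opprK. Qed.

Lemma rarrow_up a z nu : orb nu -> isr z -> 0 < a -> 0 < cv z nu -> isint (a * cv z nu) ->
  rarrow a (refl z nu) nu.
Proof.
move=> onu rz a0 s [m Em]; exists [::], z; split; [exact: proot_nil|by []|exact: s|exact: (covers_up la_dom onu rz s)|].
by rewrite rz; exists m; split=> //; rewrite -(ltr0z R) -Em mulr_gt0.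
Qed.

Lemma rarrow_im_up a j nu : orb nu -> ~~ isr j -> 0 < cv j nu -> a * cv j nu = 1 ->
  rarrow a (refl j nu) nu.
Proof.
move=> onu ij s E; exists [::], j; split; [exact: proot_nil|by []|exact: s|exact: (covers_im_up la_dom onu ij s)|].
by rewrite (negbTE ij).
Qed.

(** An additional arrow is needed only when the value is positive at [mu] and not at [nu]. It is the
    simple reflection above [mu], for which [a] times the value at [mu] has to be integral. *)
Lemma rarrow_star a z mu nu : orb nu -> isr z -> 0 < a -> isint (a * cv z nu) \/ 0 <= cv z nu ->
  rarrow a mu nu -> rchain a (vstar z mu) (vstar z nu).
Proof.
move=> onu rz a0 cond H; have omu := orb_rarrow onu H.
have Emu := rarrow_cv z H; rewrite /vstar.
case: (rarrow_cases onu rz H) => [[E s _]|[S1 S2 Hr]].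
  rewrite E cv_refl_re // oppr_lt0 s (lt_gtF s); exact: rch_refl.
case: (ltrgtP 0 (cv z nu)) => sn; case: (ltrgtP 0 (cv z mu)) => sm.
- by apply/rchain_one/Hr; left.
- by case: S1; split=> //; exact: ltW.
- by case: S1; rewrite -sm.
- apply: (@rch_step _ _ mu); last exact: H.
  apply/rchain_one; apply: rarrow_up => //.
  case: cond => [i1|]; last by rewrite leNgt sn.
  by have := isintD Emu i1; rewrite subrK.
- exact: rchain_one.
- rewrite refl0 //; exact: rchain_one.
- rewrite (refl0 (esym sn)); apply: (@rch_step _ _ mu); last exact: H.
  apply/rchain_one; apply: rarrow_up => //.
  by move: Emu; rewrite -sn mulr0 subr0.
- by case: S2; rewrite -sn.
- by rewrite !refl0 //; exact: rchain_one.
Qed.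

Lemma rarrow_circ a z mu nu : orb nu -> isr z -> 0 < a -> isint (a * cv z mu) \/ cv z mu <= 0 ->
  rarrow a mu nu -> rchain a (vcirc z mu) (vcirc z nu).
Proof.
move=> onu rz a0 cond H; have omu := orb_rarrow onu H.
have Emu := rarrow_cv z H; rewrite /vcirc.
have down : cv z nu < 0 -> isint (a * cv z nu) -> rarrow a nu (refl z nu).
  move=> sn i1; rewrite -{1}[nu](reflK rz); apply: rarrow_up => //; first exact: orb_refl.
    by rewrite cv_refl_re // oppr_gt0.
  by rewrite cv_refl_re // mulrN; exact: isintN.
case: (rarrow_cases onu rz H) => [[E s _]|[S1 S2 Hr]].
  rewrite E cv_refl_re // oppr_gt0 s (lt_gtF s) reflK //; exact: rch_refl.
case: (ltrgtP 0 (cv z mu)) => sm; case: (ltrgtP 0 (cv z nu)) => sn.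
- exact: rchain_one.
- apply: (@rch_step _ _ nu); first exact: rchain_one.
  apply: down => //; case: cond => [i1|]; last by rewrite leNgt sm.
  by have := isintB i1 Emu; rewrite opprB addrC subrK.
- by rewrite refl0 //; exact: rchain_one.
- by case: S2; split=> //; exact: ltW.
- by apply/rchain_one/Hr; right.
- by case: S2; rewrite -sn.
- by case: S1; rewrite -sm.
- rewrite (refl0 (esym sm)); apply: (@rch_step _ _ nu); first exact: rchain_one.
  by apply: down => //; move: Emu; rewrite -sm mulr0 sub0r => /isint_opp.
- by rewrite !refl0 //; exact: rchain_one.
Qed.

Lemma rchain_star a z mu nu : orb nu -> isr z -> 0 < a -> isint (a * cv z nu) \/ 0 <= cv z nu ->
  rchain a mu nu -> rchain a (vstar z mu) (vstar z nu).
Proof.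
move=> + rz a0 + H; elim: H => {nu} [|x y Hx IH H] ony cond; first exact: rch_refl.
have onx := orb_rarrow ony H.
apply: rchain_trans (rarrow_star ony rz a0 cond H); apply: IH => //.
case: (pselect (isint (a * cv z y))) => [i1|ni].
  by left; have := isintD (rarrow_cv z H) i1; rewrite subrK.
right; case: cond => // y0; case: (rarrow_cases ony rz H) => [[_ _ //]|[S1 _ _]].
rewrite leNgt; apply/negP => sx; apply: S1; split; first exact: ltW.
rewrite lt_neqAle y0 andbT; apply/eqP => E0; apply: ni; rewrite -E0 mulr0; exact: isint0.
Qed.

(** Integrality of [a alpha_z^vee] is constant along a chain. If it fails, no arrow is the simple
    reflection in [z], and the other covers cannot pass from a negative to a nonnegative value. *)
Lemma rchain_neg a z mu nu : orb nu -> isr z -> ~ isint (a * cv z nu) -> rchain a mu nu ->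
  cv z mu <= 0 -> cv z nu < 0.
Proof.
move=> + rz + H; elim: H => {nu} [|x y Hx IH H] ony ni s.
  rewrite lt_neqAle s andbT; apply/eqP => E0; apply: ni; rewrite E0 mulr0; exact: isint0.
have onx := orb_rarrow ony H.
have nix : ~ isint (a * cv z x).
  by move=> i1; apply: ni; have := isintB i1 (rarrow_cv z H); rewrite opprB addrC subrK.
have sx := IH onx nix s; case: (rarrow_cases ony rz H) => [[_ _ //]|[_ S2 _]].
by rewrite ltNge; apply/negP => sy; apply: S2.
Qed.

Lemma rchain_circ a z mu nu : orb nu -> isr z -> 0 < a -> isint (a * cv z mu) \/ cv z mu <= 0 ->
  rchain a mu nu -> rchain a (vcirc z mu) (vcirc z nu).
Proof.
move=> + rz a0 cond H; elim: H => {nu} [|x y Hx IH H] ony; first exact: rch_refl.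
have onx := orb_rarrow ony H.
apply: rchain_trans (IH onx) _; apply: rarrow_circ => //.
case: (pselect (isint (a * cv z x))) => [i1|ni]; first by left.
right; case: cond => [i1|s]; first by case: ni; exact: rchain_cv_int' Hx i1.
exact: ltW (rchain_neg onx rz ni Hx s).
Qed.

(** Along a path this makes the height integral wherever its slope turns from negative to
    nonnegative, the source of integral local minima. *)
Lemma rchain_sign a z mu nu : orb nu -> isr z -> rchain a mu nu ->
  (cv z mu < 0 /\ 0 <= cv z nu) \/ (cv z mu <= 0 /\ 0 < cv z nu) -> isint (a * cv z nu).
Proof.
move=> onu rz H sgn; apply: contrapT => ni; have := rchain_neg onu rz ni H.
by case: sgn => -[s1 s2] /(_ (ltac:(first [exact: s1|exact: ltW s1])));
  rewrite ltNge ?s2 // ltW.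
Qed.

Lemma rchain_im a j mu nu : orb nu -> ~~ isr j -> rchain a mu nu -> cv j mu = cv j nu ->
  rchain a (refl j mu) (refl j nu).
Proof.
move=> + ij H; elim: H => {nu} [|x y Hx IH H] ony Ej; first exact: rch_refl.
have onx := orb_rarrow ony H; have [u [i [p E C cov Hint]]] := H.
have Exy : cv j x = cv j y.
  apply/eqP; rewrite eq_le -{1}Ej (wge_cv_im ij (rchain_wge Hx)) /= E.
  by apply: cv_root_im_le0 => //; exact: ltW.
apply: (rch_step (IH onx _)); first by rewrite Ej Exy.
have [c0 d0] := im_step_perp p ij C (etrans (congr1 (cv j) (esym E)) Exy).
have [E1 E2 E3] := perp_commute y (proj1 p) c0 d0.
exists u, i; rewrite E2; split=> //; first by rewrite E.
exact: (covers_im_refl la_dom ony ij cov Exy).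
Qed.

Lemma isint_ge1 (r : R) : isint r -> 0 < r -> 1 <= r.
Proof. by move=> [m ->]; rewrite ltr0z -[1]/(1%:~R) ler_int. Qed.

(* If the root were a non-simple imaginary one, it would pair positively with some real simple coroot [z], and
   reflecting in [z] would break the cover. *)
Lemma dominant_first_step a mu x : orb x -> dom mu -> rarrow a mu x ->
  exists k, [/\ ~~ isr k, mu = refl k x, 0 < cv k x & a * cv k x = 1].
Proof.
move=> ox dmu [u [i [p E C cov Hint]]]; have ru := proj1 p.
case: (boolP (isr i)) => [ri|ii].
  have := cobeta_dom_ge0 p dmu; rewrite E cobeta_rbeta // A_re // -[2%:~R]/(2%:R : R); nra.
rewrite (negbTE ii) in Hint.
case: (imroot_simple_or ru ii) => [[Ea Ecob]|[z rz H]].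
  by exists i; split=> //; rewrite -?Ecob // E rbetaE // Ea Ecob.
have p' : proot (z :: u) i by split; [rewrite /= rz|rewrite (negbTE ii)].
have [S1 _] := covers_sign la_dom ox rz p' E C cov.
(* Both mixed pairings of [beta] and [alpha z] are at least 1. Dominance of [mu] gives
   [alpha_z^vee(x) > 0]; nonnegativity of [beta^vee] on [r_z x] gives
   [beta^vee(x) >= alpha_z^vee(x)]. Hence [alpha_z^vee(mu) <= 0], the forbidden crossing. *)
have H1 := isint_ge1 (corr_int z (P_act u (alphaP i))) H.
have H2 := isint_ge1 (cobeta_int u i (alphaP z)) (cv_imroot_gt0 ru ii rz H).
have H3 : 0 <= cobeta u i x - cv z x * cobeta u i (a_ z).
  rewrite -cobetaB -/(refl z x); have [w <-] := orb_refl z ox; exact: cobeta_im_ge0.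
have H4 : 0 <= cv z mu by case: dmu.
have Emu : cv z mu = cv z x - cobeta u i x * cv z (act u (a_ i)) by rewrite E rbetaE // cvB.
have h1 : 0 <= cobeta u i x * (cv z (act u (a_ i)) - 1).
  by apply: mulr_ge0; [exact: ltW|rewrite subr_ge0].
have b0 : 0 < cv z x by move: H4 h1; rewrite Emu mulrBr mulr1; move: C; lra.
have h2 : 0 <= cv z x * (cobeta u i (a_ z) - 1).
  by apply: mulr_ge0; [exact: ltW|rewrite subr_ge0].
case: S1; split=> //; rewrite Emu; move: h1 h2 H3; rewrite !mulrBr !mulr1; lra.
Qed.

End Chains.

(** * Paths as lists of pieces *)

Section Pieces.
Variables (R : realType) (D : BCdatum R).
Local Notation I := (bI D).
Local Notation V := (bV D).
Local Notation dom := (@dominant R D).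
Implicit Types (s t e : R).

(* [gp s L] follows, from time [s] on, each direction [q.1] until time [q.2]. *)
Fixpoint gp s (L : seq (V * R)) t : V :=
  if L is q :: L' then Num.max 0 (Num.min t q.2 - s) *: q.1 + gp q.2 L' t else 0.
Fixpoint inc s (L : seq (V * R)) : Prop := if L is q :: L' then s <= q.2 /\ inc q.2 L' else True.

Lemma gp_le s L t : inc s L -> t <= s -> gp s L t = 0.
Proof.
elim: L s => //= q L IH s [sq iL] ts; rewrite IH ?addr0 //; last exact: le_trans ts sq.
by rewrite minEle (le_trans ts sq) max_l ?scale0r // subr_le0.
Qed.

Lemma gp_hd s q L t : inc s (q :: L) -> s <= t <= q.2 -> gp s (q :: L) t = (t - s) *: q.1.
Proof.
move=> [sq iL] /andP [st tq] /=; rewrite gp_le // addr0 minEle tq max_r //.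
by rewrite subr_ge0.
Qed.

Lemma gp_tl s q L t : inc s (q :: L) -> q.2 <= t ->
  gp s (q :: L) t = (q.2 - s) *: q.1 + gp q.2 L t.
Proof.
move=> [sq iL] qt /=; congr (_ *: _ + _).
by rewrite min_r // max_r // subr_ge0.
Qed.

Lemma gp_cat s L1 L2 t : gp s (L1 ++ L2) t = gp s L1 t + gp (last s (map snd L1)) L2 t.
Proof. by elim: L1 s => [|q L IH] s /=; rewrite ?add0r // IH addrA. Qed.

Lemma inc_le s L : inc s L -> s <= last s (map snd L).
Proof. by elim: L s => [|q L IH] s //= [sq /IH]; exact: le_trans. Qed.

Lemma gp_ge s L t : inc s L -> last s (map snd L) <= t -> gp s L t = gp s L (last s (map snd L)).
Proof.
elim: L s => //= q L IH s [sq iL] H; have qe := inc_le iL.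
by rewrite -IH // min_r ?(le_trans qe) // min_r.
Qed.

Variables (lam : nat -> V) (n : nat).
Hypothesis lam_dom : forall q, (1 <= q <= n)%N -> dom (lam q).

(* [(m, w, e)]: until time [e] the [m]-th tensor factor, which occupies the times [[m-1, m]], has direction
   [w lam_m]. *)
Notation piece := (nat * seq I * R)%type.
Implicit Types (p q : piece) (L : seq piece) (nx : nat * seq I).

Definition pm p := p.1.1.
Definition pw p := p.1.2.
Definition pe p := p.2.
Definition dir p := act (pw p) (lam (pm p)).
Definition dl L := [seq (dir p, pe p) | p <- L].
Definition gpp s L t := gp s (dl L) t.
Definition lend s L := last s (map pe L).
(* local start time of the [m]-th tensor factor *)
Definition base (m : nat) : R := m.-1%:R.

Definition pok s p : Prop := [/\ (1 <= pm p <= n)%N, base (pm p) <= s, s < pe p & pe p <= (pm p)%:R].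
(* [nx] holds the factor and word that follow; [seg s L nx] also constrains the junction with what follows [L],
   and a complete path ends at the sentinel [(n.+1, [::])]. *)
Definition link p nx : Prop :=
  [/\ rchain (pe p - base (pm p)) (dir p) (act nx.2 (lam (pm p))),
      tge lam (pm p) (pw p) nx.2 &
      nx.1 = pm p \/ [/\ nx.1 = (pm p).+1, pe p = (pm p)%:R &
                       inWreorbit (lam (pm p)) (act nx.2 (lam (pm p)))]].
Definition nextd nx L := if L is q :: _ then (pm q, pw q) else nx.
Fixpoint seg s L nx : Prop :=
  if L is p :: L' then [/\ pok s p, link p (nextd nx L') & seg (pe p) L' nx] else True.

(** With [f] the height of [lam m - w lam m], this becomes the total height used as termination
    measure. *)
Fixpoint wsum (f : nat * seq I -> R) s L : R :=
  if L is p :: L' then (pe p - s) * f p.1 + wsum f (pe p) L' else 0.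

Lemma nextd_cat nx L1 L2 : nextd nx (L1 ++ L2) = nextd (nextd nx L2) L1.
Proof. by case: L1. Qed.

Lemma seg_cat s L1 L2 nx :
  seg s (L1 ++ L2) nx <-> seg s L1 (nextd nx L2) /\ seg (lend s L1) L2 nx.
Proof.
elim: L1 s => [|p L IH] s /=; first by split=> [H|[]].
rewrite nextd_cat; split=> [[H1 H2 /IH [H3 H4]]|[[H1 H2 H3] H4]]; split=> //.
by apply/IH.
Qed.

Lemma lend_cat s L1 L2 : lend s (L1 ++ L2) = lend (lend s L1) L2.
Proof. by rewrite /lend map_cat last_cat. Qed.

Lemma wsum_cat f s L1 L2 : wsum f s (L1 ++ L2) = wsum f s L1 + wsum f (lend s L1) L2.
Proof. by elim: L1 s => [|p L IH] s /=; rewrite ?add0r // IH addrA. Qed.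

Lemma lend_dl s L : last s (map snd (dl L)) = lend s L.
Proof. by rewrite /lend /dl -map_comp. Qed.

Lemma seg_inc s L nx : seg s L nx -> inc s (dl L).
Proof.
elim: L s => //= p L IH s [[_ _ sp _] _ /IH H]; split=> //; exact: ltW.
Qed.

Lemma gpp_cat s L1 L2 t : gpp s (L1 ++ L2) t = gpp s L1 t + gpp (lend s L1) L2 t.
Proof. by rewrite /gpp /dl map_cat gp_cat -/(dl L1) lend_dl. Qed.

Lemma lend_ge s L nx : seg s L nx -> s <= lend s L.
Proof. by move/seg_inc/inc_le; rewrite lend_dl. Qed.

Lemma lend_gt s p L nx : seg s (p :: L) nx -> s < lend s (p :: L).
Proof. by move=> [[_ _ sp _] _ /lend_ge]; exact: lt_le_trans. Qed.

Lemma gpp_le s L nx t : seg s L nx -> t <= s -> gpp s L t = 0.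
Proof. by move/seg_inc; exact: gp_le. Qed.

Lemma gpp_ge s L nx t : seg s L nx -> lend s L <= t -> gpp s L t = gpp s L (lend s L).
Proof. by move/seg_inc => H; rewrite -lend_dl; exact: gp_ge. Qed.

Lemma gpp_hd s p L nx t : seg s (p :: L) nx -> s <= t <= pe p -> gpp s (p :: L) t = (t - s) *: dir p.
Proof. by move/seg_inc => H Ht; exact: (gp_hd (q := (dir p, pe p)) H Ht). Qed.

Lemma gpp_tl s p L nx t : seg s (p :: L) nx -> pe p <= t ->
  gpp s (p :: L) t = (pe p - s) *: dir p + gpp (pe p) L t.
Proof. by move/seg_inc => H Ht; exact: (gp_tl (q := (dir p, pe p)) H Ht). Qed.

Lemma pok_frac s p : pok s p -> 0 < pe p - base (pm p) <= 1.
Proof.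
case=> m1 bs sp pm1; rewrite subr_gt0 (le_lt_trans bs sp) lerBlDl /base.
by rewrite natr1 prednK //; case/andP: m1.
Qed.

(** Both halves of a cut piece carry the same word, joined by the empty chain. Recording [wsum]
    shows that cutting leaves the total height unchanged. *)
Lemma split_at s L nx T : seg s L nx -> s <= T <= lend s L -> exists L1 L2,
  [/\ seg s (L1 ++ L2) nx, lend s L1 = T, lend s (L1 ++ L2) = lend s L,
      nextd nx (L1 ++ L2) = nextd nx L &
      (forall t, gpp s (L1 ++ L2) t = gpp s L t) /\ (forall f, wsum f s (L1 ++ L2) = wsum f s L)].
Proof.
elim: L s => [|p L IH] s /=.
  by move=> _; rewrite /lend /= => Hs; exists [::], [::]; split=> //; apply/eqP; rewrite eq_le.
move=> [ok lk sg] /andP [sT Te].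
have [Ts|nTs] := eqVneq s T; first by exists [::], (p :: L); split.
have {nTs}sT : s < T by rewrite lt_neqAle nTs.
have [m1 bs sp pm1] := ok.
case: (ltP T (pe p)) => [Tp|pT].
  exists [:: (p.1, T)], (p :: L); split=> //.
  - split; first by split=> //; exact: le_trans (ltW Tp) pm1.
      split; [exact: rch_refl|exact: tge_id|by left].
    by split=> //; split=> //; exact: le_trans bs (ltW sT).
  split=> [t|f]; last by rewrite /= /pe /=; ring.
  rewrite /gpp /= addrA -/(dl L); congr (_ + _).
  rewrite -/(dir p) -[dir (p.1, T)]/(dir p) -scalerDl /pe /=; congr (_ *: _).
  rewrite -![p.2]/(pe p); set e := pe p in Tp sp *.
  case: (leP t T) => tT.
    rewrite (min_l (le_trans tT (ltW Tp))) [X in _ + X]max_l ?addr0 //.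
    by rewrite subr_le0.
  rewrite (max_r (x := 0) (y := T - s)) ?subr_ge0 ?(ltW sT) //.
  have Tm : T <= Num.min t e by rewrite le_min (ltW tT) (ltW Tp).
  by rewrite !max_r ?subr_ge0 ?(le_trans (ltW sT)) //; ring.
have [|L1 [L2 [H1 H2 H3 H4 [H5 H6]]]] := IH (pe p) sg; first by rewrite pT.
exists (p :: L1), L2; split=> //=; first by rewrite H4.
by split=> [t|f]; rewrite ?H6 //; rewrite /gpp /= -/(dl (L1 ++ L2)) -/(gpp _ _ _) H5.
Qed.

End Pieces.

(** * Height functions and reflection of links *)

Section Dynamics.
Variables (R : realType) (D : BCdatum R).
Local Notation I := (bI D).
Local Notation V := (bV D).
Local Notation cv := (@corr R D).
Local Notation isr := (@isreal R D).
Local Notation dom := (@dominant R D).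
Local Notation piece := (nat * seq I * R)%type.
Variables (lam : nat -> V) (n : nat).
Hypothesis lam_dom : forall q, (1 <= q <= n)%N -> dom (lam q).
Local Notation dir := (@dir R D lam).
Local Notation gpp := (@gpp R D lam).
Local Notation link := (@link R D lam).
Local Notation seg := (@seg R D lam n).
Local Notation pok := (@pok R D n).
Local Notation star := (@star R D lam n).
Local Notation circ := (@circ R D lam n).
Local Notation bs := (@base R).
Implicit Types (w : seq I) (z : I) (mu nu : V) (s t h : R).
Implicit Types (p q : piece) (L : seq piece) (nx : nat * seq I).

Definition mapw (f : seq I -> seq I) L := [seq (pm p, f (pw p), pe p) | p <- L].
(* slope of the height function [alpha_z^vee] on a piece, and its value at the end of [L] *)
Definition sl z p := cv z (dir p).
Fixpoint hend z s h L := if L is p :: L' then hend z (pe p) (h + (pe p - s) * sl z p) L' else h.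

Lemma lend_mapw f s L : lend s (mapw f L) = lend s L.
Proof. by rewrite /lend /mapw -map_comp. Qed.

Lemma hend_cat z s h L1 L2 : hend z s h (L1 ++ L2) = hend z (lend s L1) (hend z s h L1) L2.
Proof. by elim: L1 s h => //= p L IH s h; rewrite IH. Qed.

Lemma seg_tl s p L nx : seg s (p :: L) nx -> seg (pe p) L nx. Proof. by case. Qed.

Lemma hend_gpp z s h L nx : seg s L nx -> hend z s h L = h + cv z (gpp s L (lend s L)).
Proof.
elim: L s h => [|p L IH] s h sg; first by rewrite /gpp /= cv0 addr0.
have sg' := seg_tl sg; rewrite /= (IH _ _ sg').
rewrite [gpp s _ _](gpp_tl sg); last exact: (lend_ge sg').
by rewrite cvD cvZ addrA.
Qed.

(* [H] is, from time [s] on, the height function of a path that continues with [L] at height [h]. *)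
Definition hfun z s h L (H : R -> R) := forall t, s <= t -> H t = h + cv z (gpp s L t).

Lemma hfun_at z s h L nx H : seg s L nx -> hfun z s h L H -> H s = h.
Proof. by move=> sg HH; rewrite HH // (gpp_le sg) // cv0 addr0. Qed.

Lemma hfun_hd z s h p L nx H t : seg s (p :: L) nx -> hfun z s h (p :: L) H ->
  s <= t <= pe p -> H t = h + (t - s) * sl z p.
Proof.
move=> sg HH Ht; rewrite HH; last by case/andP: Ht.
by rewrite (gpp_hd sg Ht) cvZ.
Qed.

Lemma hfun_tl z s h p L nx H : seg s (p :: L) nx -> hfun z s h (p :: L) H ->
  hfun z (pe p) (h + (pe p - s) * sl z p) L H.
Proof.
move=> sg HH t Ht; have [[_ _ sp _] _ _] := sg.
by rewrite HH ?(le_trans (ltW sp)) // (gpp_tl sg Ht) cvD cvZ addrA.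
Qed.

Lemma hfun_cat z s h L1 L2 nx H : seg s (L1 ++ L2) nx -> hfun z s h (L1 ++ L2) H ->
  hfun z (lend s L1) (hend z s h L1) L2 H.
Proof.
elim: L1 s h => //= p L IH s h sg HH; apply: IH; first exact: seg_tl sg.
exact: hfun_tl sg HH.
Qed.

Lemma hfun_hend z s h L nx H : seg s L nx -> hfun z s h L H -> H (lend s L) = hend z s h L.
Proof. by move=> sg HH; rewrite (hend_gpp z h sg) HH //; exact: lend_ge sg. Qed.

(* Height minus (local time) * slope: integral at every breakpoint, by the chain condition. *)
Definition dint z s h nx : R := h - (s - bs nx.1) * cv z (act nx.2 (lam nx.1)).

Lemma frac_gt0 s p : pok s p -> 0 < pe p - bs (pm p).
Proof. by move/pok_frac/andP => []. Qed.

Lemma link_frac1 s p nx : pok s p -> link p nx -> nx.1 <> pm p ->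
  pe p - bs (pm p) = 1 /\ pe p = bs nx.1.
Proof.
case=> /andP [m1 _] _ _ _ [_ _ [//|[-> -> _]]] _; rewrite /base /=; split=> //.
by rewrite -natrB ?leq_pred // -{1}(prednK m1) subSnn.
Qed.

(** Inside a factor [dint] changes by an integer along the chain. At a junction the local time is 1
    and the new local time 0, and integrality of the weight itself takes over. *)
Lemma dint_step z s h p nx : pok s p -> link p nx -> isint (dint z s h (pm p, pw p)) ->
  let h' := h + (pe p - s) * sl z p in let a := pe p - bs (pm p) in
  [/\ h' - a * sl z p = dint z s h (pm p, pw p),
      isint (h' - a * cv z (act nx.2 (lam (pm p)))) &
      isint (dint z (pe p) h' nx)].
Proof.
move=> ok lk Hd h' a; have [m1 _ _ _] := ok.
have E1 : h' - a * sl z p = dint z s h (pm p, pw p).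
  by rewrite /h' /a /dint /sl /dir /=; ring.
have [rc _ nxm] := lk; have I2 : isint (h' - a * cv z (act nx.2 (lam (pm p)))).
  have I1 : isint (h' - a * sl z p) by rewrite E1.
  by have := isintD I1 (rchain_cv z rc); rewrite -/(sl z p) addrA subrK.
split=> //; case: (eqVneq nx.1 (pm p)) => [E|/eqP ne]; first by rewrite /dint E.
have [a1 eb] := link_frac1 ok lk ne; rewrite /dint eb subrr mul0r subr0.
rewrite -[h'](subrK (a * sl z p)) E1; apply: isintD => //.
rewrite /a a1 mul1r; apply: corr_int; apply: P_act.
by case: (lam_dom m1).
Qed.

Lemma dint_seg z s h L nx : seg s L nx -> isint (dint z s h (nextd nx L)) ->
  isint (dint z (lend s L) (hend z s h L) nx).
Proof.
elim: L s h => //= p L IH s h [ok lk sg] Hd.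
by apply: IH => //; have [_ _] := dint_step ok lk Hd.
Qed.

Lemma vstarE z mu : 0 <= cv z mu -> vstar z mu = refl z mu.
Proof. by rewrite /vstar leNgt => /negbTE ->. Qed.
Lemma vcircE z mu : cv z mu <= 0 -> vcirc z mu = refl z mu.
Proof. by rewrite /vcirc leNgt => /negbTE ->. Qed.

Lemma inWre_refl la z nu : isr z -> inWreorbit la nu -> inWreorbit la (refl z nu).
Proof. by move=> rz [w [rw <-]]; exists (z :: w); split=> //=; rewrite rz. Qed.
Lemma inWre_star la z nu : isr z -> inWreorbit la nu -> inWreorbit la (vstar z nu).
Proof. by move=> rz H; rewrite /vstar; case: ifP => // _; exact: inWre_refl. Qed.
Lemma inWre_circ la z nu : isr z -> inWreorbit la nu -> inWreorbit la (vcirc z nu).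
Proof. by move=> rz H; rewrite /vcirc; case: ifP => // _; exact: inWre_refl. Qed.

Lemma link_eqw p m w w' : (1 <= pm p <= n)%N -> (forall r, (1 <= r <= n)%N -> act w (lam r) = act w' (lam r)) ->
  link p (m, w) -> link p (m, w').
Proof.
move=> m1 E [rc tg H]; split=> /=; rewrite -?E //.
by apply: tge_eqr tg => q hq; apply: E; move: m1 hq; lia.
Qed.

Section RealStep.
Variable z : I.
Hypothesis rz : isr z.

Lemma link_star s h p nx : pok s p -> link p nx -> isint (dint z s h (pm p, pw p)) ->
  (nx.1 = pm p -> 0 <= cv z (act nx.2 (lam (pm p)))) ->
  link (pm p, star z (pw p), pe p) (nx.1, star z nx.2).
Proof.
move=> ok [rc tg H] Hd pos; have [m1 _ _ _] := ok; have lp := lam_dom m1.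
have mn : (pm p <= n)%N by case/andP: m1.
split=> /=.
- rewrite /dir /pm /pw /= -/(pm p) -/(pw p) !(act_star lam_dom) //.
  apply: (rchain_star lp) => //; [exact: orb_act|exact: frac_gt0 ok|].
  case: (eqVneq nx.1 (pm p)) => [/pos|/eqP ne]; first by right.
  left; have [-> _] := link_frac1 ok (And3 rc tg H) ne; rewrite mul1r.
  by apply: corr_int; apply: P_act; case: lp.
- exact: tge_star.
- case: H => [->|[-> e1 wr]]; [by left|right; split=> //].
  by rewrite (act_star lam_dom) //; exact: inWre_star.
Qed.

(** The right end of the reflected stretch. The old direction becomes an intermediate element of the
    chain, reached by a simple arrow that exists because the height there is integral. *)
Lemma link_star_end s h p nx : pok s p -> link p nx -> isint (dint z s h (pm p, pw p)) ->
  0 <= sl z p -> isint (h + (pe p - s) * sl z p) ->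
  link (pm p, star z (pw p), pe p) nx.
Proof.
move=> ok lk Hd pos Hh; have [m1 _ _ _] := ok; have lp := lam_dom m1.
have mn : (pm p <= n)%N by case/andP: m1.
have [E1 _ _] := dint_step ok lk Hd; have [rc tg H] := lk.
have Ha : isint ((pe p - bs (pm p)) * sl z p).
  by have := isintB Hh Hd; rewrite -E1 opprB addrC subrK.
split=> //=; last by apply: tge_trans tg; exact: tge_star_l.
apply: rchain_trans rc; rewrite {1}/dir /pm /pw /= -/(pm p) -/(pw p) (act_star lam_dom) //.
rewrite vstarE //; move: pos; rewrite le_eqVlt => /orP [/eqP E0|sp].
  by rewrite refl0 //; exact: rch_refl.
apply/rchain_one/(rarrow_up lp) => //; [exact: orb_act|exact: frac_gt0 ok].
Qed.

(** The left end of the reflected stretch. A word of negative slope is its own [star], so only the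
    lower end of the chain moves. *)
Lemma link_star_next s h p nx : pok s p -> link p nx -> isint (dint z s h (pm p, pw p)) ->
  sl z p < 0 -> isint (h + (pe p - s) * sl z p) -> link p (nx.1, star z nx.2).
Proof.
move=> ok lk Hd neg Hh; have [m1 _ _ _] := ok; have lp := lam_dom m1.
have mn : (pm p <= n)%N by case/andP: m1.
have [_ I2 _] := dint_step ok lk Hd; have [rc tg H] := lk.
have sw : star z (pw p) = pw p by apply: (star_self (n := n)); exists (pm p).
split=> /=.
- have Ed : vstar z (dir p) = dir p by rewrite /vstar neg.
  rewrite -Ed (act_star lam_dom) //; apply: (rchain_star lp) => //; [exact: orb_act|exact: frac_gt0 ok|].
  by left; have := isintB Hh I2; rewrite opprB addrC subrK.
- by rewrite -sw; exact: tge_star.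
- case: H => [->|[-> e1 wr]]; [by left|right; split=> //].
  by rewrite (act_star lam_dom) //; exact: inWre_star.
Qed.

Lemma link_circ p nx s : pok s p -> link p nx -> sl z p <= 0 ->
  link (pm p, circ z (pw p), pe p) (nx.1, circ z nx.2).
Proof.
move=> ok [rc tg H] neg; have [m1 _ _ _] := ok; have lp := lam_dom m1.
have mn : (pm p <= n)%N by case/andP: m1.
split=> /=.
- rewrite /dir /pm /pw /= -/(pm p) -/(pw p) !(act_circ lam_dom) //.
  by apply: (rchain_circ lp) => //; [exact: orb_act|exact: frac_gt0 ok|right].
- exact: tge_circ.
- case: H => [->|[-> e1 wr]]; [by left|right; split=> //].
  by rewrite (act_circ lam_dom) //; exact: inWre_circ.
Qed.

Lemma link_circ_next s h p nx : pok s p -> link p nx -> isint (dint z s h (pm p, pw p)) ->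
  isint (h + (pe p - s) * sl z p) -> link p (nx.1, circ z nx.2).
Proof.
move=> ok lk Hd Hh; have [m1 _ _ _] := ok; have lp := lam_dom m1.
have mn : (pm p <= n)%N by case/andP: m1.
have [_ I2 _] := dint_step ok lk Hd; have [rc tg H] := lk.
set nu := act nx.2 (lam (pm p)) in rc I2.
have onu : inWorbit (lam (pm p)) nu by exact: orb_act.
have Ha : isint ((pe p - bs (pm p)) * cv z nu).
  by have := isintB Hh I2; rewrite opprB addrC subrK.
split=> /=.
- rewrite (act_circ lam_dom) //; apply: rchain_trans rc _; rewrite -/nu.
  case: (leP (cv z nu) 0) => [|sp]; last by rewrite /vcirc sp; exact: rch_refl.
  move=> le; rewrite vcircE //; move: le; rewrite le_eqVlt => /orP [/eqP E0|sn].
    by rewrite refl0 //; exact: rch_refl.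
  rewrite -{1}[nu](reflK rz); apply/rchain_one/(rarrow_up lp) => //.
  + exact: orb_refl.
  + exact: frac_gt0 ok.
  + by rewrite cv_refl_re // oppr_gt0.
  + by rewrite cv_refl_re // mulrN; exact: isintN.
- by apply: tge_trans tg _; exact: tge_circ_r.
- case: H => [->|[-> e1 wr]]; [by left|right; split=> //].
  by rewrite (act_circ lam_dom) //; exact: inWre_circ.
Qed.

Lemma link_sign s h p nx : pok s p -> link p nx -> isint (dint z s h (pm p, pw p)) ->
  (nx.1 = pm p -> (sl z p < 0 /\ 0 <= cv z (act nx.2 (lam nx.1))) \/ (sl z p <= 0 /\ 0 < cv z (act nx.2 (lam nx.1)))) ->
  isint (h + (pe p - s) * sl z p).
Proof.
move=> ok lk Hd sgn; have [m1 _ _ _] := ok; have lp := lam_dom m1.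
have [E1 I2 I3] := dint_step ok lk Hd; have [rc tg H] := lk.
case: (eqVneq nx.1 (pm p)) => [E|/eqP ne].
  have := sgn E; rewrite E => sgn'.
  have Ha := rchain_sign lp (orb_act _ _) rz rc sgn'.
  by have := isintD I2 Ha; rewrite subrK.
by have [_ eb] := link_frac1 ok lk ne; move: I3; rewrite /dint eb subrr mul0r subr0.
Qed.

Lemma seg_star s h L nx : seg s L nx -> isint (dint z s h (nextd nx L)) ->
  all (fun p => 0 <= sl z p) L -> isint (hend z s h L) -> seg s (mapw (star z) L) nx.
Proof.
elim: L s h => //= p L IH s h [ok lk sg] Hd /andP [pos al] Hh.
have [_ _ Hd'] := dint_step ok lk Hd; split=> //; last exact: IH Hd' al Hh.
case: L {IH} lk sg al Hh Hd' => [|q L] lk sg al Hh Hd'; first exact: link_star_end ok lk Hd pos Hh.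
apply: (link_star ok lk Hd) => /= E.
by case/andP: al; rewrite /sl /dir E.
Qed.

Lemma seg_circ s L nx : seg s L nx -> all (fun p => sl z p <= 0) L ->
  seg s (mapw (circ z) L) (nx.1, circ z nx.2).
Proof.
elim: L s => //= p L IH s [ok lk sg] /andP [neg al]; split=> //; last exact: IH.
by have := link_circ ok lk neg; case: (L).
Qed.

End RealStep.
End Dynamics.

(** * Lowering by a real simple root *)

Section RisingRegion.
Variables (R : realType) (D : BCdatum R).
Local Notation I := (bI D).
Local Notation V := (bV D).
Local Notation A := (@bA R D).
Local Notation a_ := (@alpha R D).
Local Notation cv := (@corr R D).
Local Notation isr := (@isreal R D).
Local Notation dom := (@dominant R D).
Local Notation piece := (nat * seq I * R)%type.
Variables (lam : nat -> V) (n : nat).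
Hypothesis lam_dom : forall q, (1 <= q <= n)%N -> dom (lam q).
Local Notation dir := (@dir R D lam).
Local Notation gpp := (@gpp R D lam).
Local Notation link := (@link R D lam).
Local Notation seg := (@seg R D lam n).
Local Notation star := (@star R D lam n).
Local Notation circ := (@circ R D lam n).
Local Notation hend := (@hend R D lam).
Local Notation sl := (@sl R D lam).
Local Notation hfun := (@hfun R D lam).
Local Notation dint := (@dint R D lam).
Implicit Types (k z : I) (s t h : R).
Implicit Types (p q : piece) (L : seq piece) (nx : nat * seq I).

Lemma gpp_mapw_refl z f s L t : (forall p, p \in L -> dir (pm p, f (pw p), pe p) = refl z (dir p)) ->
  gpp s (mapw f L) t = gpp s L t - cv z (gpp s L t) *: a_ z.
Proof.
elim: L s => [|p L IH] s H; first by rewrite /gpp /= cv0 scale0r subr0.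
rewrite /gpp /= -!/(dl _ _) -!/(gpp _ _ _) IH; last by move=> q hq; apply: H; rewrite inE hq orbT.
rewrite H ?mem_head // cvD cvZ scalerDl /refl scalerBr scalerA.
by rewrite opprD addrACA.
Qed.

Lemma gpp_mapw_id f s L t : (forall p, p \in L -> dir (pm p, f (pw p), pe p) = dir p) ->
  gpp s (mapw f L) t = gpp s L t.
Proof.
elim: L s => [|p L IH] s H //.
rewrite /gpp /= -!/(dl _ _) -!/(gpp _ _ _) IH; last by move=> q hq; apply: H; rewrite inE hq orbT.
by rewrite H ?mem_head.
Qed.

Lemma seg_pm s L nx p : seg s L nx -> p \in L -> (1 <= pm p <= n)%N.
Proof.
elim: L s => //= q L IH s [[m1 _ _ _] _ sg]; rewrite inE => /orP [/eqP ->|] //.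
exact: IH sg.
Qed.

Section RealF.
Variable z : I.
Hypothesis rz : isr z.

Lemma dir_star_ge0 p : (1 <= pm p <= n)%N -> 0 <= sl z p ->
  dir (pm p, star z (pw p), pe p) = refl z (dir p).
Proof. by move=> hp s0; rewrite {1}/dir /= (act_star lam_dom) // vstarE. Qed.

Lemma dir_circ_le0 p : (1 <= pm p <= n)%N -> sl z p <= 0 ->
  dir (pm p, circ z (pw p), pe p) = refl z (dir p).
Proof. by move=> hp s0; rewrite {1}/dir /= (act_circ lam_dom) // vcircE. Qed.

(* The chain condition makes the height integral wherever the slope turns from negative to nonnegative. *)
Lemma integral_dip s h p L nx H : seg s (p :: L) nx -> isint (dint z s h (pm p, pw p)) ->
  hfun z s h (p :: L) H -> sl z p < 0 ->
  hend z s h (p :: L) < h \/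
  exists t, [/\ pe p <= t, t < lend s (p :: L), isint (H t) & H t < h].
Proof.
elim: L s h p => [|q L IH] s h p sg Hd HH neg.
  by left; have [[_ _ sp _] _ _] := sg; rewrite /= gtrDl pmulr_rlt0 // subr_gt0.
have [ok lk _] := sg; have sg' := seg_tl sg; have [_ _ Hd'] := dint_step lam_dom ok lk Hd.
have HH' := hfun_tl sg HH; have [_ _ sp _] := ok.
set h' := h + (pe p - s) * sl z p in Hd' HH'.
have lt' : h' < h by rewrite /h' gtrDl pmulr_rlt0 // subr_gt0.
have Eh := hfun_at sg' HH'.
case: (ltP (sl z q) 0) => [negq|pos].
  case: (IH _ _ _ sg' Hd' HH' negq) => [lt2|[t [t1 t2 t3 t4]]]; first by left; exact: lt_trans lt2 lt'.
  right; exists t; split=> //; last exact: lt_trans t4 lt'.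
  by apply: le_trans t1; have [[_ _ /ltW]] := sg'.
right; exists (pe p); split=> //; rewrite ?Eh //; first exact: lend_gt sg'.
by apply: (link_sign lam_dom rz ok lk Hd) => _; left.
Qed.

(** A negative slope would end below [m + 1] or produce an integral height at most [m] after [Fp].
    Both are excluded, and the level [m + 1] is not met before the end. *)
Lemma rising_slopes s h L nx H (m : int) Fp N : seg s L nx ->
  isint (dint z s h (nextd nx L)) -> hfun z s h L H -> Fp <= s -> lend s L <= N ->
  hend z s h L = (m + 1)%:~R -> (L <> [::] -> h < (m + 1)%:~R) ->
  (forall t, Fp < t <= N -> isint (H t) -> m%:~R < H t) ->
  (forall t, Fp <= t < lend s L -> H t <> (m + 1)%:~R) ->
  all (fun p => 0 <= sl z p) L.
Proof.
elim: L s h => //= p L IH s h sg Hd HH Fs eN Ee hlt Hmin Hne.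
have [ok lk _] := sg; have sg' := seg_tl sg; have [_ _ Hd'] := dint_step lam_dom ok lk Hd.
have [_ _ sp _] := ok; have {}hlt := hlt ltac:(by []).
case: (ltP (sl z p) 0) => [neg|pos] /=.
  case: (integral_dip sg Hd HH neg) => /= [|[t [t1 t2 [k Ek] t4]]].
    by rewrite /= Ee => /(lt_trans hlt); rewrite ltxx.
  have Ft : Fp < t by apply: le_lt_trans Fs _; exact: lt_le_trans sp t1.
  have := Hmin t; rewrite Ft (le_trans (ltW t2) eN) => /(_ isT (ex_intro _ k Ek)).
  have := lt_trans t4 hlt; rewrite Ek !ltr_int => k1 k2.
  by lia.
have HH' := hfun_tl sg HH; apply: (IH (pe p)) Ee _ Hmin _ => //.
- exact: le_trans Fs (ltW sp).
- move=> nL; rewrite ltNge; apply/negP => ge.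
  have sl0 : 0 < sl z p.
    rewrite lt_neqAle pos andbT eq_sym; apply/eqP => E0; move: ge; rewrite E0 mulr0 addr0 leNgt.
    by rewrite hlt.
  (* The time at which the affine height on this piece reaches [m + 1]. *)
  pose t := s + ((m + 1)%:~R - h) / sl z p.
  have t1 : s < t by rewrite ltrDl divr_gt0 // subr_gt0.
  have t2 : t <= pe p.
    by rewrite /t -lerBrDl ler_pdivrMr // lerBlDl.
  have peL : pe p < lend (pe p) L.
    by case: (L) nL sg' => [//|q L'] _; exact: lend_gt.
  apply: (Hne t); first by rewrite (le_trans Fs (ltW t1)) (le_lt_trans t2 peL).
  rewrite (hfun_hd sg HH) ?(ltW t1) // /t.
  rewrite [s + _]addrC addrK mulfVK; first by rewrite addrC subrK.
  by rewrite gt_eqF.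
Qed.

(** Flat pieces just before the reflected stretch keep their directions. Their words must be raised
    as well, to stay above the raised words that follow. *)
Fixpoint zero_suffix L := if L is p :: L' then
  if all (fun q => sl z q == 0) (p :: L') then mapw (star z) (p :: L') else p :: zero_suffix L'
  else [::].

Lemma zero_suffix_all L : all (fun q => sl z q == 0) L -> zero_suffix L = mapw (star z) L.
Proof. by case: L => //= p L ->. Qed.

Lemma zero_suffix_next nx L : ~~ all (fun q => sl z q == 0) L ->
  nextd nx (zero_suffix L) = nextd nx L.
Proof. by case: L => //= p L; case: ifP. Qed.

Lemma lend_zero_suffix s L : lend s (zero_suffix L) = lend s L.
Proof.
elim: L s => //= p L IH s; case: ifP => _; last exact: IH.
exact: (lend_mapw _ _ (p :: L)).
Qed.

Lemma gpp_zero_suffix s L t : (forall p, p \in L -> (1 <= pm p <= n)%N) ->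
  gpp s (zero_suffix L) t = gpp s L t.
Proof.
elim: L s => //= p L IH s hp; case: ifP => [al|_]; last first.
  rewrite /gpp /= -!/(dl _ _) -!/(gpp _ _ _) IH // => q hq; apply: hp.
  by rewrite inE hq orbT.
have := @gpp_mapw_id (star z) s (p :: L) t; apply => q hq; have /eqP s0 := allP (al : all (fun q => sl z q == 0) (p :: L)) q hq.
by rewrite dir_star_ge0 ?hp // ?s0 // refl0.
Qed.

(** The piece before the flat suffix must descend, so that [star] fixes its word. The last
    hypothesis ensures this: before a rising piece ending at height [m] there would be an integral
    height below [m]. *)
Lemma seg_zero_suffix s h L1 L2 nx H (m : int) : seg s (L1 ++ L2) nx -> L2 <> [::] ->
  isint (dint z s h (nextd nx (L1 ++ L2))) -> all (fun p => 0 <= sl z p) L2 ->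
  isint (hend z s h (L1 ++ L2)) -> hfun z s h (L1 ++ L2) H -> hend z s h L1 = m%:~R ->
  (forall t, 0 <= t <= lend s L1 -> isint (H t) -> m%:~R <= H t) -> 0 <= s ->
  (if L1 is p :: _ then sl z p < 0 \/ (exists t0, [/\ 0 <= t0, t0 <= s, isint (H t0) & H t0 <= h])
   else True) ->
  seg s (zero_suffix L1 ++ mapw (star z) L2) nx.
Proof.
move=> + nL2; elim: L1 s h => [|p L1 IH] s h.
  by move=> sg Hd al Hh _ _ _ _ _; exact: (seg_star lam_dom rz sg Hd al Hh).
move=> sg Hd al Hh HH Em Hmin s0 Inv.
have [ok lk _] := sg; have sg' := seg_tl sg; have [_ _ Hd'] := dint_step lam_dom ok lk Hd.
have [_ _ sp _] := ok; have HH' := hfun_tl sg HH.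
case: (boolP (all (fun q => sl z q == 0) (p :: L1))) => [al0|nal].
  rewrite zero_suffix_all // /mapw -map_cat; apply: (seg_star lam_dom rz sg Hd _ Hh).
  by rewrite all_cat al andbT; apply: sub_all al0 => q /eqP ->.
rewrite /zero_suffix (negbTE nal) -/zero_suffix; set h' := h + (pe p - s) * sl z p in Hd' HH'.
have sgL1 : seg (pe p) L1 (nextd nx L2) by have /seg_cat [] := sg'.
have leL1 : pe p <= lend (pe p) L1 := lend_ge sgL1.
split=> //; last first.
  apply: (IH _ h') => //; first exact: le_trans s0 (ltW sp).
  case: (L1) sg' lk Hd' HH' => [//|q L] sg' lk Hd' HH'.
  case: (ltP (sl z q) 0) => [nq|pq]; [by left|right].
  have Eh := hfun_at sg' HH'.
  case: (ltP (sl z p) 0) => [np|pp].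
    exists (pe p); split=> //; rewrite ?Eh //; first exact: le_trans s0 (ltW sp).
    by apply: (link_sign lam_dom rz ok lk Hd) => _; left.
  case: Inv => [|[t0 [t1 t2 t3 t4]]]; first by rewrite ltNge pp.
  exists t0; split=> //; first exact: le_trans t2 (ltW sp).
  by apply: le_trans t4 _; rewrite lerDl mulr_ge0 // subr_ge0 ltW.
case: (boolP (all (fun q => sl z q == 0) L1)) => [al0|nal1]; last first.
  rewrite nextd_cat zero_suffix_next // -?nextd_cat //.
  by case: (L1) nal1 lk.
have slp : sl z p != 0 by move: nal; rewrite /= al0 andbT.
have hflat (s' h2 : R) L : all (fun q => sl z q == 0) L -> hend z s' h2 L = h2.
  by elim: L s' h2 => //= q L IHL s' h2 /andP [/eqP -> /IHL ->]; rewrite mulr0 addr0.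
have Eh' : h' = m%:~R by rewrite -Em /= hflat.
have np : sl z p < 0.
  rewrite lt_neqAle slp leNgt; apply/negP => pp.
  case: Inv => [|[t0 [t1 t2 t3 t4]]]; first by rewrite ltNge (ltW pp).
  have := Hmin t0; rewrite t1 (le_trans t2) => [/(_ isT t3)|]; last first.
    by apply: le_trans (ltW sp) _.
  rewrite leNgt -Eh' => /negP; apply; apply: le_lt_trans t4 _.
  by rewrite /h' ltrDl mulr_gt0 // subr_gt0.
have Hi : isint h' by exists m.
have := link_star_next lam_dom rz ok (lk : link p (nextd nx (L1 ++ L2))) Hd np Hi.
rewrite zero_suffix_all // /mapw -map_cat.
have nL : L1 ++ L2 <> [::] by case: (L1) nL2.
by case: (L1 ++ L2) nL.
Qed.

End RealF.
End RisingRegion.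

(** * Lowering by an imaginary simple root *)

Section ImaginaryRegion.
Variables (R : realType) (D : BCdatum R).
Local Notation I := (bI D).
Local Notation V := (bV D).
Local Notation a_ := (@alpha R D).
Local Notation cv := (@corr R D).
Local Notation isr := (@isreal R D).
Local Notation dom := (@dominant R D).
Local Notation piece := (nat * seq I * R)%type.
Variables (lam : nat -> V) (n : nat).
Hypothesis lam_dom : forall q, (1 <= q <= n)%N -> dom (lam q).
Local Notation gpp := (@gpp R D lam).
Local Notation link := (@link R D lam).
Local Notation seg := (@seg R D lam n).
Local Notation bs := (@base R).
Local Notation hend := (@hend R D lam).
Local Notation sl := (@sl R D lam).
Local Notation hfun := (@hfun R D lam).
Local Notation dint := (@dint R D lam).
Local Notation mapw := (@mapw R D).
Implicit Types (j k z : I) (nu : V) (s t h : R).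
Implicit Types (p q : piece) (L : seq piece) (nx : nat * seq I).

Definition good L := seg 0 L (n.+1, [::]) /\ lend 0 L = n%:R.

(* [f_z] acts on the path [G], parametrised by [[0, N]], with minimum [m] and breakpoints [Fp], [Fm]. *)
Definition fi_on (N : R) z (G : R -> V) (m : int) (Fp Fm : R) : Prop :=
 [/\ forall t, 0 <= t <= N -> isint (cv z (G t)) -> m%:~R <= cv z (G t),
     [/\ 0 <= Fp, Fp < N, cv z (G Fp) = m%:~R & forall t, 0 <= t <= N -> cv z (G t) = m%:~R -> t <= Fp] &
     [/\ Fp <= Fm, Fm <= N, cv z (G Fm) = (m + 1)%:~R &
         forall t, Fp <= t <= N -> cv z (G t) = (m + 1)%:~R -> Fm <= t]].
Definition fshift z (G : R -> V) (m : int) (Fp Fm t : R) : V :=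
  if t <= Fp then G t else if t <= Fm then G t - (cv z (G t) - m%:~R) *: a_ z else G t - a_ z.

Lemma three_split L nx s a b : seg s L nx -> s <= a -> a <= b -> b <= lend s L ->
  exists L1 L2 L3, [/\ seg s (L1 ++ (L2 ++ L3)) nx, lend s L1 = a, lend a L2 = b,
    lend b L3 = lend s L & (forall t, gpp s (L1 ++ (L2 ++ L3)) t = gpp s L t) /\
    (forall f, wsum f s (L1 ++ (L2 ++ L3)) = wsum f s L)].
Proof.
move=> sg sa ab bL; have [|L1 [L23 [H1 H2 H3 H4 [H5 H6]]]] := split_at (T := a) sg.
  by rewrite sa (le_trans ab bL).
have /seg_cat [sg1 sg23] := H1; rewrite H2 in sg23.
have e23 : lend a L23 = lend s L by rewrite -H3 lend_cat H2.
have [|L2 [L3 [G1 G2 G3 G4 [G5 G6]]]] := split_at (T := b) sg23; first by rewrite ab e23.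
exists L1, L2, L3; split=> //.
- by apply/seg_cat; rewrite G4 H2.
- by rewrite -e23 -G3 lend_cat G2.
- split=> [t|f]; first by rewrite -H5 !gpp_cat H2 -G5 gpp_cat.
  by rewrite -H6 !wsum_cat H2 -G6 wsum_cat.
Qed.

(** The height rises by exactly 1 over the middle part. Reflecting it subtracts [H - m] times
    [alpha z] inside and one full [alpha z] afterwards. *)
Lemma shift_lists z L1 L2 L3 L1' L2' L3' nx (m : int) Fp Fm :
  seg 0 (L1 ++ (L2 ++ L3)) nx -> lend 0 L1 = Fp -> lend Fp L2 = Fm ->
  cv z (gpp 0 (L1 ++ (L2 ++ L3)) Fp) = m%:~R -> cv z (gpp 0 (L1 ++ (L2 ++ L3)) Fm) = (m + 1)%:~R ->
  (forall t, gpp 0 L1' t = gpp 0 L1 t) -> lend 0 L1' = Fp ->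
  (forall t, gpp Fp L2' t = gpp Fp L2 t - cv z (gpp Fp L2 t) *: a_ z) -> lend Fp L2' = Fm ->
  (forall t, gpp Fm L3' t = gpp Fm L3 t) ->
  forall t, gpp 0 (L1' ++ (L2' ++ L3')) t = fshift z (gpp 0 (L1 ++ (L2 ++ L3))) m Fp Fm t.
Proof.
move=> sg e1 e2 hFp hFm g1 e1' g2 e2' g3 t.
have /seg_cat [sg1 sg23] := sg; rewrite e1 in sg23; have /seg_cat [sg2 sg3] := sg23; rewrite e2 in sg3.
have le12 : Fp <= Fm by rewrite -e2; exact: lend_ge sg2.
have tot r : gpp 0 (L1 ++ (L2 ++ L3)) r = gpp 0 L1 r + gpp Fp L2 r + gpp Fm L3 r.
  by rewrite !gpp_cat e1 e2 addrA.
have Em : cv z (gpp 0 L1 Fp) = m%:~R.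
  by rewrite -hFp tot (gpp_le sg2) // (gpp_le sg3) // !addr0.
have E1 r : Fp <= r -> gpp 0 L1 r = gpp 0 L1 Fp by rewrite -e1; exact: gpp_ge sg1.
have Ec : cv z (gpp Fp L2 Fm) = 1.
  move: hFm; rewrite tot (E1 _ le12) (gpp_le sg3 (lexx _)) addr0 cvD Em rmorphD /=; lra.
rewrite !gpp_cat e1' e2' g1 g2 g3 -/(gpp 0 (L1 ++ (L2 ++ L3))).
have -> : gpp 0 L1 t + (gpp Fp L2 t - cv z (gpp Fp L2 t) *: a_ z + gpp Fm L3 t) =
   gpp 0 (L1 ++ (L2 ++ L3)) t - cv z (gpp Fp L2 t) *: a_ z.
  by rewrite tot -!addrA; do 2 congr (_ + _); exact: addrC.
rewrite /fshift; case: (leP t Fp) => [le|lt1]; first by rewrite (gpp_le sg2) // cv0 scale0r subr0.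
case: (leP t Fm) => [le|lt2]; last first.
  by rewrite (gpp_ge sg2) ?e2 ?(ltW lt2) // Ec scale1r.
congr (_ - _ *: _); rewrite tot (gpp_le sg3 le) addr0 cvD (E1 _ (ltW lt1)) Em; ring.
Qed.

Lemma seg_im j s h L nx H Fm : ~~ isr j -> seg s L nx -> L <> [::] ->
  isint (dint j s h (nextd nx L)) -> 0 <= dint j s h (nextd nx L) -> hfun j s h L H ->
  lend s L = Fm -> hend j s h L = 1 -> (forall t, s <= t < Fm -> H t < 1) ->
  (forall r, (1 <= r < (nextd nx L).1)%N -> cv j (act (nextd nx L).2 (lam r)) = 0) ->
  seg s (mapw (cons j) L) nx.
Proof.
move=> ij; elim: L s h => // p L IH s h sg _ Hd D0 HH eF Eh Hlt Z0.
have [ok lk0 _] := sg; have lk : link p (nextd nx L) := lk0; have sg' := seg_tl sg.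
have [m1 bsle sp pm1] := ok; have lp := lam_dom m1.
have mn : (pm p <= n)%N by case/andP: m1.
have a0 := frac_gt0 ok; set a := pe p - bs (pm p) in a0.
have [E1 I2 Hd'] := dint_step lam_dom ok lk Hd; set h' := h + (pe p - s) * sl j p in E1 I2 Hd' Eh.
have slp0 : 0 <= sl j p by exact: cv_im_ge0.
have h1 : h < 1.
  rewrite -(hfun_at sg HH); apply: Hlt; rewrite lexx -eF; exact: lend_gt sg.
have D00 : dint j s h (pm p, pw p) = 0.
  have Dh : dint j s h (pm p, pw p) <= h.
    by rewrite /dint gerBl mulr_ge0 // subr_ge0.
  move: Hd D0 (le_lt_trans Dh h1) => [k] /= ->.
  by rewrite ler0z -[1]/(1%:~R) ltr_int => k0 k1; have -> : k = 0 by clear -k0 k1; lia.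
have Eh' : h' = a * sl j p by move: E1; rewrite D00 => /eqP; rewrite subr_eq0 => /eqP.
have Ha1 : a <= 1 by case/andP: (pok_frac ok).
case: (L =P [::]) => [EL|nL].
  subst L; have Eh1 : h' = 1 := Eh; split=> //; split=> /=.
  - have [rc _ _] := lk; apply: rchain_trans rc; apply/rchain_one.
    apply: (rarrow_im_up lp) => //; [exact: orb_act| |by rewrite -/a -/(sl j p) -Eh'].
    by rewrite -/(sl j p) -(pmulr_rgt0 _ a0) -Eh' Eh1.
  - have [_ tg _] := lk; apply: tge_trans tg.
    change (tge lam (pm p) (j :: pw p) (pw p)); apply: (tge_cons_up mn) => r hr.
    by apply: cv_im_ge0 => //; apply: lam_dom; move: hr mn; clear; move=> *; lia.
  - by have [] := lk.
have eL : pe p < Fm.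
  by rewrite -eF; case: (L) nL sg' => // q L' _; exact: lend_gt.
have HH' := hfun_tl sg HH.
have h'1 : h' < 1.
  have Ehp : H (pe p) = h' := hfun_at sg' HH'.
  by rewrite -Ehp; apply: Hlt; rewrite (ltW sp) eL.
have [rc tg nxm] := lk; set nu := act (nextd nx L).2 (lam (pm p)) in rc I2.
have nu0 : 0 <= cv j nu by exact: cv_im_ge0.
have Enu : cv j nu = sl j p.
  have le : cv j nu <= sl j p := wge_cv_im ij (rchain_wge rc).
  have : isint (a * (sl j p - cv j nu)).
    by rewrite mulrBr -Eh'; exact: I2.
  have : 0 <= a * (sl j p - cv j nu).
    by apply: mulr_ge0; [exact: ltW|rewrite subr_ge0].
  have : a * (sl j p - cv j nu) < 1.
    by apply: le_lt_trans h'1; rewrite Eh' ler_pM2l // gerBl.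
  move=> k1 k0 [k Ek]; move: k1 k0; rewrite Ek ler0z -[1]/(1%:~R) ltr_int => k1 k0.
  have kz : k = 0 by clear -k0 k1; lia.
  by move/eqP: Ek; rewrite kz mulf_eq0 gt_eqF //= subr_eq0 => /eqP.
have Zr r : (1 <= r < pm p)%N -> cv j (act (nextd nx L).2 (lam r)) = 0.
  move=> hr; apply/eqP; rewrite eq_le; apply/andP; split; last first.
    by apply: cv_im_ge0 => //; apply: lam_dom; move: hr mn; clear; move=> *; lia.
  rewrite -(Z0 r hr); apply: (wge_cv_im ij); apply: (tge_wge lam_dom mn) => //.
  by move: hr; clear; move=> *; lia.
have same : (nextd nx L).1 <> pm p -> sl j p = 0.
  move=> ne; have [a1 _] := link_frac1 ok lk ne.
  have [k Ek] : isint (sl j p) by apply: corr_int; apply: P_act; case: lp.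
  move: h'1 slp0; rewrite Eh' /a a1 mul1r Ek ler0z -[1]/(1%:~R) ltr_int => k1 k0.
  by have -> : k = 0 by clear -k0 k1; lia.
split; first by [].
- have -> : nextd nx (mapw (cons j) L) = ((nextd nx L).1, j :: (nextd nx L).2).
    by case: (L) nL.
  split=> /=.
  + exact: (rchain_im lp (orb_act _ _) ij rc (esym Enu)).
  + apply: (tge_im lam_dom mn ij tg) => r hr.
    case: (eqVneq r (pm p)) => [->|ne]; first by rewrite -/nu Enu.
    have lr : (1 <= r < pm p)%N by move: hr ne; rewrite /=; clear; move=> *; lia.
    by rewrite Zr ?Z0.
  + case: nxm => [->|[Enx e1 wr]]; [by left|right; rewrite Enx; split=> //].
    by rewrite refl0 // -/nu Enu same // Enx => /eqP; rewrite eqn_leq ltnn.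
- apply: (IH _ h') => //; last first.
  + move=> r hr; case: (ltnP r (pm p)) => [lt|ge]; first by apply: Zr; rewrite lt andbT; case/andP: hr.
    have [Er ne] : r = pm p /\ (nextd nx L).1 <> pm p.
      by case: nxm hr => [->|[-> _ _]]; move: ge; clear; move=> *; lia.
    by rewrite Er -/nu Enu same.
  + by move=> t /andP [t1 t2]; apply: Hlt; rewrite (le_trans (ltW sp)).
  + case: (eqVneq (nextd nx L).1 (pm p)) => [E|/eqP ne].
      by rewrite /dint E -/nu Enu Eh' -/a subrr.
    have [a1 eb] := link_frac1 ok lk ne.
    by rewrite /dint eb subrr mul0r subr0 Eh' same // mulr0.
Qed.

Lemma cv_gpp_mono j s L t t' : ~~ isr j -> (forall p, p \in L -> (1 <= pm p <= n)%N) -> t <= t' ->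
  cv j (gpp s L t) <= cv j (gpp s L t').
Proof.
move=> ij + tt; elim: L s => [|p L IH] s hp; first by rewrite /gpp.
rewrite /gpp /= -!/(dl _ _) -!/(gpp _ _ _) !cvD !cvZ; apply: lerD; last first.
  by apply: IH => q hq; apply: hp; rewrite inE hq orbT.
apply: ler_wpM2r.
  by apply: cv_im_ge0 => //; apply/lam_dom/hp/mem_head.
rewrite /Num.max; case: ifP => c1; case: ifP => c2 //.
- apply: lerB => //; rewrite le_min; apply/andP; split; first by rewrite ge_min tt.
  by rewrite ge_min lexx orbT.
- move/negbT: c2; rewrite -leNgt; apply: le_trans; apply: lerB => //.
  rewrite le_min; apply/andP; split; first by rewrite ge_min tt.
  by rewrite ge_min lexx orbT.
- exact: ltW.
Qed.

Lemma hend_flat z s h L nx : seg s L nx -> all (fun p => 0 <= sl z p) L ->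
  h <= hend z s h L /\ (hend z s h L = h -> all (fun p => sl z p == 0) L).
Proof.
elim: L s h => //= p L IH s h sg /andP [pos al].
have sg' := seg_tl sg; have [[_ _ sp _] _ _] := sg.
have [le IH2] := IH _ (h + (pe p - s) * sl z p) sg' al.
have inc0 : 0 <= (pe p - s) * sl z p by apply: mulr_ge0 => //; rewrite subr_ge0 ltW.
split=> [|E]; first by apply: le_trans le; rewrite lerDl.
have E0 : (pe p - s) * sl z p = 0 by move: le; rewrite E; lra.
rewrite IH2 ?andbT; last by rewrite E E0 addr0.
by move/eqP: E0; rewrite mulf_eq0 subr_eq0 gt_eqF.
Qed.

Lemma good_start L : good L -> (0 < n)%N -> exists p L', [/\ L = p :: L', pm p = 1%N & bs (pm p) = 0].
Proof.
case=> + + n0; case: L => [|p L] sg; first by rewrite /lend /= => /eqP; rewrite eq_sym pnatr_eq0 => /eqP n00; rewrite n00 in n0.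
move=> _; exists p, L; have [[m1 b0 _ _] _ _] := sg.
move: b0; rewrite /base lern0 => /eqP b0; split=> //; last by rewrite b0.
by move: m1 b0; lia.
Qed.

Lemma hend_all0 z s h L : all (fun p => sl z p == 0) L -> hend z s h L = h.
Proof. by elim: L s h => //= q L IHL s h /andP [/eqP -> /IHL ->]; rewrite mulr0 addr0. Qed.

End ImaginaryRegion.

(** * Root operators *)

Section LoweringStep.
Variables (R : realType) (D : BCdatum R).
Local Notation I := (bI D).
Local Notation V := (bV D).
Local Notation a_ := (@alpha R D).
Local Notation cv := (@corr R D).
Local Notation isr := (@isreal R D).
Local Notation dom := (@dominant R D).
Local Notation piece := (nat * seq I * R)%type.
Variables (lam : nat -> V) (n : nat).
Hypothesis lam_dom : forall q, (1 <= q <= n)%N -> dom (lam q).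
Local Notation dir := (@dir R D lam).
Local Notation gpp := (@gpp R D lam).
Local Notation seg := (@seg R D lam n).
Local Notation star := (@star R D lam n).
Local Notation hend := (@hend R D lam).
Local Notation sl := (@sl R D lam).
Local Notation hfun := (@hfun R D lam).
Local Notation dint := (@dint R D lam).
Local Notation mapw := (@mapw R D).
Local Notation zero_suffix := (@zero_suffix R D lam n).
Implicit Types (z : I) (t h : R).
Implicit Types (p q : piece) (L : seq piece).

Local Notation good := (@good R D lam n).

Theorem fstep z L (m : int) Fp Fm : good L -> fi_on n%:R z (gpp 0 L) m Fp Fm ->
  exists L', good L' /\ forall t, gpp 0 L' t = fshift z (gpp 0 L) m Fp Fm t.
Proof.
move=> [sg0 eL0] [H1 [Fp0 FpN EFp Fpmax] [FpFm FmN EFm Fmmin]].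
have {}FpFm : Fp < Fm.
  rewrite lt_neqAle FpFm andbT; apply/eqP => E; move: EFm; rewrite -E EFp => /eqP.
  by rewrite eqr_int; lia.
have n0 : (0 < n)%N by rewrite -(ltr0n R); exact: le_lt_trans Fp0 FpN.
have [|L1 [L2 [L3 [sg e1 e2 e3 [gA _]]]]] := three_split sg0 Fp0 (ltW FpFm); first by rewrite eL0.
rewrite eL0 in e3.
suff [L1' [L2' [sg' e1' e2' g1 g2]]] : exists L1' L2', [/\ seg 0 (L1' ++ L2') (nextd (n.+1, [::]) L3),
   lend 0 L1' = Fp, lend Fp L2' = Fm, forall t, gpp 0 L1' t = gpp 0 L1 t &
   forall t, gpp Fp L2' t = gpp Fp L2 t - cv z (gpp Fp L2 t) *: a_ z].
  exists (L1' ++ (L2' ++ L3)); split.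
    split; last by rewrite !lend_cat e1' e2'.
    rewrite catA; apply/seg_cat; split=> //; rewrite lend_cat e1' e2'.
    by move: sg; rewrite catA => /seg_cat [_]; rewrite lend_cat e1 e2.
  move=> t; rewrite (shift_lists (m := m) sg e1 e2 _ _ g1 e1' g2 e2' (fun=> erefl)) ?gA //.
  by rewrite /fshift gA.
have gd : good (L1 ++ (L2 ++ L3)) by split=> //; rewrite !lend_cat e1 e2.
have [p [L' [EL pm1 b0]]] := good_start gd n0.
have sg12 : seg 0 (L1 ++ L2) (nextd (n.+1, [::]) L3).
  by move: sg; rewrite catA => /seg_cat [].
have sg3 : seg Fm L3 (n.+1, [::]).
  by move: sg; rewrite catA => /seg_cat [_]; rewrite lend_cat e1 e2.
have /seg_cat [sg1 sg2] := sg12; rewrite e1 in sg2.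
pose H0 t := cv z (gpp 0 (L1 ++ L2) t).
have EH0 t : t <= Fm -> H0 t = cv z (gpp 0 L t).
  by move=> tF; rewrite -gA /H0 catA (gpp_cat _ 0 (L1 ++ L2)) lend_cat e1 e2 (gpp_le sg3 tF) addr0.
have HH0 : hfun z 0 0 (L1 ++ L2) H0 by move=> t _; rewrite add0r.
have H02 : hfun z Fp (hend z 0 0 L1) L2 H0 by rewrite -e1; exact: hfun_cat sg12 HH0.
have h1 : hend z 0 0 L1 = m%:~R by rewrite -(hfun_at sg2 H02) EH0 // ltW.
rewrite h1 in H02.
have h2 : hend z Fp m%:~R L2 = (m + 1)%:~R by rewrite -(hfun_hend sg2 H02) e2 EH0.
have h12 : hend z 0 0 (L1 ++ L2) = (m + 1)%:~R by rewrite hend_cat e1 h1.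
have nL2 : L2 <> [::] by move=> E; move: e2; rewrite E /lend /= => E'; rewrite E' ltxx in FpFm.
have Ed12 : dint z 0 0 (nextd (nextd (n.+1, [::]) L3) (L1 ++ L2)) = 0.
  by rewrite -nextd_cat -catA EL /dint /= b0 !subrr mul0r subrr.
have Hd2 : isint (dint z Fp m%:~R (nextd (nextd (n.+1, [::]) L3) L2)).
  have := dint_seg lam_dom (z := z) (h := 0) sg1; rewrite e1 h1; apply.
  by rewrite -nextd_cat Ed12; exact: isint0.
have Hneq t : Fp <= t < Fm -> H0 t <> (m + 1)%:~R.
  move=> /andP [t1 t2]; rewrite EH0 ?(ltW t2) // => E.
  have /Fmmin /(_ E) : Fp <= t <= n%:R by rewrite t1 (le_trans (ltW t2)).
  by rewrite leNgt t2.
have pmL p0 : p0 \in L1 ++ L2 -> (1 <= pm p0 <= n)%N := seg_pm sg12.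
have pmL1 p0 : p0 \in L1 -> (1 <= pm p0 <= n)%N by move=> h0; apply: pmL; rewrite mem_cat h0.
have pmL2 p0 : p0 \in L2 -> (1 <= pm p0 <= n)%N by move=> h0; apply: pmL; rewrite mem_cat h0 orbT.
case: (boolP (isr z)) => [rz|iz].
  have al : all (fun p => 0 <= sl z p) L2.
    apply: (rising_slopes lam_dom rz (H := H0) (m := m) (Fp := Fp) (N := Fm) sg2 Hd2 H02) => //.
    - by rewrite e2.
    - by move=> _; rewrite ltr_int; lia.
    - move=> t /andP [t1 t2]; rewrite EH0 // => Hi.
      have t0 : 0 <= t <= n%:R by rewrite (le_trans t2 FmN) (le_trans Fp0 (ltW t1)).
      rewrite lt_neqAle H1 // andbT; apply/eqP => E.
      by have := Fpmax t t0 (esym E); rewrite leNgt t1.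
    - by move=> t; rewrite e2; exact: Hneq.
  exists (zero_suffix z L1), (mapw (star z) L2); split.
  - apply: (seg_zero_suffix lam_dom rz (h := 0) (H := H0) (m := m) sg12) => //.
    + by rewrite Ed12; exact: isint0.
    + by rewrite h12; exists (m + 1).
    + rewrite e1 => t /andP [t0 t1]; rewrite EH0; last exact: le_trans t1 (ltW FpFm).
      by apply: H1; rewrite t0 (le_trans t1 (ltW FpN)).
    + case: (L1) => // p1 L0; right; exists 0; rewrite lexx; split=> //.
        by rewrite (hfun_at sg12 HH0); exact: isint0.
      by rewrite (hfun_at sg12 HH0).
  - by rewrite lend_zero_suffix.
  - by rewrite lend_mapw.
  - by move=> t; rewrite (gpp_zero_suffix lam_dom).
  - move=> t; apply: gpp_mapw_refl => p0 hp0.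
    by rewrite (dir_star_ge0 lam_dom) ?pmL2 //; exact: (allP al).
have mono t t' : t <= t' -> H0 t <= H0 t'.
  by move=> tt; rewrite /H0; exact: (cv_gpp_mono lam_dom 0 iz pmL tt).
have sl0 p0 : p0 \in L1 -> 0 <= sl z p0.
  by move=> hp; apply: (cv_im_ge0 (la := lam (pm p0))) => //; exact/lam_dom/pmL1.
have [hm0 hmf] : 0 <= hend z 0 0 L1 /\ (hend z 0 0 L1 = 0 -> all (fun p => sl z p == 0) L1).
  by apply: hend_flat sg1 _; apply/allP.
have m0 : m = 0.
  have /H1 : 0 <= (0:R) <= n%:R by rewrite lexx ler0n.
  rewrite -EH0; last exact: le_trans Fp0 (ltW FpFm).
  rewrite (hfun_at sg12 HH0) => /(_ (isint0 _)); rewrite lerz0.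
  by move: hm0; rewrite h1 ler0z; lia.
have al0 : all (fun p => sl z p == 0) L1 by apply: hmf; rewrite h1 m0.
(* Before [Fp] all slopes are zero, so prefixing [z] leaves the path alone while keeping the words
   in order with those of the stretch. *)
exists (mapw (cons z) L1), (mapw (cons z) L2); split.
- rewrite /mapw -map_cat -/(mapw _ (L1 ++ L2)).
  apply: (seg_im lam_dom iz (h := 0) (H := H0) (Fm := Fm) sg12) => //.
  + by case: (L1) nL2.
  + by rewrite Ed12; exact: isint0.
  + by rewrite Ed12.
  + by rewrite lend_cat e1.
  + by rewrite h12 m0.
  + move=> t /andP [t0 tF]; case: (ltP t Fp) => tp.
      apply: (le_lt_trans (mono _ _ (ltW tp))).
      by rewrite EH0 ?(ltW FpFm) // EFp m0 ltr01.
    rewrite lt_neqAle; apply/andP; split; last first.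
      by apply: (le_trans (mono _ _ (ltW tF))); rewrite EH0 // EFm m0.
    by apply/eqP => E; apply: (Hneq t); rewrite ?tp // E m0.
  + rewrite -nextd_cat -catA EL /= pm1 => r; lia.
- by rewrite lend_mapw.
- by rewrite lend_mapw.
- by move=> t; apply: gpp_mapw_id => p0 /(allP al0) /eqP E; rewrite {1}/dir /= refl0.
- by move=> t; apply: gpp_mapw_refl.
Qed.

End LoweringStep.

(** * Raising a non-straight path *)

Section IntegralMinima.
Variables (R : realType) (D : BCdatum R).
Local Notation I := (bI D).
Local Notation V := (bV D).
Local Notation cv := (@corr R D).
Local Notation isr := (@isreal R D).
Local Notation dom := (@dominant R D).
Local Notation piece := (nat * seq I * R)%type.
Variables (lam : nat -> V) (n : nat).
Hypothesis lam_dom : forall q, (1 <= q <= n)%N -> dom (lam q).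
Local Notation gpp := (@gpp R D lam).
Local Notation link := (@link R D lam).
Local Notation seg := (@seg R D lam n).
Local Notation circ := (@circ R D lam n).
Local Notation hend := (@hend R D lam).
Local Notation sl := (@sl R D lam).
Local Notation hfun := (@hfun R D lam).
Local Notation dint := (@dint R D lam).
Implicit Types (w : seq I) (z : I) (mu : V) (s t h e : R).
Implicit Types (p q : piece) (L : seq piece) (nx : nat * seq I).

Lemma lin_ge (c h x s t e : R) : s <= t <= e -> c <= h -> c <= h + (e - s) * x -> c <= h + (t - s) * x.
Proof.
move=> /andP [st te] H1 H2; case: (leP 0 x) => x0.
  have : 0 <= (t - s) * x by rewrite mulr_ge0 // subr_ge0.
  lra.
have : 0 <= (e - t) * - x by apply: mulr_ge0; rewrite ?subr_ge0 // oppr_ge0 ltW.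
lra.
Qed.

Lemma lin_gt (c h x s t e : R) : s <= t < e -> c < h -> c <= h + (e - s) * x -> c < h + (t - s) * x.
Proof.
move=> /andP [st te] H1 H2; case: (leP 0 x) => x0.
  have : 0 <= (t - s) * x by rewrite mulr_ge0 // subr_ge0.
  lra.
have : 0 < (e - t) * - x by apply: mulr_gt0; rewrite ?subr_gt0 // oppr_gt0.
lra.
Qed.

Lemma lin_lt (c h x s t e : R) : s <= t <= e -> h < c -> h + (e - s) * x < c -> h + (t - s) * x < c.
Proof.
move=> /andP [st te] H1 H2; case: (leP 0 x) => x0.
  have : 0 <= (e - t) * x by rewrite mulr_ge0 // subr_ge0.
  lra.
have : 0 <= (t - s) * - x by apply: mulr_ge0; rewrite ?subr_ge0 // oppr_ge0 ltW.
lra.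
Qed.

Section RealDip.
Variable z : I.
Hypothesis rz : isr z.

(** A minimum after the start sits where a negative slope ends. The sentinel [n.+1] turns the end of
    the list into a junction, so a minimum there is integral too. *)
Lemma first_min s h L nx H : seg s L nx -> nx.1 = n.+1 -> isint (dint z s h (nextd nx L)) ->
  hfun z s h L H -> exists T, [/\ s <= T <= lend s L, forall t, s <= t <= lend s L -> H T <= H t,
    forall t, s <= t < T -> H T < H t & T = s \/ isint (H T)].
Proof.
elim: L s h => [|p L IH] s h sg En Hd HH.
  exists s; rewrite /lend /= lexx; split=> //; last by left.
    by move=> t st; have -> : t = s by apply/eqP; rewrite eq_le andbC.
  by move=> t /andP [t1 t2]; move: (le_lt_trans t1 t2); rewrite ltxx.
have [ok lk _] := sg; have sg' := seg_tl sg; have [_ _ Hd'] := dint_step lam_dom ok lk Hd.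
have HH' := hfun_tl sg HH; have [m1 _ sp _] := ok.
have Es := hfun_at sg HH; have Ep := hfun_at sg' HH'.
have Et t : s <= t <= pe p -> H t = h + (t - s) * sl z p := hfun_hd sg HH.
have [T [/andP [T1 T2] Tmin Tlt Ti]] := IH _ _ sg' En Hd' HH'.
have pl := lend_ge sg'; rewrite /= -/(lend _ _).
have Tp : H T <= h + (pe p - s) * sl z p by rewrite -Ep; apply: Tmin; rewrite lexx pl.
case: (leP h (H T)) => hT.
  exists s; rewrite Es lexx (le_trans (ltW sp) pl); split=> //; last by left.
    move=> t /andP [t1 t2]; case: (leP t (pe p)) => tp.
      rewrite (Et t) ?t1 //; apply: (@lin_ge _ _ _ _ _ (pe p)) => //; first by rewrite t1.
      exact: le_trans hT Tp.
    by apply: le_trans hT (Tmin _ _); rewrite (ltW tp).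
  by move=> t /andP [t1 t2]; move: (le_lt_trans t1 t2); rewrite ltxx.
exists T; rewrite (le_trans (ltW sp) T1) T2; split=> //.
- move=> t /andP [t1 t2]; case: (leP t (pe p)) => tp; last by apply: Tmin; rewrite (ltW tp).
  by rewrite (Et t) ?t1 //; apply: (@lin_ge _ _ _ _ _ (pe p)); rewrite ?t1 // ltW.
- move=> t /andP [t1 t2]; case: (ltP t (pe p)) => tp; last by apply: Tlt; rewrite tp.
  rewrite (Et t) ?t1 ?(ltW tp) //; apply: (@lin_gt _ _ _ _ _ (pe p)) => //.
  by rewrite t1.
right; case: Ti => // ET; rewrite ET Ep.
have neg : sl z p < 0.
  rewrite ltNge; apply/negP => ge; move: hT; rewrite ET Ep ltNge => /negP; apply.
  by rewrite lerDl mulr_ge0 // subr_ge0 ltW.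
apply: (link_sign lam_dom rz ok lk Hd); case: (L) sg' HH' Tmin => [|q L'] sg' HH' Tmin /= E.
  by move: m1; rewrite -E En ltnn andbF.
left; split=> //; have [[_ _ sq _] _ _] := sg'.
have : H (pe p) <= H (pe q).
  rewrite -{1}ET; apply: Tmin; rewrite (ltW sq); exact: lend_ge (seg_tl sg').
rewrite Ep (hfun_hd sg' HH') ?lexx ?(ltW sq) // lerDl pmulr_rge0 // subr_gt0 //.
Qed.

Lemma last_cross s h L nx (H : R -> R) c : seg s L nx ->
  (forall t, s <= t <= lend s L -> H t = h + cv z (gpp s L t)) -> c <= h -> H (lend s L) < c ->
  exists T, [/\ s <= T, T < lend s L, H T = c & forall t, T < t <= lend s L -> H t < c].
Proof.
elim/last_ind: L nx => [|L p IH] nx.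
  move=> _ HH ch; rewrite HH /lend /= ?lexx // /gpp /= cv0 addr0.
  by move=> /(le_lt_trans ch); rewrite ltxx.
rewrite -cats1 => /seg_cat [sgL sgp]; rewrite lend_cat; set e := lend s L in sgp *.
rewrite /= -/(lend _ _) => HH ch.
have [[_ _ ep _] _ _] := sgp; have se : s <= e := lend_ge sgL.
have -> : lend e [:: p] = pe p by [].
have HL t : s <= t <= e -> H t = h + cv z (gpp s L t).
  move=> /andP [t1 t2]; rewrite HH ?gpp_cat ?(gpp_le sgp t2) ?addr0 //.
  by rewrite t1 (le_trans t2 (ltW ep)).
have Hp t : e <= t <= pe p -> H t = H e + (t - e) * sl z p.
  move=> /andP [t1 t2]; rewrite HH; last by rewrite (le_trans se t1).
  rewrite gpp_cat -/e (gpp_ge sgL t1) (gpp_hd sgp) ?t1 // cvD cvZ addrA HL //.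
  by rewrite se lexx.
rewrite Hp; last by rewrite lexx ltW.
move=> Hc; case: (ltP (H e) c) => He.
  have [T [T1 T2 T3 T4]] := IH _ sgL HL ch He.
  exists T; split=> //; first exact: lt_trans T2 ep.
  move=> t /andP [t1 t2]; case: (leP t e) => te; first by apply: T4; rewrite t1.
  by rewrite Hp ?(ltW te) //; apply: (@lin_lt _ _ _ _ _ (pe p)) => //; rewrite (ltW te).
have neg : sl z p < 0.
  rewrite ltNge; apply/negP => ge; have := le_lt_trans (lexx _) Hc.
  have : 0 <= (pe p - e) * sl z p by rewrite mulr_ge0 // subr_ge0 ltW.
  lra.
(* The last piece descends through the level [c]; this is the crossing time. *)
pose T := e + (c - H e) / sl z p.
have eT : e <= T by rewrite lerDl mulr_le0 // ?subr_le0 // invr_le0 ltW.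
have Tp : T < pe p by rewrite /T -ltrBrDl ltr_ndivrMr // ltrBrDl.
have HT : H T = c.
  rewrite Hp; last by rewrite eT ltW.
  rewrite /T [e + _]addrC addrK mulfVK ?lt_eqF //; lra.
exists T; split=> //; first exact: le_trans se eT.
move=> t /andP [t1 t2]; rewrite -HT (Hp t) ?(le_trans eT (ltW t1)) // (Hp T) ?eT ?(ltW Tp) //.
by rewrite ltrD2l ltr_nM2r // ltrD2r.
Qed.

(** A turn to nonnegative slope would occur at an integral height, and none lies strictly inside the
    stretch. *)
Lemma falling_slopes s h p L nx H : seg s (p :: L) nx -> isint (dint z s h (pm p, pw p)) ->
  hfun z s h (p :: L) H -> sl z p < 0 ->
  (forall t, s < t < lend s (p :: L) -> ~ isint (H t)) -> all (fun q => sl z q < 0) (p :: L).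
Proof.
elim: L s h p => [|q L IH] s h p sg Hd HH neg Hne; first by rewrite /= neg.
have [ok lk _] := sg; have sg' := seg_tl sg; have [_ _ Hd'] := dint_step lam_dom ok lk Hd.
have HH' := hfun_tl sg HH; have [_ _ sp _] := ok.
rewrite [all _ _]/= neg; apply: (IH _ _ _ sg' Hd' HH'); last first.
  by move=> t /andP [t1 t2]; apply: Hne; rewrite (lt_trans sp t1).
rewrite ltNge; apply/negP => ge; apply: (Hne (pe p)).
  by rewrite sp; exact: lend_gt sg'.
rewrite (hfun_at sg' HH'); apply: (link_sign lam_dom rz ok lk Hd) => _; by left.
Qed.

Lemma seg_circ_next s h L nx : seg s L nx -> isint (dint z s h (nextd nx L)) ->
  isint (hend z s h L) -> seg s L (nx.1, circ z nx.2).
Proof.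
elim: L s h => //= p L IH s h sg Hd Hh; have [ok lk0 _] := sg.
have lk : link p (nextd nx L) := lk0; have sg' := seg_tl sg.
have [_ _ Hd'] := dint_step lam_dom ok lk Hd; split=> //; last exact: IH Hd' Hh.
by case: (L) lk Hh => // {}lk Hh; exact: (link_circ_next lam_dom rz ok lk Hd Hh).
Qed.

Lemma seg_eqw s L m w w' : seg s L (m, w) -> (forall r, (1 <= r <= n)%N -> act w (lam r) = act w' (lam r)) ->
  seg s L (m, w').
Proof.
move=> + E; elim: L s => //= p L IH s [ok lk sg]; split=> //; last exact: IH.
case: (L) lk => //= lk; have [m1 _ _ _] := ok; exact: (link_eqw m1 E lk).
Qed.

Lemma vcirc_dom mu : dom mu -> vcirc z mu = mu.
Proof.
case=> _ /(_ z); rewrite /vcirc le_eqVlt => /orP [/eqP E|->] //.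
by rewrite -E ltxx refl0.
Qed.

End RealDip.
End IntegralMinima.

(** * Total height and inversion of lowering operators *)

Section Height.
Variables (R : realType) (D : BCdatum R).
Local Notation I := (bI D).
Local Notation V := (bV D).
Local Notation a_ := (@alpha R D).
Local Notation cv := (@corr R D).
Local Notation isr := (@isreal R D).
Local Notation dom := (@dominant R D).
Local Notation piece := (nat * seq I * R)%type.
Variables (lam : nat -> V) (n : nat).
Hypothesis lam_dom : forall q, (1 <= q <= n)%N -> dom (lam q).
Local Notation dir := (@dir R D lam).
Local Notation seg := (@seg R D lam n).
Local Notation hend := (@hend R D lam).
Local Notation sl := (@sl R D lam).
Local Notation mapw := (@mapw R D).
Implicit Types (w : seq I) (j k z : I) (s t h : R).
Implicit Types (p q : piece) (L : seq piece) (nx : nat * seq I).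

Local Notation wsum := (@wsum R D).
Local Notation fi_on := (@fi_on R D).
Local Notation fshift := (@fshift R D).

(* the height of [la - act w la] *)
Fixpoint ht w (la : V) : R := if w is z :: w' then ht w' la + cv z (act w' la) else 0.

Lemma ht_Qv w la (c : I -> int) (h : int) : la \in @bP R D -> Qv (la - act w la) c h -> ht w la = h%:~R.
Proof.
move=> Pl Q; suff [d [g [Q' ->]]] : exists d g, Qv (la - act w la) d g /\ ht w la = g%:~R.
  by have [_ ->] := Qv_uniq Q Q'.
elim: w {c h Q} => [|z w [c [h [Q E]]]].
  by exists (fun=> 0), 0; rewrite /= subrr; split=> //; exact: Qv0.
have [m Em] := corr_int z (P_act w Pl).
exists (fun k => c k + m * (z == k)%:R), (h + m); rewrite /= E Em rmorphD; split=> //.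
by have := QvD Q (Qv_zalpha m z); rewrite /refl Em opprB addrCA addrC.
Qed.

Lemma ht_eq w w' la : la \in @bP R D -> act w la = act w' la -> ht w la = ht w' la.
Proof.
move=> Pl E; have [c [h Q]] := Qv_act_sub w Pl.
by rewrite (ht_Qv Pl Q); rewrite E in Q; rewrite (ht_Qv Pl Q).
Qed.

Lemma ht_refl z w w' la : la \in @bP R D -> act w' la = refl z (act w la) ->
  ht w' la = ht w la + cv z (act w la).
Proof. by move=> Pl E; rewrite (ht_eq (w' := z :: w) Pl E). Qed.

Lemma ht_ge0 w la : dom la -> 0 <= ht w la.
Proof.
move=> dl; have [c [h [Q c0]]] := orbit_down w dl.
by rewrite (ht_Qv (proj1 dl) Q) ler0z; exact: Qv_height_ge0 Q c0.
Qed.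

Definition mht s L := wsum (fun q : nat * seq I => ht q.2 (lam q.1)) s L.

Lemma mht_ge0 s L nx : seg s L nx -> 0 <= mht s L.
Proof.
elim: L s => [|p L IH] s sg; first exact: lexx.
have [[m1 _ sp _] _ _] := sg; rewrite /mht /=; apply: addr_ge0; last exact: IH (seg_tl sg).
by rewrite mulr_ge0 ?subr_ge0 ?(ltW sp) //; exact/ht_ge0/lam_dom.
Qed.

(** Reflecting a direction raises its height by its pairing with the coroot of [z]. Weighted by
    durations, these pairings add up to the variation of [H]. *)
Lemma mht_mapw_refl z f s h L : (forall p, p \in L -> (1 <= pm p <= n)%N) ->
  (forall p, p \in L -> dir (pm p, f (pw p), pe p) = refl z (dir p)) ->
  mht s (mapw f L) = mht s L + (hend z s h L - h).
Proof.
elim: L s h => [|p L IH] s h hm H; first by rewrite /mht /= subrr addr0.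
have [Pp _] := lam_dom (hm p (mem_head _ _)).
have := IH (pe p) (h + (pe p - s) * sl z p); rewrite /mht /= => -> //; last first.
- by move=> q hq; apply: H; rewrite inE hq orbT.
- by move=> q hq; apply: hm; rewrite inE hq orbT.
have /(ht_refl Pp) E := H p (mem_head _ _); rewrite /pm /pw /= in E.
rewrite E /sl /dir /pm /pw /pe; ring.
Qed.

Lemma mht_cat s L1 L2 : mht s (L1 ++ L2) = mht s L1 + mht (lend s L1) L2.
Proof. exact: wsum_cat. Qed.

(** [G] has minimum [k], first reached at [T], and [Fp] is its last visit to level [k + 1] before
    [T]. Reflecting in between gives height [2 (k + 1) - H] there and [H + 2] afterwards, so [G']
    has minimum [k + 1], attained last at [Fp]. *)
Lemma fi_dip z (k : int) (Fp T N : R) (G G' : R -> V) (Dt : R -> R) : isr z ->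
  (forall t, G' t = G t - Dt t *: a_ z) -> 0 <= Fp -> Fp < T -> T <= N ->
  cv z (G Fp) = (k + 1)%:~R -> cv z (G T) = k%:~R ->
  (forall t, 0 <= t <= N -> k%:~R <= cv z (G t)) -> (forall t, 0 <= t < T -> k%:~R < cv z (G t)) ->
  (forall t, Fp < t <= T -> cv z (G t) < (k + 1)%:~R) ->
  (forall t, t <= Fp -> Dt t = 0) -> (forall t, Fp <= t <= T -> Dt t = cv z (G t) - (k + 1)%:~R) ->
  (forall t, T <= t -> Dt t = -1) ->
  fi_on N z G' (k + 1) Fp T /\ forall t, G t = fshift z G' (k + 1) Fp T t.
Proof.
move=> rz EG Fp0 FpT TN EFp ET Hge Hgt Hlt D0 D1 D2.
have EH t : cv z (G' t) = cv z (G t) - Dt t * 2.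
  by rewrite EG cvB corr_alpha A_re.
have k1 : (k + 1)%:~R = k%:~R + 1 :> R by rewrite rmorphD.
have k2 : (k + 1 + 1)%:~R = k%:~R + 2 :> R by rewrite !rmorphD /= -addrA.
have HFp : cv z (G' Fp) = (k + 1)%:~R by rewrite EH D0 // EFp; ring.
have FmE t : Fp < t -> (k + 1)%:~R < cv z (G' t) \/ ~~ (0 <= t <= N).
  move=> t1; case: (leP t N) => tN; last by right; rewrite andbF.
  left; rewrite EH; case: (leP t T) => tT.
    by rewrite D1 ?(ltW t1) //; have := Hlt t; rewrite t1 tT k1 => /(_ isT); lra.
  rewrite D2 ?(ltW tT) //; have := Hge t; rewrite tN (le_trans Fp0 (ltW t1)) k1 => /(_ isT); lra.
split; last first.
  move=> t; rewrite /fshift; case: (leP t Fp) => t1; first by rewrite EG D0 // scale0r subr0.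
  case: (leP t T) => t2; last by rewrite EG D2 ?(ltW t2) // scaleN1r opprK addrK.
  have -> : cv z (G' t) - (k + 1)%:~R = - Dt t by rewrite EH D1 ?(ltW t1) //; ring.
  by rewrite EG scaleNr opprK subrK.
split.
- move=> t t0n; case: (ltP Fp t) => t1.
    by case: (FmE t t1) => [/ltW //|]; rewrite t0n.
  rewrite EH D0 // mul0r subr0 => -[j Ej]; rewrite Ej ler_int.
  have : k%:~R < cv z (G t) by apply: Hgt; case/andP: t0n => -> _; exact: le_lt_trans t1 FpT.
  by rewrite Ej ltr_int; clear; move=> *; lia.
- split=> //; first exact: lt_le_trans FpT TN.
  move=> t t0n E; rewrite leNgt; apply/negP => t1.
  by case: (FmE t t1); rewrite ?t0n // E ltxx.
split=> //; first exact: ltW.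
  by rewrite EH D2 // ET k2; ring.
move=> t /andP [t1 t2] E; rewrite leNgt; apply/negP => t3; move: E; rewrite EH D1 ?t1 ?(ltW t3) //.
have := Hgt t; rewrite t3 (le_trans Fp0 t1) k1 k2 => /(_ isT); lra.
Qed.

Lemma zero_prefix z L : exists Z Y, [/\ L = Z ++ Y, all (fun p => sl z p == 0) Z &
  if Y is q :: _ then sl z q != 0 else True].
Proof.
elim: L => [|p L [Z [Y [-> H1 H2]]]]; first by exists [::], [::].
case: (boolP (sl z p == 0)) => E; last by exists [::], (p :: Z ++ Y).
by exists (p :: Z), Y; rewrite /= E H1.
Qed.

End Height.

(** * Raising by a real simple root *)

Section RealRaising.
Variables (R : realType) (D : BCdatum R).
Local Notation I := (bI D).
Local Notation V := (bV D).
Local Notation a_ := (@alpha R D).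
Local Notation cv := (@corr R D).
Local Notation isr := (@isreal R D).
Local Notation dom := (@dominant R D).
Local Notation piece := (nat * seq I * R)%type.
Variables (lam : nat -> V) (n : nat).
Hypothesis lam_dom : forall q, (1 <= q <= n)%N -> dom (lam q).
Local Notation gpp := (@gpp R D lam).
Local Notation seg := (@seg R D lam n).
Local Notation circ := (@circ R D lam n).
Local Notation bs := (@base R).
Local Notation hend := (@hend R D lam).
Local Notation sl := (@sl R D lam).
Local Notation hfun := (@hfun R D lam).
Local Notation dint := (@dint R D lam).
Local Notation mapw := (@mapw R D).
Implicit Types (j k z : I) (t : R).
Implicit Types (q : piece) (L : seq piece).

Local Notation good := (@good R D lam n).
Local Notation fi_on := (@fi_on R D).
Local Notation fshift := (@fshift R D).
Local Notation mht := (@mht R D lam).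

Lemma dip_step z L t0 : isr z -> good L -> 0 <= t0 <= n%:R -> cv z (gpp 0 L t0) < 0 ->
  exists L' (m : int) Fp Fm, [/\ good L', fi_on n%:R z (gpp 0 L') m Fp Fm,
    forall t, gpp 0 L t = fshift z (gpp 0 L') m Fp Fm t & mht 0 L' = mht 0 L - 1].
Proof.
move=> rz gd t0n Hneg; have [sg0 eL0] := gd.
have n0 : (0 < n)%N.
  rewrite lt0n; apply/eqP => E; move: t0n Hneg; rewrite E -eq_le => /eqP <-.
  by rewrite (gpp_le sg0) // cv0 ltxx.
have [p1 [L' [EL pm1 b0]]] := good_start gd n0.
have Ed0 : dint z 0 0 (nextd (n.+1, [::]) L) = 0.
  by rewrite EL /dint /= b0 !subrr mul0r subrr.
pose H t := cv z (gpp 0 L t).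
have HH : hfun z 0 0 L H by move=> t _; rewrite add0r.
have H0 := hfun_at sg0 HH.
have [|T [/andP [T0 Tn] Tmin Tlt Ti]] := first_min lam_dom rz sg0 erefl _ HH.
  by rewrite Ed0; exact: isint0.
rewrite eL0 in Tn Tmin.
have HT0 : H T < 0 := le_lt_trans (Tmin _ t0n) Hneg.
case: Ti => [ET|[k Ek]]; first by move: HT0; rewrite ET H0 ltxx.
have k0 : k < 0 by rewrite -(ltrz0 R) -Ek.
have kc : (k + 1)%:~R <= 0 :> R by rewrite lerz0; move: k0; clear; lia.
have [|LA [LB [sgAB eA eAB _ [gAB _]]]] := split_at (T := T) sg0; first by rewrite T0 eL0.
have /seg_cat [sgA sgB] := sgAB; rewrite eA in sgB.
(* The path starts at height [0 >= k + 1] and reaches [k] at [T], so the level [k + 1] is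
   crossed. *)
have [||Fp [Fp0 FpT HFp Flt]] := @last_cross _ _ _ _ z 0 0 LA _ H (k + 1)%:~R sgA _ kc.
- move=> t /andP [_]; rewrite eA => tT.
  by rewrite /H -gAB gpp_cat eA (gpp_le sgB tT) addr0 add0r.
- by rewrite eA Ek ltr_int; clear; lia.
rewrite eA in FpT Flt.
have [|L1 [L2 [L3 [sg e1 e2 e3 [gA wA]]]]] := three_split sg0 Fp0 (ltW FpT); first by rewrite eL0.
rewrite eL0 in e3; have [Z [Y [EL3 Z0 Y0]]] := zero_prefix lam z L3.
have [q2 [L2' EL2]] : exists q L', L2 = q :: L'.
  case: (L2) e2 => [|q L2'] e2; last by exists q, L2'.
  by move: FpT; rewrite -e2 /lend ltxx.
have /seg_cat [sg1 sg23] := sg; rewrite e1 in sg23.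
have /seg_cat [sg2 sg3] := sg23; rewrite e2 in sg3.
have h1 : hend z 0 0 L1 = (k + 1)%:~R.
  rewrite (hend_gpp z 0 sg1) add0r e1 -HFp /H -gA gpp_cat e1 (gpp_le sg23) //.
  by rewrite addr0.
pose H2 t := (k + 1)%:~R + cv z (gpp Fp L2 t).
have EH2 t : Fp <= t <= T -> H t = H2 t.
  move=> /andP [t1 t2]; rewrite /H -gA !gpp_cat e1 e2 (gpp_le sg3 t2) addr0 cvD.
  by rewrite /H2 -h1 (hend_gpp z 0 sg1) add0r e1 (gpp_ge sg1) e1.
have hf2 : hfun z Fp (k + 1)%:~R L2 H2 by [].
have h2 : hend z Fp (k + 1)%:~R L2 = k%:~R.
  by rewrite -(hfun_hend sg2 hf2) e2 -EH2 ?Ek // lexx ltW.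
have Hd1 : isint (dint z 0 0 (nextd (nextd (n.+1, [::]) (L2 ++ L3)) L1)).
  have -> : nextd (nextd (n.+1, [::]) (L2 ++ L3)) L1 = nextd (n.+1, [::]) (L1 ++ (L2 ++ L3)).
    by rewrite -nextd_cat.
  move: (sg); case: (L1 ++ (L2 ++ L3)) (gA) => [gA0 _|q L0 _ [[m1 b1 _ _] _ _]].
    move: Hneg; rewrite -gA0 /gpp /= cv0 ltxx //.
  rewrite /dint /= (_ : bs (pm q) = 0) ?subrr ?mul0r ?subrr; first exact: isint0.
  by apply/eqP; rewrite eq_le b1 /base ler0n.
have Hd2 : isint (dint z Fp (k + 1)%:~R (nextd (nextd (n.+1, [::]) L3) L2)).
  by have := dint_seg lam_dom sg1 Hd1; rewrite e1 h1 nextd_cat.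
have al2 : all (fun q => sl z q < 0) L2.
  move: sg2 Hd2 hf2 EL2 e2 => + + + EL2; rewrite EL2 => sg2 Hd2 hf2 e2.
  apply: (falling_slopes lam_dom rz sg2 Hd2 hf2); last first.
    move=> t; rewrite e2 => /andP [t1 t2]; rewrite -EH2 ?(ltW t1) ?(ltW t2) //.
    case=> j Ej; have := Tlt t; rewrite (le_trans Fp0 (ltW t1)) t2 Ek Ej ltr_int => /(_ isT).
    have := Flt t; rewrite t1 (ltW t2) Ej ltr_int => /(_ isT); clear; lia.
  have [[_ _ sq _] _ _] := sg2; have pT : pe q2 <= T by rewrite -e2; exact: lend_ge (seg_tl sg2).
  have := Flt (pe q2); rewrite sq pT EH2 ?(ltW sq) ?pT // => /(_ isT).
  rewrite /H2 EL2 (gpp_hd sg2) ?lexx ?(ltW sq) // cvZ gtrDl pmulr_rlt0 // subr_gt0 //.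
(* The flat pieces after [T] keep their directions, but their words must be lowered together with
   those of the stretch. *)
pose X := L2 ++ Z.
have Enx : nextd (n.+1, [::]) (L2 ++ L3) = nextd (nextd (n.+1, [::]) Y) X.
  by rewrite EL3 catA nextd_cat.
have sgX : seg Fp X (nextd (n.+1, [::]) Y).
  by move: sg23; rewrite EL3 catA => /seg_cat [].
have sgY : seg (lend Fp X) Y (n.+1, [::]).
  by move: sg23; rewrite EL3 catA => /seg_cat [].
have alX : all (fun q => sl z q <= 0) X.
  rewrite all_cat (sub_all _ al2) ?(sub_all _ Z0) //; first by move=> q /eqP ->.
  by move=> q /ltW.
have pmX q : q \in X -> (1 <= pm q <= n)%N := seg_pm sgX.
have s0 : 0 <= lend Fp X by apply: le_trans Fp0 _; exact: lend_ge sgX.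
have sgX' : seg Fp (mapw (circ z) X) (nextd (n.+1, [::]) Y).
  (* Lowering may stop after [Z]: the next slope is nonzero, hence positive by minimality at [T],
     and [circ] does nothing; at the sentinel dominance of all [lam r] does the same. *)
  have := seg_circ lam_dom rz sgX alX; case: Y Y0 EL3 sgY {Enx sgX} => [|q Y] Y0 EL3 sgY /= H'.
    apply: (seg_eqw H') => r hr; rewrite (act_circ lam_dom) //=.
    by apply: vcirc_dom; exact: lam_dom.
  suff E : circ z (pw q) = pw q by rewrite E in H'.
  have [[mq _ sq _] _ _] := sgY; apply: circ_self; exists (pm q) => //.
  rewrite -/(sl z q) lt_neqAle eq_sym Y0 /=.
  have hfY : hfun z (lend Fp X) k%:~R (q :: Y) H.
    have sgf : seg 0 ((L1 ++ X) ++ (q :: Y)) (n.+1, [::]).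
      by move: sg; rewrite EL3 /X !catA.
    have hff : hfun z 0 0 ((L1 ++ X) ++ (q :: Y)) H.
      by move=> t _; rewrite /H -gA EL3 /X !catA add0r.
    have := hfun_cat sgf hff; rewrite lend_cat e1 hend_cat e1 h1 /X hend_cat h2.
    by rewrite hend_all0.
  have eq' : pe q <= n%:R.
    by rewrite -e3 EL3 -e2 -lend_cat catA lend_cat; exact: lend_ge (seg_tl sgY).
  have := Tmin (pe q); rewrite eq' (le_trans s0 (ltW sq)) (hfun_hd (t := pe q) sgY hfY) ?lexx ?(ltW sq) //.
  by rewrite Ek lerDl pmulr_rge0 ?subr_gt0 // => /(_ isT).
exists (L1 ++ (mapw (circ z) X ++ Y)), (k + 1), Fp, T.
have gZ t : gpp (lend Fp L2) (mapw (circ z) Z) t = gpp (lend Fp L2) Z t.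
  apply: gpp_mapw_id => q hq; have /eqP s1 := allP Z0 q hq.
  by rewrite (dir_circ_le0 lam_dom) ?pmX ?mem_cat ?hq ?orbT // ?s1 // refl0.
have gX t : gpp Fp (mapw (circ z) X) t = gpp Fp X t - cv z (gpp Fp L2 t) *: a_ z.
  rewrite /mapw map_cat -!/(mapw _ _) !gpp_cat lend_mapw.
  rewrite (gpp_mapw_refl (z := z)); last first.
    move=> q hq; apply: (dir_circ_le0 lam_dom) => //; first by apply: pmX; rewrite mem_cat hq.
    by apply/ltW; exact: (allP al2).
  by rewrite gZ addrAC.
have gG t : gpp 0 (L1 ++ (mapw (circ z) X ++ Y)) t = gpp 0 L t - cv z (gpp Fp L2 t) *: a_ z.
  rewrite -gA EL3 (catA L2) -/X !(gpp_cat _ 0 L1) e1 -addrA; congr (_ + _).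
  rewrite (gpp_cat _ Fp X) (gpp_cat _ Fp (mapw _ _)) gX lend_mapw.
  exact: addrAC.
have [] := fi_dip (k := k) (Fp := Fp) (T := T) (N := n%:R) (Dt := fun t => cv z (gpp Fp L2 t)) rz gG => //.
- by move=> t /Tmin; rewrite Ek.
- by move=> t /Tlt; rewrite Ek.
- by move=> t t1; rewrite (gpp_le sg2 t1) cv0.
- by move=> t t1; rewrite -/(H t) (EH2 _ t1) /H2 addrC addKr.
- move=> t t1; rewrite (gpp_ge sg2) ?e2 //.
  by have := EH2 T; rewrite lexx (ltW FpT) Ek /H2 rmorphD /= => /(_ isT); lra.
move=> F1 F2; split=> //.
  split.
    apply/seg_cat; rewrite e1; split; last by apply/seg_cat; rewrite lend_mapw.
    have := seg_circ_next lam_dom rz sg1 Hd1; rewrite h1 => /(_ (ex_intro _ _ erefl)).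
    by rewrite /X EL2.
  by rewrite !lend_cat lend_mapw e1 -e3 EL3 !lend_cat e2.
have -> : mht 0 L = mht 0 (L1 ++ (X ++ Y)).
  by rewrite /mht -wA EL3 /X -!catA.
have -> : mht 0 (L1 ++ (mapw (circ z) X ++ Y)) = mht 0 (L1 ++ (X ++ Y)) + (hend z Fp (k + 1)%:~R X - (k + 1)%:~R).
  rewrite !(mht_cat _ 0 L1) e1 (mht_cat _ Fp X) (mht_cat _ Fp (mapw _ _)) lend_mapw (mht_mapw_refl lam_dom (z := z) Fp (k + 1)%:~R pmX); first by ring.
  move=> q hq; apply: (dir_circ_le0 lam_dom) => //; first exact: pmX.
  exact: (allP alX).
by rewrite /X hend_cat h2 hend_all0 // rmorphD /=; ring.
Qed.

End RealRaising.

(** * Straight pieces and words fixing earlier weights *)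

Section Straightness.
Variables (R : realType) (D : BCdatum R).
Local Notation I := (bI D).
Local Notation V := (bV D).
Local Notation a_ := (@alpha R D).
Local Notation cv := (@corr R D).
Local Notation dom := (@dominant R D).
Local Notation piece := (nat * seq I * R)%type.
Variables (lam : nat -> V) (n : nat).
Hypothesis lam_dom : forall q, (1 <= q <= n)%N -> dom (lam q).
Local Notation dir := (@dir R D lam).
Local Notation gpp := (@gpp R D lam).
Local Notation link := (@link R D lam).
Local Notation seg := (@seg R D lam n).
Local Notation pok := (@pok R D n).
Local Notation bs := (@base R).
Local Notation hend := (@hend R D lam).
Local Notation sl := (@sl R D lam).
Local Notation mapw := (@mapw R D).
Implicit Types (u v w : seq I) (i k z : I) (mu nu : V) (s t h : R).
Implicit Types (p q : piece) (L : seq piece) (nx : nat * seq I).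

Local Notation mht := (@mht R D lam).

(** Going up in this order lowers the weight, whereas no weight of the orbit exceeds [la]. *)
Lemma orbit_min la nu : dom la -> inWorbit la nu -> wge la nu -> nu = la.
Proof.
move=> dl on H; have [c [h [Q _ [//|h0]]]] := wge_coords dl on H.
case: on (Q) => w <- Q'; have [d [g [Qd d0]]] := orbit_down w dl.
have := QvN Q'; rewrite opprB => /(Qv_uniq Qd) [_ E].
by have := Qv_height_ge0 Qd d0; rewrite E oppr_ge0 leNgt h0.
Qed.

(** A real word is invertible, so each weight lies in the orbit of the other and their difference
    has nonnegative coordinates with both signs. *)
Lemma dom_Wre la mu : dom la -> dom mu -> inWreorbit la mu -> mu = la.
Proof.
move=> dl dm [w [rw E]]; have [c [h [Q c0]]] := orbit_down w dl; rewrite E in Q.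
have [d [g [Qd d0]]] := orbit_down (rev w) dm.
rewrite -E act_revK // E in Qd; have := QvN Qd; rewrite opprB => /(Qv_uniq Q) [Ec _].
apply/eqP; rewrite eq_sym -subr_eq0; apply/eqP; apply: (Qv_eq0 Q) => k.
by have := c0 k; have := d0 k; rewrite Ec; clear; move=> *; lia.
Qed.

(** Otherwise [la - r_beta la] is a positive multiple of [beta], and [stabilizer] finds in its
    support a simple coroot positive on [la]. *)
Lemma cobeta_perp u i la (c : I -> int) (h : int) : proot u i -> dom la -> Qv (act u (a_ i)) c h ->
  (forall k, 0 < c k -> cv k la = 0) -> cobeta u i la = 0.
Proof.
move=> p dl Q Hc; have ru := proj1 p; apply/eqP; rewrite eq_le (cobeta_dom_ge0 p dl) andbT.
rewrite leNgt; apply/negP => pos; have [m Em] := cobeta_int u i (proj1 dl).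
have Er : la - rbeta u i la = m%:~R *: act u (a_ i) by rewrite rbetaE // Em opprB addrC subrK.
case: (stabilizer (rword u i) dl) => [[v [vw _ al]]|[k [d [g [Qd _ k1 k2]]]]].
  move: Er; rewrite /rbeta -(act_weq vw) (act_fix al) subrr => /esym/eqP.
  rewrite scaler_eq0 -Em gt_eqF //= => /eqP; exact: root_neq0.
have := QvZ m Q; rewrite -Er => /(Qv_uniq Qd) [Ed _].
have mp : 0 < m by rewrite -(ltr0z R) -Em.
by move: k1; rewrite Hc ?ltxx // -(pmulr_rgt0 _ mp) -Ed.
Qed.

(** A single-orbit inequality does not control earlier weights. The support hypothesis makes each
    root used in the chain orthogonal to them, so they stay fixed as the word is built. *)
Lemma wge_word m x y : (1 <= m <= n)%N -> wge x (act y (lam m)) ->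
  (forall (c : I -> int) (h : int), Qv (act y (lam m) - x) c h -> forall k, 0 < c k -> forall r, (1 <= r < m)%N -> cv k (lam r) = 0) ->
  (forall r, (1 <= r < m)%N -> act y (lam r) = lam r) ->
  exists w, [/\ act w (lam m) = x, tge lam m w y & forall r, (1 <= r < m)%N -> act w (lam r) = lam r].
Proof.
move=> hm; have lm := lam_dom hm.
suff H nu : wge x nu -> forall y, nu = act y (lam m) ->
  (forall (c : I -> int) (h : int), Qv (nu - x) c h -> forall k, 0 < c k -> forall r, (1 <= r < m)%N -> cv k (lam r) = 0) ->
  (forall r, (1 <= r < m)%N -> act y (lam r) = lam r) ->
  exists w, [/\ act w (lam m) = x, tge lam m w y & forall r, (1 <= r < m)%N -> act w (lam r) = lam r].
  by move=> H1; exact: (H _ H1).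
elim=> {nu y} [|x' nu u i Hx IH p E C] y Ey Hs Hf.
  by exists y; split=> //; exact: tge_id.
have onu : inWorbit (lam m) nu by rewrite Ey; exact: orb_act.
have ox' : inWorbit (lam m) x' by rewrite E; exact: orb_rbeta.
have [M EM] := cobeta_int u i (orb_P lm onu).
have M0 : 0 < M by rewrite -(ltr0z R) -EM.
have [c [h [Q c0 _]]] := proot_coords p; have [d [g [Qd d0 _]]] := wge_coords lm ox' Hx.
have Qs : Qv (nu - x) (fun k => M * c k + d k) (M * h + g).
  have := QvD (QvZ M Q) Qd; congr (Qv _ _ _).
  by rewrite E rbetaE ?EM; [rewrite addrA (addrC (_ *: _)) subrK|case: p].
have Hc k r : (1 <= r < m)%N -> 0 < c k -> cv k (lam r) = 0.
  move=> hr ck; apply: (Hs _ _ Qs k) => //.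
  by rewrite ltr_wpDr ?mulr_gt0.
have [||r hr|w [Ew tw fw]] := IH (rword u i ++ y).
- by rewrite act_rword -Ey.
- move=> d' g' Qd' k dk; apply: (Hs _ _ Qs k).
  have [Ed _] := Qv_uniq Qd' Qd; rewrite -Ed; apply: lt_le_trans dk _.
  by rewrite lerDr mulr_ge0 // ltW.
- rewrite act_rword Hf // rbetaE; last by case: p.
  rewrite (cobeta_perp p (c := c) (h := h)) ?scale0r ?subr0 //.
    by apply: lam_dom; move: hm hr; clear; move=> *; lia.
  by move=> k ck; exact: Hc.
exists w; split=> //; apply: (tge_step tw p) => [r _|]; first exact: act_rword.
by exists m; [move: hm; clear; move=> *; lia|rewrite -Ey].
Qed.

Lemma seg_lt s L nx q : seg s L nx -> q \in L -> bs (pm q) < lend s L.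
Proof.
elim: L s => //= p L IH s sg; have [[_ b1 sp _] _ _] := sg; have sg' := seg_tl sg.
rewrite inE => /orP [/eqP ->|]; last exact: IH.
by apply: le_lt_trans b1 _; apply: lt_le_trans sp _; exact: lend_ge sg'.
Qed.

Definition fixes (nx : nat * seq I) := forall r, (1 <= r < nx.1)%N -> act nx.2 (lam r) = lam r.

Lemma fix_below s p nx : pok s p -> link p nx -> fixes (pm p, pw p) ->
  forall r, (1 <= r < pm p)%N -> act nx.2 (lam r) = lam r.
Proof.
move=> [m1 _ _ _] [_ tg _] fx r hr; have mn : (pm p <= n)%N by case/andP: m1.
have lr : dom (lam r) by apply: lam_dom; move: hr mn; clear; move=> *; lia.
apply: orbit_min => //; first exact: orb_act.
rewrite -{1}(fx r hr); apply: (tge_wge lam_dom mn) => //.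
by case/andP: hr => -> /ltnW.
Qed.

Lemma fix_step s p nx : pok s p -> link p nx -> fixes (pm p, pw p) -> dir p = lam (pm p) -> fixes nx.
Proof.
move=> ok lk fx st r hr; have [m1 _ _ _] := ok; have [rc _ nxm] := lk.
case: (ltnP r (pm p)) => rp; first by apply: (fix_below ok lk fx); rewrite rp andbT; case/andP: hr.
have Er : r = pm p.
  by case: nxm hr => [->|[-> _ _]]; move: rp; clear; move=> *; lia.
rewrite Er; apply: orbit_min; [exact: lam_dom|exact: orb_act|].
by rewrite -{1}st; exact: rchain_wge rc.
Qed.

Lemma fix_seg s L nx : seg s L nx -> fixes (nextd nx L) -> all (fun p => dir p == lam (pm p)) L -> fixes nx.
Proof.
elim: L s => //= p L IH s [ok lk sg] fx /andP [/eqP st al].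
by apply: (IH _ sg) => //; exact: fix_step ok lk fx st.
Qed.

Lemma fix_run m s L nx : seg s L nx -> L <> [::] -> all (fun p => pm p == m) L ->
  (forall r, (1 <= r < m)%N -> act (nextd nx L).2 (lam r) = lam r) ->
  forall r, (1 <= r < m)%N -> act nx.2 (lam r) = lam r.
Proof.
elim: L s => //= p L IH s [ok lk sg] _ /andP [/eqP Ep al] fx.
have fx' : forall r, (1 <= r < m)%N -> act (nextd nx L).2 (lam r) = lam r.
  by move=> r; rewrite -Ep; apply: (fix_below ok lk) => q; rewrite Ep; exact: fx.
by case: (L) sg al fx' IH => // q L' sg al fx' IH; exact: (IH _ sg).
Qed.

(** If the last straight piece were in the same factor as what follows, minimality of the dominant
    weight would make the next direction straight. *)
Lemma straight_end s L nx : seg s L nx -> s = bs (nextd nx L).1 -> all (fun p => dir p == lam (pm p)) L ->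
  act nx.2 (lam nx.1) <> lam nx.1 -> lend s L = bs nx.1.
Proof.
elim/last_ind: L => [|L p _]; first by [].
rewrite -cats1 => /seg_cat [_ sgp] _; rewrite all_cat => /andP [_ /andP [/eqP st _]] ne.
rewrite lend_cat; have [ok lk0 _] := sgp; have lk : link p nx := lk0.
have [m1 _ _ _] := ok; have [rc _ nxm] := lk.
case: (eqVneq nx.1 (pm p)) => [E|/eqP ne1]; last by have [_ <-] := link_frac1 ok lk ne1.
case: ne; rewrite E; apply: orbit_min; [exact: lam_dom|exact: orb_act|].
by rewrite -{1}st; exact: rchain_wge rc.
Qed.

Lemma seg_eqw_lt s L m w w' : seg s L (m, w) -> (forall q, q \in L -> (pm q < m)%N) ->
  (forall r, (1 <= r < m)%N -> act w (lam r) = act w' (lam r)) -> seg s L (m, w').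
Proof.
move=> + + E; elim: L s => //= p L IH s [ok lk sg] Hm; split=> //; last first.
  by apply: IH => // q hq; apply: Hm; rewrite inE hq orbT.
have pl : (pm p < m)%N := Hm p (mem_head _ _).
case: (L) lk => //= -[rc tg H]; have [m1 _ _ _] := ok.
have Ep : act w (lam (pm p)) = act w' (lam (pm p)) by apply: E; rewrite pl andbT; case/andP: m1.
split=> /=; rewrite -?Ep //; apply: tge_eqr tg => q hq; apply: E.
by case/andP: hq => -> /leq_ltn_trans ->.
Qed.

Lemma seg_const s L nx m w : seg s L nx -> all (fun p => pm p == m) L ->
  rchain (lend s L - bs m) (act w (lam m)) (act nx.2 (lam m)) -> tge lam m w nx.2 ->
  (nx.1 = m \/ [/\ nx.1 = m.+1, lend s L = m%:R & inWreorbit (lam m) (act nx.2 (lam m))]) ->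
  seg s (mapw (fun=> w) L) nx.
Proof.
elim: L s => //= p L IH s [ok lk sg] /andP [/eqP Ep al] rc tg H; split=> //; last exact: IH.
have Ed : dir (pm p, w, pe p) = act w (lam m) by rewrite {1}/dir /= Ep.
case: (L) al rc H {IH sg lk} => [|q L'] /=; first by rewrite /link Ed [pm _]Ep.
move=> /andP [/eqP Eq _] _ _; rewrite /link Ed [pm _]Ep Eq; split; [exact: rch_refl|exact: tge_id|by left].
Qed.

Lemma gpp_const s L nx x t : seg s L nx -> all (fun p => dir p == x) L -> s <= t <= lend s L ->
  gpp s L t = (t - s) *: x.
Proof.
elim: L s => [|p L IH] s sg.
  move=> _; rewrite /lend /= => /andP [t1 t2]; have -> : t = s by apply/eqP; rewrite eq_le t1 t2.
  by rewrite subrr scale0r.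
move=> /= /andP [/eqP Ex al] /andP [t1 t2]; have [[_ _ sp _] _ _] := sg; have sg' := seg_tl sg.
case: (leP t (pe p)) => tp; first by rewrite (gpp_hd sg) ?t1 // Ex.
rewrite (gpp_tl sg (ltW tp)) IH ?(ltW tp) // Ex -scalerDl; congr (_ *: _); ring.
Qed.

(** Imaginary reflections are not involutive, so the old directions are expressed through the new
    ones. *)
Lemma gpp_unrefl z f s L t : (forall p, p \in L -> dir p = refl z (dir (pm p, f (pw p), pe p))) ->
  gpp s L t = gpp s (mapw f L) t - cv z (gpp s (mapw f L) t) *: a_ z.
Proof.
elim: L s => [|p L IH] s H; first by rewrite /gpp /= cv0 scale0r subr0.
rewrite /gpp /= -!/(dl _ _) -!/(gpp _ _ _) IH; last by move=> q hq; apply: H; rewrite inE hq orbT.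
rewrite H ?mem_head // cvD cvZ scalerDl /refl scalerBr scalerA.
by rewrite opprD addrACA.
Qed.

Lemma mht_unrefl z f s h L : (forall p, p \in L -> (1 <= pm p <= n)%N) ->
  (forall p, p \in L -> dir p = refl z (dir (pm p, f (pw p), pe p))) ->
  mht s L = mht s (mapw f L) + (hend z s h (mapw f L) - h).
Proof.
elim: L s h => [|p L IH] s h hm H; first by rewrite /mht /= subrr addr0.
have [Pp _] := lam_dom (hm p (mem_head _ _)).
have := IH (pe p) (h + (pe p - s) * sl z (pm p, f (pw p), pe p)); rewrite /mht /= => -> //; last first.
- by move=> q hq; apply: H; rewrite inE hq orbT.
- by move=> q hq; apply: hm; rewrite inE hq orbT.
have /(ht_refl Pp) E := H p (mem_head _ _); rewrite /pm /pw /= in E.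
rewrite E /sl /dir /pm /pw /pe /=; ring.
Qed.

Lemma prefix_split (P : pred piece) L : exists L1 L2, [/\ L = L1 ++ L2, all P L1 &
  if L2 is q :: _ then ~~ P q else True].
Proof.
elim: L => [|p L [L1 [L2 [-> H1 H2]]]]; first by exists [::], [::].
case: (boolP (P p)) => E; last by exists [::], (p :: L1 ++ L2).
by exists (p :: L1), L2; rewrite /= E H1.
Qed.

End Straightness.

(** * Raising by an imaginary simple root *)

Section ImaginaryRaising.
Variables (R : realType) (D : BCdatum R).
Local Notation I := (bI D).
Local Notation V := (bV D).
Local Notation a_ := (@alpha R D).
Local Notation cv := (@corr R D).
Local Notation isr := (@isreal R D).
Local Notation dom := (@dominant R D).
Local Notation piece := (nat * seq I * R)%type.
Variables (lam : nat -> V) (n : nat).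
Hypothesis lam_dom : forall q, (1 <= q <= n)%N -> dom (lam q).
Local Notation dir := (@dir R D lam).
Local Notation gpp := (@gpp R D lam).
Local Notation seg := (@seg R D lam n).
Local Notation bs := (@base R).
Local Notation sl := (@sl R D lam).
Local Notation mapw := (@mapw R D).
Implicit Types (v w : seq I) (j k z : I) (mu nu : V) (s t h e : R).
Implicit Types (p q : piece) (L : seq piece) (nx : nat * seq I).

Local Notation good := (@good R D lam n).
Local Notation fi_on := (@fi_on R D).
Local Notation fshift := (@fshift R D).
Local Notation mht := (@mht R D lam).
Local Notation fixes := (@fixes R D lam).

Lemma Qv_sub_coord la mu k (c : I -> int) (h : int) : Qv (la - mu) c h -> (forall j, 0 <= c j) -> c k = 0 ->
  cv k la <= cv k mu.
Proof.
move=> Q c0 ck; have -> : mu = la + - (la - mu) by rewrite opprB addrC subrK.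
rewrite cvD cvN lerDl oppr_ge0; have [l [-> _]] := Qv_cv k Q.
apply: sumr_le0 => j _; rewrite lerz0; case: (eqVneq k j) => [<-|ne]; first by rewrite ck mul0r.
by rewrite mulr_ge0_le0 // bA_off.
Qed.

Lemma push_step L : good L -> ~~ all (fun p => dir p == lam (pm p)) L ->
  (forall z t, isr z -> 0 <= t <= n%:R -> 0 <= cv z (gpp 0 L t)) ->
  exists k L' (m : int) Fp Fm, [/\ good L', fi_on n%:R k (gpp 0 L') m Fp Fm,
    forall t, gpp 0 L t = fshift k (gpp 0 L') m Fp Fm t & mht 0 L' = mht 0 L - 1].
Proof.
move=> gd nst pos; have [sgL eL] := gd.
have n0 : (0 < n)%N.
  case: L gd sgL nst {pos eL} => [|p L] _ //= [[m1 _ _ _] _ _] _.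
  by move: m1; clear; move=> *; lia.
have [L0 [LR [EL st0 hR]]] := prefix_split (fun p => dir p == lam (pm p)) L.
case: LR EL hR => [|p L1] EL hR; first by move: nst; rewrite EL cats0 st0.
set m := pm p; set mu := dir p; set s := lend 0 L0; move/eqP: hR => hR.
have /seg_cat [sg0 sgp] : seg 0 (L0 ++ p :: L1) (n.+1, [::]) by rewrite -EL.
rewrite -/s in sgp; rewrite [nextd _ _]/= -/m in sg0.
have [p0 [L' [EL' pm0 b0]]] := good_start gd n0.
have En : nextd (n.+1, [::]) L = nextd (m, pw p) L0 by rewrite EL nextd_cat.
have En1 : (nextd (m, pw p) L0).1 = 1%N by rewrite -En EL'.
have fx : fixes (m, pw p).
  by apply: (fix_seg lam_dom sg0) => // r; rewrite En1; case: r.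
(* The first non-straight piece opens its factor, so the time elapsed since [s] is the local time,
   the coefficient in the chain. *)
have Es : s = bs m.
  by apply: (straight_end lam_dom sg0) => //; rewrite En1.
have [[m1 _ sp pm1] _ _] := sgp; rewrite -/m in m1 pm1.
have lm := lam_dom m1; have mn : (m <= n)%N by case/andP: m1.
have lr r : (1 <= r < m)%N -> dom (lam r).
  by move=> hr; apply: lam_dom; move: hr mn; clear; move=> *; lia.
have [v rv vw] := reduced_ex (pw p).
have [c [h [Q c0 cvn _]]] := reduced_stab lm rv.
have Emu : act v (lam m) = mu by rewrite (act_weq vw).
rewrite Emu in Q.
(* The word fixes the earlier weights, so by [reduced_stab] every letter of its reduced form
   annihilates them; heights for these letters vanish up to time [s]. *)
have J k r : k \in v -> (1 <= r < m)%N -> cv k (lam r) = 0.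
  move=> kv hr; have [d [g [Qd _ _ [al|[j _ dj]]]]] := reduced_stab (lr r hr) rv.
    by have /eqP := allP al k kv.
  move: Qd dj; rewrite (act_weq vw) (fx r hr) subrr => Qd.
  by have [-> _] := Qv_uniq Qd (@Qv0 R D); rewrite ltxx.
have pmlt q : q \in L0 -> (pm q < m)%N.
  move=> hq; have := seg_lt sg0 hq; rewrite -/s Es /base ltr_nat.
  by have := seg_pm sg0 hq; clear -m1; move: m1; move=> *; lia.
have sl0 k : k \in v -> all (fun q => sl k q == 0) L0.
  move=> kv; apply/allP => q hq; rewrite /sl (eqP (allP st0 q hq)) J //.
  by have := seg_pm sg0 hq; rewrite pmlt // andbT => /andP [].
have Hs k : k \in v -> cv k (gpp 0 L0 s) = 0.
  by move=> kv; have := hend_gpp k 0 sg0; rewrite hend_all0 ?sl0 // add0r.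
(* Real letters of [v] have height 0 at [s], so nonnegative heights force a nonnegative slope. For a
   real [k] outside [v] the [k]-coordinate of [lam m - mu] vanishes, whence
   [alpha_k^vee(mu) >= alpha_k^vee(lam m)]. *)
have dmu : dom mu.
  split=> [|k]; first by apply: P_act; case: lm.
  case: (boolP (isr k)) => rk; last exact: cv_im_ge0.
  case: (boolP (k \in v)) => kv; last first.
    by apply: le_trans (Qv_sub_coord Q c0 (cvn k kv)); case: lm => _.
  have /seg_cat [_ sg1] : seg s ([:: p] ++ L1) (n.+1, [::]) by exact: sgp.
  have pn : pe p <= n%:R by apply: le_trans pm1 _; rewrite ler_nat.
  have s0 : 0 <= s := lend_ge sg0.
  have := pos k (pe p) rk; rewrite pn (le_trans s0 (ltW sp)) => /(_ isT).
  rewrite EL gpp_cat -/s (gpp_ge sg0) ?(ltW sp) // (gpp_hd sgp) ?lexx ?(ltW sp) //.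
  by rewrite cvD cvZ Hs // add0r pmulr_rge0 // subr_gt0.
(* Cuts may split one direction into several pieces; the whole run must be replaced, and only at its
   end is the chain nontrivial. *)
have [Run [Rest [ER aR hRest]]] := prefix_split (fun q => (pm q == m) && (dir q == mu)) (p :: L1).
have sgRR := sgp; rewrite ER in sgRR; have /seg_cat [sgR sgRest] := sgRR.
set nx := nextd (n.+1, [::]) Rest in sgR; set e := lend s Run in sgRest.
have nR : Run <> [::].
  by move=> E; move: ER hRest; rewrite E /= => <-; rewrite -/m -/mu !eqxx.
have aRm : all (fun q => pm q == m) Run by apply: sub_all aR => q /andP [].
have aRd : all (fun q => dir q == mu) Run by apply: sub_all aR => q /andP [].
have Enx : nextd nx Run = (m, pw p) by rewrite /nx -nextd_cat -ER.
have fnx r : (1 <= r < m)%N -> act nx.2 (lam r) = lam r.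
  by apply: (fix_run lam_dom sgR nR aRm); rewrite Enx.
set nu := act nx.2 (lam m).
have [rc H3] : rchain (e - bs m) mu nu /\ (nx.1 = m \/ [/\ nx.1 = m.+1, e = m%:R & inWreorbit (lam m) nu]).
  move: sgR aRm aRd nR; rewrite /e; case/lastP: (Run) => // R0 r; rewrite -cats1 !all_cat lend_cat.
  move=> /seg_cat [_ [ok lk _]] /andP [_ /andP [/eqP Er _]] /andP [_ /andP [/eqP Ed _]] _.
  by have [rc _ H] := lk; rewrite Er Ed in rc H.
(* Inside the factor this is maximality of the run. At a junction [nu] is in the real orbit of
   [lam m], so a dominant [mu = nu] would be [lam m]. *)
have numu : mu <> nu.
  move=> E; case: H3 => [E1|[_ _ wr]]; last by apply: hR; apply: dom_Wre => //; rewrite -/mu E.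
  move: hRest E1 E; rewrite /nu /nx; case: (Rest) => [|q L2] /=.
    by move=> _ E1; move: mn; rewrite -E1 ltnn.
  by move=> ne E1 E; move: ne; rewrite E1 eqxx /= {1}/dir E1 -E eqxx.
have [//|[x ra rx]] := rchain_head rc.
have onu : inWorbit (lam m) nu by exact: orb_act.
have ox := orb_rchain onu rx.
have [k [ik Ek k1 k2]] := dominant_first_step lm ox dmu ra.
have [M EM] := corr_int k (orb_P lm ox).
have M0 : 0 < M by rewrite -(ltr0z R) -EM.
have [f [g [Qf f0]]] := orbit_down nx.2 lm; rewrite -/nu in Qf.
have [d [h' [Qd d0 _]]] := wge_coords lm onu (rchain_wge rx).
(* [lam m - mu] is the sum of [lam m - nu], [nu - x] and a positive multiple of [alpha k]. So [k]
   and the support of [nu - x] consist of letters of [v], which annihilate the earlier weights. *)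
have Ec j : c j = f j + d j + M * (k == j)%:R.
  have QS := QvD (QvD Qf Qd) (Qv_zalpha M k).
  have E : lam m - nu + (nu - x) + M%:~R *: a_ k = lam m - mu.
    by rewrite Ek /refl EM opprB addrA subrK -addrA [- x + _]addrC.
  by rewrite E in QS; have [-> _] := Qv_uniq Q QS.
have inv j : 0 < c j -> j \in v by apply: contraTT => jv; rewrite cvn // ltxx.
have kv : k \in v by apply: inv; rewrite Ec eqxx mulr1 ltr_wpDl ?addr_ge0.
have [|w [Ew tw fw]] := wge_word lam_dom m1 (rchain_wge rx) _ fnx.
  move=> c' g' Q' j cj r hr; apply: J => //; apply: inv; rewrite Ec.
  have [E _] := Qv_uniq Q' Qd; rewrite -addrA ltr_wpDl // ltr_wpDr //; last by rewrite -E.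
  by rewrite mulr_ge0 // ltW.
pose Run' := mapw (fun=> w) Run.
have sgR' : seg s Run' nx.
  by apply: (seg_const sgR aRm) => //; rewrite Ew.
have sg0' : seg 0 L0 (m, w).
  by apply: (seg_eqw_lt sg0 pmlt) => r hr; rewrite fw //; exact: fx.
have eR' : lend s Run' = e by rewrite lend_mapw.
have Enx' : nextd nx Run' = (m, w).
  by move: Enx nR; rewrite /Run'; case: (Run) => //= q R0 [-> _].
have sgn : seg 0 (L0 ++ (Run' ++ Rest)) (n.+1, [::]).
  apply/seg_cat; split; first by rewrite nextd_cat Enx'.
  by apply/seg_cat; rewrite eR'.
have gn : good (L0 ++ (Run' ++ Rest)).
  by split=> //; rewrite -eL EL ER !lend_cat lend_mapw.
have dR' : all (fun q => dir q == x) Run'.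
  apply/allP => q /mapP [q' hq' ->]; rewrite {1}/dir /= (eqP (allP aRm q' hq')) Ew //.
have hR' q : q \in Run -> dir q = refl k (dir (pm q, w, pe q)).
  move=> hq; rewrite (eqP (allP aRd q hq)) Ek {1}/dir /= (eqP (allP aRm q hq)) Ew //.
have se : s < e.
  by move: nR sgR; rewrite /e; case: (Run) => // q R0 _ sgR; exact: lend_gt sgR.
have gR' t : s <= t <= e -> gpp s Run' t = (t - s) *: x.
  by move=> ht; apply: (gpp_const sgR' dR'); rewrite eR'.
pose G := gpp 0 (L0 ++ (Run' ++ Rest)).
have GE t : G t = gpp 0 L0 t + (gpp s Run' t + gpp e Rest t) by rewrite /G !gpp_cat eR'.
have HE t : s <= t <= e -> cv k (G t) = (t - s) * cv k x.
  move=> /andP [t1 t2]; rewrite GE (gpp_ge sg0 t1) (gpp_le sgRest t2) addr0.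
  by rewrite gR' ?t1 // cvD cvZ Hs // add0r.
have He : cv k (G e) = 1 by rewrite HE ?lexx ?(ltW se) // Es.
have Hs0 : cv k (G s) = 0 by rewrite HE ?lexx ?(ltW se) // subrr mul0r.
have mono t t' : t <= t' -> cv k (G t) <= cv k (G t').
  by move=> tt; apply: (cv_gpp_mono lam_dom 0 ik _ tt) => q; exact: seg_pm sgn.
have s0 : 0 <= s := lend_ge sg0.
have en : e <= n%:R by rewrite -eL EL ER !lend_cat; exact: lend_ge sgRest.
have gt0 t : s < t -> 0 < cv k (G t).
  move=> st; case: (leP t e) => te; last by apply: lt_le_trans (mono _ _ (ltW te)); rewrite He.
  by rewrite HE ?te ?(ltW st) // mulr_gt0 // subr_gt0.
exists k, (L0 ++ (Run' ++ Rest)), 0, s, e; split=> //.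
- split.
  + move=> t /andP [t0 _] _; case: (leP t s) => ts; last by apply/ltW/gt0.
    have := mono _ _ t0; rewrite /G (gpp_le sgn (lexx 0)) cv0 //.
  + split=> //; first exact: lt_le_trans se en.
    by move=> t _ E; rewrite leNgt; apply/negP => /gt0; rewrite -/G E ltxx.
  + split=> //; first exact: ltW.
    move=> t /andP [t1 _] E; rewrite leNgt; apply/negP => te.
    move: E; rewrite -/G HE ?t1 ?(ltW te) // add0r => E.
    have : (t - s) * cv k x < (e - s) * cv k x by rewrite ltr_pM2r // ltrD2r.
    by rewrite E -HE ?lexx ?(ltW se) // He ltxx.
- move=> t; rewrite EL ER.
  apply: (shift_lists (m := 0) (Fp := s) (Fm := e) (L1 := L0) (L2 := Run') (L3 := Rest) sgn) => //.
  by move=> r; exact: gpp_unrefl.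
have := mht_unrefl lam_dom s 0 (fun q => seg_pm sgR) hR'.
rewrite (hend_gpp k 0 sgR') eR' gR' ?lexx ?(ltW se) // cvZ Es k2 add0r subr0 -Es => E.
rewrite EL ER !(mht_cat _ 0 L0) !(mht_cat _ _ Run) -/s E (mht_cat _ s Run') eR' -/e; ring.
Qed.

End ImaginaryRaising.

(** * From lists of pieces to the statement *)

Section BruhatLifting.
Variables (R : realType) (D : BCdatum R).
Local Notation I := (bI D).
Local Notation V := (bV D).
Local Notation dom := (@dominant R D).
Local Notation piece := (nat * seq I * R)%type.
Variables (lam : nat -> V) (n : nat).
Hypothesis lam_dom : forall q, (1 <= q <= n)%N -> dom (lam q).
Local Notation dir := (@dir R D lam).
Local Notation gpp := (@gpp R D lam).
Local Notation link := (@link R D lam).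
Local Notation seg := (@seg R D lam n).
Implicit Types (u v w : seq I) (i k : I) (s t h e : R).
Implicit Types (p q : piece) (L : seq piece) (nx : nat * seq I).

Local Notation ble := (@bruhat_le R D).

Lemma bruhat_weqr x y y' : ble x y -> weq y y' -> ble x y'.
Proof.
case=> [u u' E E'|u u1 u' H [v [i [p [E lt]]]] E']; first by apply: ble_eq; exact: weq_trans E E'.
apply: (ble_step H); exists v, i; split=> //; split; first exact: weq_trans (weq_sym E') E.
by move/lenltE: lt => lt; apply/lenltE; rewrite -(len_weq E').
Qed.

Lemma bruhat_trans x y w : ble x y -> ble y w -> ble x w.
Proof.
move=> H H2; elim: H2 x H => [u u' E|u u1 u' _ IH e] x H; first exact: bruhat_weqr H E.
exact: ble_step (IH _ H) e.
Qed.

(** An edge gives only weak signs. One that pairs to zero with all of [lam 1, ..., lam m] moves none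
    of them and is absorbed by [tge_refl]. *)
Lemma bruhat_tge m x w : (m <= n)%N -> ble x w -> tge lam m w x.
Proof.
move=> mn; elim=> [u u' E|u u1 u' _ IH [v [i [p [E lt]]]]].
  by apply: tge_refl => q _; rewrite (act_weq E).
apply: tge_trans IH; have lt' : lenlt u1 (rword v i ++ u1).
  by move/lenltE: lt => lt; apply/lenltE; rewrite -(len_weq E).
have ge0 r : (1 <= r <= m)%N -> 0 <= cobeta v i (act u1 (lam r)).
  by move=> hr; apply: lenlt_cobeta_ge0 => //; apply: lam_dom; exact: le_n hr.
have Eact r : act u' (lam r) = rbeta v i (act u1 (lam r)) by rewrite (act_weq E) act_rword.
case: (pselect (exists2 r, (1 <= r <= m)%N & 0 < cobeta v i (act u1 (lam r)))) => [H|H].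
  by apply: (tge_one p).
apply: tge_refl => r hr; rewrite Eact rbetaE; last by case: p.
have := ge0 r hr; rewrite le_eqVlt => /orP [/eqP <-|H2]; first by rewrite scale0r subr0.
by case: H; exists r.
Qed.

Lemma tge_nil m w : (m <= n)%N -> tge lam m w [::].
Proof.
move=> mn; have [v rv vw] := reduced_ex w.
apply: (tge_eql (x := v)) => [q _|]; first by rewrite (act_weq vw).
elim: v {vw} rv => [_|k v IH /reduced_cons [rv lt]]; first exact: tge_id.
apply: tge_trans (IH rv); apply: (tge_cons_up mn) => r hr; apply: cv_dom_ge0 => //.
by apply: lam_dom; exact: le_n hr.
Qed.

(** The same reflections are applied to the prescribed word [x']. A strictly positive pairing with
    one [lam q] makes each of them lengthen the word, hence a Bruhat edge. *)
Lemma bruhat_lift m w x : (m <= n)%N -> tge lam m w x -> forall x',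
  (forall r, (1 <= r <= m)%N -> act x' (lam r) = act x (lam r)) ->
  exists w', ble x' w' /\ forall r, (1 <= r <= m)%N -> act w' (lam r) = act w (lam r).
Proof.
move=> mn; elim=> {x} [x E|x y u i _ IH p E [q hq H]] x' Ex.
  by exists x'; split=> [|r hr]; [exact/ble_eq/weq_refl|rewrite E // Ex].
have [r hr|w' [H1 H2]] := IH (rword u i ++ x'); first by rewrite act_rword Ex // E.
exists w'; split=> //; apply: bruhat_trans H1; apply: (ble_step (ble_eq (weq_refl _))).
exists u, i; split=> //; split; first exact: weq_refl.
by apply: (cobeta_gt0_lenlt p (lam_dom (le_n mn hq))); rewrite Ex.
Qed.

Fixpoint bseg nx L : Prop :=
  if L is p :: L' then ble (nextd nx L').2 (pw p) /\ bseg nx L' else True.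

(** Words are replaced from right to left, because lifting needs the smaller word first. Their
    action on the weights up to their own factor is kept. *)
Lemma relift s L nx : seg s L nx -> exists L', [/\ seg s L' nx, forall t, gpp s L' t = gpp s L t,
  lend s L' = lend s L, (nextd nx L').1 = (nextd nx L).1 /\
   (forall r, (1 <= r <= (nextd nx L).1)%N -> (1 <= r <= n)%N -> act (nextd nx L').2 (lam r) = act (nextd nx L).2 (lam r))
  & bseg nx L'].
Proof.
elim: L s => [|p L IH] s; first by exists [::].
move=> [ok lk sg]; have [L' [H1 H2 H3 [H4 H5] H6]] := IH _ sg.
have [rc tg H] := lk; have [m1 _ _ _] := ok; have mn : (pm p <= n)%N by case/andP: m1.
have nm : (pm p <= (nextd nx L).1)%N by case: H => [->|[->]].
have E r : (1 <= r <= pm p)%N -> act (nextd nx L').2 (lam r) = act (nextd nx L).2 (lam r).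
  by move=> /andP [r1 r2]; apply: H5; rewrite r1; [exact: leq_trans nm|exact: leq_trans mn].
have [w' [B1 B2]] := bruhat_lift mn tg E.
have Ed : act w' (lam (pm p)) = dir p by apply: B2; rewrite leqnn andbT; case/andP: m1.
exists ((pm p, w', pe p) :: L'); split=> //.
- split=> //; split.
  + by rewrite {1}/dir /= Ed E // leqnn andbT; case/andP: m1.
  + apply: (tge_eql (x := pw p)); first by move=> q hq; exact: B2.
    by apply: tge_eqr tg => q hq; rewrite E.
  + by rewrite /= H4 E // leqnn andbT; case/andP: m1.
- by move=> t; rewrite /gpp /= -!/(dl _ _) -!/(gpp _ _ _) H2 {1}/dir /= Ed.
- by split=> //= r hr _; exact: B2.
Qed.

(* component and word of the piece of the path containing the time interval to the right of [T] *)
Fixpoint pat L (T : R) : nat * seq I :=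
  if L is p :: L' then if T < pe p then (pm p, pw p) else pat L' T else (0%N, [::]).

Lemma pat_bruhat_hd s p L nx T : seg s (p :: L) nx -> bseg nx (p :: L) -> T < lend s (p :: L) ->
  ble (pat (p :: L) T).2 (pw p).
Proof.
elim: L s p => [|q L IH] s p sg bs' hT /=.
  by rewrite ifT; [exact/ble_eq/weq_refl|].
case: (ltP T (pe p)) => _; first exact/ble_eq/weq_refl.
have [b1 b2] := bs'; apply: bruhat_trans b1.
exact: (IH _ _ (seg_tl sg) b2 hT).
Qed.

Lemma pat_bruhat s L nx T T' : seg s L nx -> bseg nx L -> T <= T' -> T' < lend s L ->
  ble (pat L T').2 (pat L T).2.
Proof.
elim: L s => [|p L IH] s sg bs' TT hT; first exact/ble_eq/weq_refl.
have := pat_bruhat_hd sg bs' hT; rewrite /=; case: (ltP T (pe p)) => tp //.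
by rewrite ltNge (le_trans tp TT) /= => _; apply: IH hT => //; [exact: seg_tl sg|case: bs'].
Qed.

Lemma pat_pm s L nx T m : seg s L nx -> (1 <= m)%N -> m.-1%:R <= T -> s <= T -> T < m%:R -> T < lend s L ->
  (pat L T).1 = m.
Proof.
elim: L s => [|p L IH] s sg m1 T1 sT T2 hT; first by move: (le_lt_trans sT hT); rewrite ltxx.
have [[mp b1 _ pm1] _ _] := sg; rewrite /=; case: (ltP T (pe p)) => tp; last exact: (IH _ (seg_tl sg)).
have : (pm p).-1%:R < m%:R :> R by apply: le_lt_trans b1 _; exact: le_lt_trans sT T2.
have : m.-1%:R < (pm p)%:R :> R by apply: lt_le_trans pm1; exact: le_lt_trans T1 tp.
by rewrite !ltr_nat /=; move: m1 mp; clear; move=> *; lia.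
Qed.

Lemma pat_deriv s L nx T : seg s L nx -> s <= T -> T < lend s L -> exists2 eps, 0 < eps &
  forall h, 0 <= h <= eps -> gpp s L (T + h) = gpp s L T + h *: act (pat L T).2 (lam (pat L T).1).
Proof.
elim: L s => [|p L IH] s sg sT hT; first by move: (le_lt_trans sT hT); rewrite ltxx.
rewrite /=; case: (ltP T (pe p)) => tp.
  exists (pe p - T); first by rewrite subr_gt0.
  move=> h /andP [h0 h1]; rewrite !(gpp_hd sg) ?sT ?(ltW tp) //; last first.
    by rewrite (le_trans sT) ?lerDl //= -lerBrDl.
  by rewrite -scalerDl; congr (_ *: _); ring.
have [eps e0 He] := IH _ (seg_tl sg) tp hT; exists eps => // h hh.
have h0 : 0 <= h by case/andP: hh.
by rewrite !(gpp_tl sg) ?(le_trans tp) ?lerDl // He // addrA.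
Qed.

Lemma link_at s L nx m : seg s L nx -> (1 <= m)%N -> s < m%:R -> m%:R < lend s L ->
  exists p T0, [/\ T0 < m%:R, forall T, T0 <= T -> T < m%:R -> pat L T = (pm p, pw p),
    link p (pat L m%:R), pe p = m%:R & pm p = m].
Proof.
elim: L s => [|p L IH] s sg m1 sm ml; first by move: (lt_trans sm ml); rewrite ltxx.
have [ok lk0 _] := sg; have lk : link p (nextd nx L) := lk0; have sg' := seg_tl sg.
have [mp b1 sp pm1] := ok; case: (ltP (pe p) m%:R) => pem.
  have [q [T0 [H1 H2 H3 H4 H5]]] := IH _ sg' m1 pem ml.
  exists q, (Num.max T0 (pe p)); split=> //.
  - by rewrite gt_max H1.
  - by move=> T; rewrite ge_max => /andP [t1 t2] t3 /=; rewrite ltNge t2 H2.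
  - by rewrite /= ltNge (ltW pem).
have Em : pm p = m.
  have : (pm p).-1%:R < m%:R :> R by exact: le_lt_trans b1 sm.
  have : m%:R <= (pm p)%:R :> R by exact: le_trans pem pm1.
  by rewrite ltr_nat ler_nat; move: m1 mp; clear; move=> *; lia.
have Ep : pe p = m%:R by apply/eqP; rewrite eq_le pem -Em pm1.
exists p, s; split=> //; first by move=> T _ tm; rewrite /= Ep tm.
rewrite /= Ep ltxx; case: (L) sg' lk ml => [|q L'] sg' lk ml.
  by move: ml; rewrite /lend /= Ep ltxx.
by have [[_ _ sq _] _ _] := sg'; rewrite /= -Ep sq.
Qed.

End BruhatLifting.

(** * Passing between the parameter intervals [[0, n]] and [[0, 1]] *)

Section Reparametrization.
Variables (R : realType) (D : BCdatum R).
Local Notation I := (bI D).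
Local Notation V := (bV D).
Local Notation dom := (@dominant R D).
Local Notation piece := (nat * seq I * R)%type.
Variables (lam : nat -> V) (n : nat).
Hypothesis lam_dom : forall q, (1 <= q <= n)%N -> dom (lam q).
Local Notation dir := (@dir R D lam).
Local Notation gpp := (@gpp R D lam).
Local Notation seg := (@seg R D lam n).
Implicit Types (j k z : I) (s t : R).
Implicit Types (p q : piece) (L : seq piece) (nx : nat * seq I).

Local Notation good := (@good R D lam n).
Local Notation fi_on := (@fi_on R D).
Local Notation fshift := (@fshift R D).

Hypothesis n_gt0 : (0 < n)%N.
Let N0 : 0 < n%:R :> R. Proof. by rewrite ltr0n. Qed.
Local Notation N := (n%:R : R).

Lemma scaled_itv (t : R) : 0 <= t <= 1 -> 0 <= N * t <= N.
Proof. by move=> /andP [t0 t1]; rewrite mulr_ge0 ?ler0n // ler_piMr ?ler0n. Qed.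

Lemma unscale (T : R) : N * (T / N) = T.
Proof. by rewrite mulrCA mulfV ?mulr1 // gt_eqF. Qed.

Lemma unscaled_itv (T : R) : 0 <= T <= N -> 0 <= T / N <= 1.
Proof. by move=> /andP [t0 t1]; rewrite divr_ge0 ?ler0n //= ler_pdivrMr // mul1r. Qed.

Lemma scale_le (t T : R) : (N * t <= T) = (t <= T / N).
Proof. by rewrite ler_pdivlMr // mulrC. Qed.

Lemma fi_rel_of_on z (G : R -> V) m Fp Fm (p q : R -> V) : fi_on N z G m Fp Fm ->
  (forall t, 0 <= t <= 1 -> p t = G (N * t)) ->
  (forall t, 0 <= t <= 1 -> q t = fshift z G m Fp Fm (N * t)) -> fi_rel z p q.
Proof.
move=> [H1 [a1 a2 a3 a4] [b1 b2 b3 b4]] Ep Eq.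
have Fp01 : 0 <= Fp / N <= 1 by apply: unscaled_itv; rewrite a1 ltW.
have Fm01 : 0 <= Fm / N <= 1 by apply: unscaled_itv; rewrite b2 (le_trans a1).
exists m, (Fp / N), (Fm / N); split.
- by exists (Fp / N); rewrite Ep // unscale.
- by move=> t t01; rewrite Ep //; apply: H1; exact: scaled_itv.
- split=> //; first by case/andP: Fp01.
  + by rewrite ltr_pdivrMr // mul1r.
  + by rewrite Ep // unscale.
  + by move=> t t01; rewrite Ep // -scale_le; apply: a4; exact: scaled_itv.
- split=> //; first by rewrite ler_pM2r ?invr_gt0.
  + by case/andP: Fm01.
  + by rewrite Ep // unscale.
  + move=> t /andP [t0 t1] E; have t01 : 0 <= t <= 1 by rewrite t1 andbT (le_trans _ t0) //; case/andP: Fp01.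
    rewrite ler_pdivrMr // mulrC; apply: b4; last by rewrite -Ep.
    by rewrite mulrC -ler_pdivrMr // t0 /= -[X in _ <= X]mul1r ler_pM2r.
- by move=> t t01; rewrite Eq // /fshift !scale_le Ep.
Qed.

Lemma fi_on_of_rel z (G p q : R -> V) : fi_rel z p q -> (forall t, 0 <= t <= 1 -> p t = G (N * t)) ->
  exists m Fp Fm, fi_on N z G m Fp Fm /\ forall t, 0 <= t <= 1 -> q t = fshift z G m Fp Fm (N * t).
Proof.
move=> [m [fp [fm [_ H1 [a1 a2 a3 a4] [b1 b2 b3 b4] Eq]]]] Ep.
have fp01 : 0 <= fp <= 1 by rewrite a1 ltW.
have fm01 : 0 <= fm <= 1 by rewrite b2 (le_trans a1).
exists m, (N * fp), (N * fm).
have EG T : 0 <= T <= N -> G T = p (T / N) by move=> hT; rewrite Ep ?unscale //; exact: unscaled_itv.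
split; last first.
  by move=> t t01; rewrite Eq // /fshift !ler_pM2l // Ep.
split.
- by move=> t tN; rewrite EG //; apply: H1; exact: unscaled_itv.
- split; [by rewrite mulr_ge0 ?ler0n|by rewrite -[X in _ < X]mulr1 ltr_pM2l|by rewrite -Ep|].
  by move=> t tN; rewrite EG // => E; rewrite mulrC -ler_pdivrMr //; apply: a4 E; exact: unscaled_itv.
split; [by rewrite ler_pM2l|by rewrite -[X in _ <= X]mulr1 ler_pM2l|by rewrite -Ep|].
move=> t /andP [t1 t2] E; rewrite mulrC -ler_pdivlMr //; apply: b4.
  by rewrite ler_pdivrMr // mul1r t2 -scale_le t1.
by rewrite -EG // t2 (le_trans _ t1) // mulr_ge0 ?ler0n.
Qed.

Lemma unit_cover (T : R) : 0 <= T <= N -> exists2 m, (1 <= m <= n)%N & m.-1%:R <= T <= m%:R.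
Proof.
elim: n n_gt0 => // k IH _ /andP [T0 T1]; case: (leqP k 0) => [|k0].
  by rewrite leqn0 => /eqP Ek; exists 1%N; rewrite ?Ek //= T0; move: T1; rewrite Ek.
case: (leP T k%:R) => Tk; last by exists k.+1; rewrite ?ltnSn ?leqnn //= (ltW Tk).
have [|m hm hT] := IH k0; first by rewrite T0.
by exists m => //; case/andP: hm => -> /leqW.
Qed.

Lemma concat_uniq (f : nat -> R -> V) (p q : R -> V) :
  concat_rel [seq f m | m <- iota 1 n] p -> concat_rel [seq f m | m <- iota 1 n] q ->
  forall t, 0 <= t <= 1 -> p t = q t.
Proof.
rewrite /concat_rel size_map size_iota => Hp Hq t /scaled_itv /unit_cover [m hm /andP [h1 h2]].
have ht : m.-1%:R / N <= t <= m%:R / N by rewrite -scale_le h2 ler_pdivrMr // mulrC h1.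
by rewrite (Hp m hm t ht) (Hq m hm t ht).
Qed.

Lemma concat_of_steps (P : R -> V) (f : nat -> R -> V) : P 0 = 0 ->
  (forall m tau, (1 <= m <= n)%N -> 0 <= tau <= 1 -> P (m.-1%:R + tau) = P m.-1%:R + f m tau) ->
  concat_rel [seq f m | m <- iota 1 n] (fun t => P (N * t)).
Proof.
move=> P0 HP; rewrite /concat_rel size_map size_iota => m hm t /andP [h1 h2].
have nthE l : (l < n)%N -> nth (fun=> 0) [seq f m | m <- iota 1 n] l = f l.+1.
  by move=> ln; rewrite (nth_map 0%N) ?size_iota // nth_iota // add1n.
have PS l : (l <= n)%N -> P l%:R = \sum_(j < l) nth (fun=> 0) [seq f m | m <- iota 1 n] j 1.
  elim: l => [|l IH] ln; first by rewrite big_ord0.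
  rewrite big_ord_recr /= -IH ?(ltnW ln) // nthE //.
  by have := HP l.+1 1; rewrite /= ln lexx ler01 natr1 => /(_ isT isT).
have [m1 mn] := andP hm; rewrite -PS; last by apply: leq_trans (leq_pred m) mn.
rewrite nthE prednK //.
have Em : m%:R = m.-1%:R + 1 :> R by rewrite natr1 prednK.
have tau1 : 0 <= N * t - m.-1%:R <= 1.
  rewrite subr_ge0 lerBlDl -Em scale_le h2 andbT.
  by move: h1; rewrite ler_pdivrMr // mulrC.
by rewrite -(HP m _ hm tau1); congr P; rewrite addrC subrK.
Qed.

Lemma concat_step (f : nat -> R -> V) (P p : R -> V) : concat_rel [seq f m | m <- iota 1 n] p ->
  (forall t, 0 <= t <= 1 -> p t = P (N * t)) ->
  forall m, (1 <= m <= n)%N -> exists C, forall tau, 0 <= tau <= 1 -> P (m.-1%:R + tau) = C + f m tau.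
Proof.
rewrite /concat_rel size_map size_iota => Hp Ep m hm; have [m1 mn] := andP hm.
exists (\sum_(l < m.-1) nth (fun=> 0) [seq f m | m <- iota 1 n] l 1) => tau /andP [t0 t1].
pose t := (m.-1%:R + tau) / N.
have Em : m%:R = m.-1%:R + 1 :> R by rewrite natr1 prednK.
have h1 : m.-1%:R / N <= t <= m%:R / N.
  by rewrite !ler_pM2r ?invr_gt0 // lerDl t0 Em lerD2l.
have t01 : 0 <= t <= 1.
  apply: unscaled_itv; rewrite addr_ge0 ?ler0n //=; apply: (@le_trans _ _ m%:R); last by rewrite ler_nat.
  by rewrite Em lerD2l.
have := Hp m hm t h1; rewrite Ep // /t unscale => ->; congr (_ + _).
rewrite (nth_map 0%N) ?size_iota ?nth_iota ?prednK // add1n prednK //.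
by congr f; rewrite addrC addKr.
Qed.

(* the concatenation of the straight paths, in time [[0, n]] *)
Definition straight_sum (T : R) : V :=
  \sum_(q < n) Num.max 0 (Num.min T q.+1%:R - q%:R) *: lam q.+1.

Lemma straight_sum_step m (s T : R) : (1 <= m <= n)%N -> m.-1%:R <= s -> s <= T -> T <= m%:R ->
  straight_sum T - straight_sum s = (T - s) *: lam m.
Proof.
move=> /andP [m1 mn] ms sT Tm; have mn' : (m.-1 < n)%N by rewrite prednK.
rewrite /straight_sum -sumrB (bigD1 (Ordinal mn')) //= prednK // -scalerBl big1 ?addr0.
  by rewrite !min_l ?(le_trans sT) // !max_r ?subr_ge0 ?(le_trans ms) //; congr (_ *: _); ring.
move=> q /eqP qm; rewrite -scalerBl; case: (ltngtP q m.-1) => [lt|gt|E]; last by case: qm; apply: val_inj.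
  have q1 : q.+1%:R <= m.-1%:R :> R by rewrite ler_nat.
  by rewrite !min_r ?subrr ?scale0r // ?(le_trans q1) // (le_trans ms).
have q1 : m%:R <= q%:R :> R by rewrite ler_nat -(prednK m1).
have clip r : r <= q%:R -> Num.max 0 (Num.min r q.+1%:R - q%:R) = 0 :> R.
  move=> rq; rewrite max_l // subr_le0 ge_min rq //.
by rewrite !clip ?subrr ?scale0r ?(le_trans Tm) // (le_trans sT) // (le_trans Tm).
Qed.

Lemma straight_gpp s L nx T : seg s L nx -> all (fun p => dir p == lam (pm p)) L -> s <= T <= lend s L ->
  gpp s L T = straight_sum T - straight_sum s.
Proof.
elim: L s => [|p L IH] s sg.
  rewrite /lend /= => _ /andP [t1 t2]; have -> : T = s by apply/eqP; rewrite eq_le t1 t2.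
  by rewrite subrr.
move=> /= /andP [/eqP Ep al] /andP [t1 t2]; have [[m1 b1 sp pm1] _ _] := sg; have sg' := seg_tl sg.
case: (leP T (pe p)) => tp.
  by rewrite (gpp_hd sg) ?t1 // Ep (straight_sum_step m1) // (le_trans tp).
rewrite (gpp_tl sg (ltW tp)) IH ?(ltW tp) // Ep -(straight_sum_step m1 b1 (ltW sp) pm1).
by rewrite addrC addrA subrK.
Qed.

Lemma straight_concat L : good L -> all (fun p => dir p == lam (pm p)) L ->
  concat_rel [seq straight (lam m) | m <- iota 1 n] (fun t => gpp 0 L (N * t)).
Proof.
move=> [sg eL] al; apply: (concat_of_steps (f := fun m => straight (lam m))).
  by rewrite (gpp_le sg).
move=> m tau hm /andP [t0 t1]; have [m1 mn] := andP hm.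
have Em : m.-1%:R + 1 = m%:R :> R by rewrite natr1 prednK.
have le1 : m.-1%:R + tau <= m%:R by rewrite -Em lerD2l.
have mN : m%:R <= N by rewrite ler_nat.
have le0 : m.-1%:R <= m.-1%:R + tau by rewrite lerDl.
rewrite !(straight_gpp sg al) ?eL ?ler0n ?(le_trans le0 (le_trans le1 mN)) //=.
  rewrite addrAC; congr (_ - _); apply/eqP; rewrite addrC -subr_eq.
  by rewrite (straight_sum_step hm) // addrC addKr.
by rewrite addr_ge0 ?ler0n //= (le_trans le1).
Qed.

End Reparametrization.

(** * Generalized LS paths as blocks of pieces *)

Section LSPathBlocks.
Variables (R : realType) (D : BCdatum R).
Local Notation I := (bI D).
Local Notation V := (bV D).
Local Notation dom := (@dominant R D).
Local Notation piece := (nat * seq I * R)%type.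
Variables (lam : nat -> V) (n : nat).
Hypothesis lam_dom : forall q, (1 <= q <= n)%N -> dom (lam q).
Local Notation dir := (@dir R D lam).
Local Notation gpp := (@gpp R D lam).
Local Notation link := (@link R D lam).
Local Notation seg := (@seg R D lam n).
Implicit Types (w : seq I) (j k : I) (s t h : R).
Implicit Types (q : piece) (nx : nat * seq I).

Local Notation clip t a b := (Num.max 0 (Num.min t b - a) : R).

Lemma clip_shift (b T a1 a2 : R) : clip T (b + a1) (b + a2) = clip (T - b) a1 a2.
Proof.
congr (Num.max _ _); rewrite opprD addrA; congr (_ - _).
by rewrite !minElt ltrBlDl; case: ifP => // _; rewrite addrC addKr.
Qed.

Section LSPath.
Variables (k : nat) (lf : nat -> V) (af : nat -> rat).
Hypotheses (a0 : af 0%N = 0) (ak : af k = 1)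
  (ainc : forall l, (l < k)%N -> af l < af l.+1).
Local Notation a l := (ratr (af l) : R).

Lemma af_le l l' : (l <= l')%N -> (l' <= k)%N -> a l <= a l'.
Proof.
move=> /subnK <-; elim: (l' - l)%N => [|d IH] //; rewrite addSn => dk.
by apply: le_trans (IH (ltnW dk)) _; rewrite ler_rat ltW // ainc.
Qed.

Lemma af_lt l : (l < k)%N -> a l < a l.+1.
Proof. by move=> lk; rewrite ltr_rat ainc. Qed.

Lemma af0E : a 0 = 0. Proof. by rewrite a0 rmorph0. Qed.
Lemma af1E : a k = 1. Proof. by rewrite ak rmorph1. Qed.

Lemma af_ge0 l : (l <= k)%N -> 0 <= a l. Proof. by move=> lk; rewrite -af0E af_le. Qed.
Lemma af_le1 l : (l <= k)%N -> a l <= 1. Proof. by move=> lk; rewrite -af1E af_le. Qed.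

Lemma lsfun_le0 (t : R) : t <= 0 -> lsfun k lf af t = 0.
Proof.
move=> t0; rewrite /lsfun big_nat_cond big1 // => l /andP [/andP [l1 lk] _].
rewrite max_l ?scale0r // subr_le0 ge_min (le_trans t0) // af_ge0 //.
by apply: leq_trans (leq_pred l) _; rewrite -ltnS.
Qed.

Lemma lsfun_ge1 (t : R) : 1 <= t -> lsfun k lf af t = lsfun k lf af 1.
Proof.
move=> t1; rewrite /lsfun; apply: eq_big_nat => l /andP [l1 lk].
by rewrite !min_r ?af_le1 // (le_trans _ t1) // af_le1.
Qed.

Lemma lsfun_deriv l (t : R) : (1 <= l <= k)%N -> a l.-1 <= t -> t < a l -> exists2 eps, 0 < eps &
  forall h, 0 <= h <= eps -> lsfun k lf af (t + h) = lsfun k lf af t + h *: lf l.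
Proof.
move=> /andP [l1 lk] t1 t2; exists (a l - t); first by rewrite subr_gt0.
move=> h /andP [h0 h1]; have th : t + h <= a l by rewrite addrC -lerBrDr.
have tt : t <= t + h by rewrite lerDl.
suff <- : lsfun k lf af (t + h) - lsfun k lf af t = h *: lf l by rewrite [RHS]addrC subrK.
rewrite /lsfun -sumrB.
rewrite (bigD1_seq l) ?iota_uniq //=; last by rewrite mem_index_iota l1.
rewrite -scalerBl big_nat_cond big1 ?addr0.
  rewrite (min_l th) (min_l (ltW t2)) !max_r ?subr_ge0 ?(le_trans t1 tt) //.
  by congr (_ *: _); ring.
move=> j /andP [/andP [j1 jk] jl]; rewrite -scalerBl.
case: (ltngtP j l) jl => // lt _.
  have aj : a j <= t by apply: le_trans t1; apply: af_le; [rewrite -ltnS prednK|exact: leq_trans (leq_pred l) lk].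
  by rewrite !min_r ?subrr ?scale0r // (le_trans aj).
have aj : a l <= a j.-1 by apply: af_le; [rewrite -ltnS prednK|apply: leq_trans (leq_pred j) _; rewrite -ltnS].
by rewrite !max_l ?subrr ?scale0r // subr_le0 ge_min ?(le_trans th aj) ?(le_trans (ltW t2) aj).
Qed.

Variables (m : nat) (w : nat -> seq I).
Hypothesis m1 : (1 <= m <= n)%N.
Local Notation b := (m.-1%:R : R).

Definition blk (l c : nat) : seq piece := [seq (m, w r, b + a r) | r <- iota l c].

Lemma gpp_blk l c (T : R) : (1 <= l)%N -> gpp (b + a l.-1) (blk l c) T =
  \sum_(l <= r < l + c) clip (T - b) (a r.-1) (a r) *: act (w r) (lam m).
Proof.
elim: c l => [|c IH] l l1; first by rewrite addn0 big_geq.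
rewrite addnS big_ltn ?ltnS ?leq_addr // /gpp /= -/(dl _) -/(gpp _ _ _) -/(blk _ _).
by rewrite (IH l.+1) // addSn clip_shift.
Qed.

Lemma lend_blk l c s : lend s (blk l c.+1) = b + a (l + c)%N.
Proof. by elim: c l s => [|c IH] l s; [rewrite addn0|rewrite addnS -addSn -(IH _ (b + a l))]. Qed.

Lemma blk_end : b + a k = m%:R.
Proof. by rewrite af1E natr1 prednK //; case/andP: m1. Qed.

Lemma seg_blk l c nx : (1 <= l)%N -> (l + c = k.+1)%N ->
  (forall r, (1 <= r <= k)%N -> act (w r) (lam m) = lf r) ->
  (forall r, (1 <= r < k)%N -> achain (af r) (lf r) (lf r.+1)) ->
  (forall r, (1 <= r < k)%N -> bruhat_le (w r.+1) (w r)) ->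
  link (m, w k, m%:R) nx -> seg (b + a l.-1) (blk l c) nx.
Proof.
move=> + + Ew Hc Hb lk; elim: c l => [|c IH] l l1 E //=.
have lk' : (l <= k)%N by rewrite -ltnS -E addnS ltnS leq_addr.
have mn : (m <= n)%N by case/andP: m1.
rewrite -/(blk _ _); split; last by apply: (IH l.+1) => //; rewrite addSnnS.
  split=> //=.
  - by rewrite /base lerDl af_ge0 // (leq_trans (leq_pred l)).
  - by rewrite /pe /= ltrD2l -{2}(prednK l1); apply: af_lt; rewrite prednK.
  - by rewrite /pm /pe /= -blk_end lerD2l af_le.
case: (c) E => [|c'] E /=.
  have -> : l = k by move: E; clear; lia.
  by rewrite blk_end.
have lk2 : (1 <= l < k)%N by rewrite l1; move: E; clear; lia.
have lk3 : (1 <= l.+1 <= k)%N by case/andP: lk2.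
split=> /=; [|apply: (bruhat_tge lam_dom mn); exact: Hb|by left].
rewrite {1}/dir /pm /pw /pe /= /base Ew ?l1 ?lk' // Ew // addrC addKr.
exact: achain_rchain (Hc _ lk2).
Qed.

End LSPath.
End LSPathBlocks.

(** * Lists of pieces, standard paths and the lifting conditions *)

Section Characterization.
Variables (R : realType) (D : BCdatum R).
Local Notation I := (bI D).
Local Notation V := (bV D).
Local Notation cv := (@corr R D).
Local Notation isr := (@isreal R D).
Local Notation dom := (@dominant R D).
Local Notation piece := (nat * seq I * R)%type.
Variables (lam : nat -> V) (n : nat).
Hypothesis lam_dom : forall q, (1 <= q <= n)%N -> dom (lam q).
Local Notation dir := (@dir R D lam).
Local Notation gpp := (@gpp R D lam).
Local Notation seg := (@seg R D lam n).
Implicit Types (w : seq I) (i j k z : I) (t h : R).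
Implicit Types (L : seq piece).

Local Notation good := (@good R D lam n).
Local Notation fi_on := (@fi_on R D).
Local Notation fshift := (@fshift R D).
Local Notation mht := (@mht R D lam).
Hypothesis n_gt0 : (0 < n)%N.
Local Notation N := (n%:R : R).
Local Notation straights := [seq straight (lam m) | m <- iota 1 n].

(** The measure is real, but it is nonnegative and drops by exactly 1, so induction on an integer
    bound suffices. *)
Lemma good_standard L : good L -> exists2 pb, concat_rel straights pb &
  Freach pb (fun t => gpp 0 L (N * t)).
Proof.
move=> gd; have [k] : exists k : nat, mht 0 L < k%:R.
  by exists (Num.bound (mht 0 L)); apply/archi_boundP/(mht_ge0 lam_dom (proj1 gd)).
elim: k L gd => [|k IH] L gd hk.
  by move: hk; rewrite ltNge (mht_ge0 lam_dom (proj1 gd)).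
case: (boolP (all (fun p => dir p == lam (pm p)) L)) => [al|nal].
  by exists (fun t => gpp 0 L (N * t)); [exact: straight_concat|exact: fr_refl].
have [z [L' [m [Fp [Fm [gd' F1 F2 E]]]]]] : exists z L' (m : int) Fp Fm, [/\ good L',
    fi_on N z (gpp 0 L') m Fp Fm, forall t, gpp 0 L t = fshift z (gpp 0 L') m Fp Fm t &
    mht 0 L' = mht 0 L - 1].
  case: (pselect (exists z t, [/\ isr z, 0 <= t <= N & cv z (gpp 0 L t) < 0])) => [[z [t [rz ht neg]]]|H].
    by have [L' [m [Fp [Fm H]]]] := dip_step lam_dom rz gd ht neg; exists z, L', m, Fp, Fm.
  apply: push_step => // z t rz ht; rewrite leNgt; apply/negP => neg.
  by case: H; exists z, t.
have [|pb H1 H2] := IH L' gd'; first by rewrite E ltrBlDr natr1.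
exists pb => //; apply: (fr_step (i := z) H2); apply: (fi_rel_of_on n_gt0 F1) => // t _.
Qed.

Lemma seg_straight m c : (1 <= m)%N -> (m + c = n.+1)%N ->
  seg m.-1%:R [seq (q, [::], q%:R) | q <- iota m c] (n.+1, [::]) /\
  nextd (n.+1, [::] : seq I) [seq (q, [::], q%:R : R) | q <- iota m c] = (m, [::]).
Proof.
elim: c m => [|c IH] m m1 E; first by split=> //; move: E; rewrite addn0 => ->.
have mn : (1 <= m <= n)%N by rewrite m1 -ltnS -E addnS ltnS leq_addr.
have [|H1 H2] := IH m.+1 isT; first by rewrite addSnnS.
split=> //=; split=> //; last first.
  rewrite H2; split=> /=; [exact: rch_refl|exact: tge_id|right; split=> //].
  by exists [::].
by split=> //; rewrite /pe /pm /= ltr_nat prednK.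
Qed.

Lemma straight_good : exists2 L, good L & all (fun p => dir p == lam (pm p)) L.
Proof.
have [//|//|H _] := @seg_straight 1 n; exists [seq (q, [::], q%:R) | q <- iota 1 n].
  split=> //; move: n_gt0; case: (n) => // k _.
  by rewrite /lend -map_comp -[k.+1]addn1 iotaD map_cat last_cat /= /pe /= addnC.
by apply/allP => p /mapP [q _ ->].
Qed.

Lemma standard_good pb p : concat_rel straights pb -> Freach pb p ->
  exists2 L, good L & forall t, 0 <= t <= 1 -> p t = gpp 0 L (N * t).
Proof.
move=> Hpb; elim=> {p} [q Eq|q q' i _ [L gd Eq] fi].
  have [L gd al] := straight_good; exists L => // t t01.
  rewrite -Eq //; have X := straight_concat n_gt0 gd al.
  exact: (concat_uniq (f := fun m => straight (lam m)) n_gt0 Hpb X).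
have [m [Fp [Fm [F1 F2]]]] := fi_on_of_rel n_gt0 fi Eq.
have [L' [gd' E]] := fstep lam_dom gd F1; exists L' => // t t01.
by rewrite F2 // E.
Qed.

Variables (kap : nat -> nat) (lamml : nat -> nat -> V) (aml : nat -> nat -> rat).
Hypothesis gls : forall m, (1 <= m <= n)%N -> GLS (lam m) (kap m) (lamml m) (aml m).
Local Notation ls m := (lsfun (kap m) (lamml m) (aml m) : R -> V).

Section Build.
Variable w : nat -> nat -> seq I.
Hypotheses (w1 : forall m l, (1 <= m <= n)%N -> (1 <= l <= kap m)%N -> act (w m l) (lam m) = lamml m l)
  (w2 : forall m l, (1 <= m <= n)%N -> (1 <= l < kap m)%N -> bruhat_le (w m l.+1) (w m l))
  (w2' : forall m, (1 <= m < n)%N -> bruhat_le (w m.+1 1%N) (w m (kap m)))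
  (w3 : forall m, (1 <= m < n)%N -> inWreorbit (lam m) (act (w m.+1 1%N) (lam m)))
  (w4 : forall m, (1 <= m < n)%N -> achain 1 (lamml m (kap m)) (act (w m.+1 1%N) (lam m))).

Definition blocks m c := flatten [seq blk (aml q) q (w q) 1 (kap q) | q <- iota m c].

Lemma seg_blocks m c : (1 <= m)%N -> (m + c = n.+1)%N ->
  [/\ seg m.-1%:R (blocks m c) (n.+1, [::]), lend m.-1%:R (blocks m c) = N,
     nextd (n.+1, [::]) (blocks m c) = if c is 0%N then (n.+1, [::]) else (m, w m 1%N) &
     forall T, gpp m.-1%:R (blocks m c) T = \sum_(m <= q < m + c) ls q (T - q.-1%:R)].
Proof.
elim: c m => [|c IH] m m1 E.
  split=> //; first by move: E; rewrite addn0 => ->.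
  by move=> T; rewrite addn0 big_geq.
have mn : (1 <= m <= n)%N by rewrite m1 -ltnS -E addnS ltnS leq_addr.
have [||H1 H2 H3 H4] := IH m.+1; rewrite ?addSnnS //.
have [[k0 a0 ak ainc] [_ _ Hc Hl]] := gls mn.
have E0 : m.-1%:R + ratr (aml m 0%N) = m.-1%:R :> R by rewrite a0 rmorph0 addr0.
have Eb : blocks m c.+1 = blk (aml m) m (w m) 1 (kap m) ++ blocks m.+1 c by [].
have Ek : exists k : nat, kap m = k.+1 by exists (kap m).-1; rewrite prednK.
have lB : lend m.-1%:R (blk (aml m) m (w m) 1 (kap m)) = m%:R :> R.
  have [k Ek'] := Ek; by rewrite Ek' lend_blk add1n -Ek' (blk_end R ak mn).
split.
- rewrite Eb; apply/seg_cat; rewrite lB; split=> //; rewrite -{1}E0.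
  apply: (seg_blk lam_dom a0 ak ainc mn (l := 1) (lf := lamml m)) => //.
  + by move=> r hr; exact: w1.
  + by move=> r hr; exact: w2.
  have [m1' mn'] := andP mn.
  rewrite H3; case: (c) E => [|c'] E.
    have Em : m = n by move: E; clear; lia.
    split=> /=; [|exact: (tge_nil lam_dom)|right; split=> //; [by rewrite Em|by exists [::]]].
    rewrite {1}/dir /pe /pm /pw /= /base w1 ?k0 ?leqnn //.
    have -> : m%:R - m.-1%:R = ratr 1 :> R by rewrite rmorph1 -{1}(prednK m1) -natr1 addrC addKr.
    exact: achain_rchain.
  have hm : (1 <= m < n)%N by rewrite m1; move: E; clear; lia.
  split=> /=; [|apply: (bruhat_tge lam_dom mn'); exact: w2'|right; split=> //; exact: w3].
  rewrite {1}/dir /pe /pm /pw /= /base w1 ?k0 ?leqnn //.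
  have -> : m%:R - m.-1%:R = ratr 1 :> R by rewrite rmorph1 -{1}(prednK m1) -natr1 addrC addKr.
  by apply: achain_rchain; exact: w4.
- by rewrite Eb lend_cat lB.
- by have [k Ek'] := Ek; rewrite Eb Ek'.
move=> T; rewrite Eb gpp_cat lB H4 [RHS]big_ltn; last by rewrite addnS ltnS leq_addr.
rewrite addSnnS; congr (_ + _); rewrite -{1}E0 (gpp_blk lam _ _ _ (l := 1)) // add1n.
by apply: eq_big_nat => j hj; rewrite w1.
Qed.

Lemma build_good : exists2 L, good L & concat_rel [seq ls m | m <- iota 1 n] (fun t => gpp 0 L (N * t)).
Proof.
have [//|//|H1 H2 _ H4] := @seg_blocks 1 n; exists (blocks 1 n); first by split.
rewrite /= in H4.
apply: (concat_of_steps n_gt0 (f := fun m => ls m)).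
  rewrite H4 big_nat_cond big1 // => q /andP [/andP [q1 qn] _].
  have [[k0 a0 ak ainc] _] := gls (m := q) ltac:(by rewrite q1 -ltnS -add1n).
  by apply: (lsfun_le0 _ a0 ainc); rewrite sub0r oppr_le0 ler0n.
move=> m tau hm /andP [t0 t1]; have [m1 mn] := andP hm; rewrite !H4.
suff <- : \sum_(1 <= q < 1 + n) ls q (m.-1%:R + tau - q.-1%:R) -
   \sum_(1 <= q < 1 + n) ls q (m.-1%:R - q.-1%:R) = ls m tau by rewrite [RHS]addrC subrK.
rewrite -sumrB (bigD1_seq m) ?iota_uniq //=; last by rewrite mem_index_iota m1.
have gl q : (1 <= q < 1 + n)%N -> (1 <= q <= n)%N by rewrite add1n ltnS.
have [[k0 a0 ak ainc] _] := gls hm.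
rewrite subrr (lsfun_le0 _ a0 ainc (lexx 0)) // subr0 [m.-1%:R + tau]addrC addrK big_nat_cond big1 ?addr0 //.
move=> q /andP [/gl hq qm]; have [[k0' a0' ak' ainc'] _] := gls hq.
case: (ltngtP q m) qm => // lt _.
  have d1 : 1 <= m.-1%:R - q.-1%:R :> R.
    rewrite lerBrDr -(natrD _ 1 q.-1) ler_nat; move: lt hq; clear; lia.
  rewrite !(lsfun_ge1 _ ak' ainc') ?subrr //.
  by apply: le_trans d1 _; rewrite lerD2r lerDr.
have d1 : m.-1%:R + 1 <= q.-1%:R :> R by rewrite natr1 ler_nat; move: lt hm; clear; lia.
by rewrite !(lsfun_le0 _ a0' ainc') ?subrr // subr_le0; apply: le_trans d1; rewrite ?lerDl // addrC lerD2l.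
Qed.

End Build.

(** Both descriptions of the path are affine just to the right of [T]; comparing increments over a
    common short interval identifies the directions. *)
Lemma dir_of_path L p m l T : good L -> concat_rel [seq ls m | m <- iota 1 n] p ->
  (forall t, 0 <= t <= 1 -> p t = gpp 0 L (N * t)) -> (1 <= m <= n)%N -> (1 <= l <= kap m)%N ->
  m.-1%:R + ratr (aml m l.-1) <= T -> T < m.-1%:R + ratr (aml m l) -> act (pat L T).2 (lam m) = lamml m l.
Proof.
move=> [sg eL] Hp Ep hm hl T1 T2; have [[k0 a0 ak ainc] _] := gls hm.
have [m1 mn] := andP hm; have [l1 lk] := andP hl.
have [C HC] := concat_step n_gt0 (f := fun m => ls m) Hp Ep hm.
have lk' : (l.-1 <= kap m)%N by apply: leq_trans (leq_pred l) lk.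
have g0 : 0 <= ratr (aml m l.-1) :> R by exact: (af_ge0 R a0 ainc lk').
have g1 : ratr (aml m l) <= 1 :> R by exact: (af_le1 R ak ainc lk).
have Em : m.-1%:R + 1 = m%:R :> R by rewrite natr1 prednK.
have mT : m.-1%:R <= T by apply: le_trans T1; rewrite lerDl.
have Tm : T < m%:R by apply: lt_le_trans T2 _; rewrite -Em lerD2l.
have mN : m%:R <= N by rewrite ler_nat.
have T0 : 0 <= T := le_trans (ler0n _ _) mT.
have TL : T < lend 0 L by rewrite eL; exact: lt_le_trans Tm mN.
have [e1 e10 D1] := pat_deriv sg T0 TL.
rewrite (pat_pm sg m1 mT T0 Tm TL) in D1.
pose tau := T - m.-1%:R.
have [||e2 e20 D2] := lsfun_deriv (lamml m) ainc (t := tau) hl.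
- by rewrite lerBrDl.
- by rewrite ltrBlDl.
have tau0 : 0 <= tau by rewrite subr_ge0.
have tau1 : tau < 1 by rewrite ltrBlDl Em.
pose h := Num.min e1 (Num.min e2 (1 - tau)).
have h0 : 0 < h by rewrite !lt_min e10 e20 subr_gt0.
have h1 : h <= e1 by rewrite ge_min lexx.
have h2 : h <= e2 by rewrite !ge_min lexx orbT.
have h3 : tau + h <= 1 by rewrite -lerBrDl !ge_min lexx !orbT.
have ET : T = m.-1%:R + tau by rewrite /tau addrC subrK.
have := HC (tau + h); rewrite addr_ge0 ?(ltW h0) // h3 addrA -ET D1 ?h1 ?(ltW h0) // D2 ?h2 ?(ltW h0) //.
have := HC tau; rewrite tau0 (ltW tau1) -ET => -> //; rewrite addrA => /(_ isT) /addrI.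
by move/scalerI; apply; rewrite gt_eqF.
Qed.

(** After relifting, the word for [(m, l)] is read off at the starting time of the [l]-th segment of
    the [m]-th path. The link at time [m] supplies the two junction conditions. *)
Lemma extract_words L p : good L -> concat_rel [seq ls m | m <- iota 1 n] p ->
  (forall t, 0 <= t <= 1 -> p t = gpp 0 L (N * t)) ->
  exists w : nat -> nat -> seq I,
     [/\ forall m l, (1 <= m <= n)%N -> (1 <= l <= kap m)%N -> act (w m l) (lam m) = lamml m l,
         (forall m l, (1 <= m <= n)%N -> (1 <= l < kap m)%N -> bruhat_le (w m l.+1) (w m l)) /\
         (forall m, (1 <= m < n)%N -> bruhat_le (w m.+1 1%N) (w m (kap m))),
         forall m, (1 <= m < n)%N -> inWreorbit (lam m) (act (w m.+1 1%N) (lam m)) &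
         forall m, (1 <= m < n)%N -> achain 1 (lamml m (kap m)) (act (w m.+1 1%N) (lam m))].
Proof.
move=> [sg0 e0] Hp Ep0; have [L' [sg gE eL _ bL]] := relift lam_dom sg0.
have gd : good L' by split=> //; rewrite eL.
have Ep t : 0 <= t <= 1 -> p t = gpp 0 L' (N * t) by move=> ht; rewrite gE Ep0.
rewrite e0 in eL; have dirT := dir_of_path gd Hp Ep.
have succ m : (1 <= m < n)%N -> (1 <= m.+1 <= n)%N by case/andP.
have sub m : (1 <= m < n)%N -> (1 <= m <= n)%N by move=> /andP [-> /ltnW].
have Em m : (1 <= m)%N -> m.-1%:R + 1 = m%:R :> R by move=> m1; rewrite natr1 prednK.
pose tm m l : R := m.-1%:R + ratr (aml m l.-1).
have tm1 m : (1 <= m < n)%N -> tm m.+1 1%N = m%:R.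
  by move=> hm; rewrite /tm /=; have [[_ -> _ _] _] := gls (succ m hm); rewrite rmorph0 addr0.
have tm_lt m l : (1 <= m <= n)%N -> (1 <= l <= kap m)%N -> 0 <= tm m l /\ tm m l < m%:R.
  move=> hm /andP [l1 lk]; have [[k0 a0 ak ainc] _] := gls hm.
  have lk' : (l.-1 < kap m)%N by rewrite prednK.
  split; first by rewrite addr_ge0 ?ler0n // (af_ge0 R a0 ainc) // ltnW.
  rewrite -Em ?ltrD2l; last by case/andP: hm.
  by apply: lt_le_trans (af_lt R ainc lk') _; rewrite prednK //; exact: (af_le1 R ak ainc lk).
exists (fun m l => (pat L' (tm m l)).2); split.
- move=> m l hm hl; have [[k0 a0 ak ainc] _] := gls hm; apply: (dirT _ _ _ hm hl) => //.
  have [l1 lk] := andP hl; rewrite ltrD2l -{2}(prednK l1); apply: (af_lt _ ainc); rewrite prednK //.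
- split=> m.
  + move=> l hm /andP [l1 lk]; have [[k0 a0 ak ainc] _] := gls hm.
    apply: (pat_bruhat sg bL).
      by rewrite /tm lerD2l /= (af_le _ ainc) // ?leq_pred // ltnW.
    have [_ lt] := tm_lt m l.+1 hm lk; rewrite eL; apply: lt_le_trans lt _.
    by rewrite ler_nat; case/andP: hm.
  + move=> hm; have [[k0 a0 ak ainc] _] := gls (sub m hm); rewrite tm1 //.
    apply: (pat_bruhat sg bL); last by rewrite eL ltr_nat; case/andP: hm.
    by have [_ /ltW] := tm_lt m (kap m) (sub m hm) ltac:(by rewrite k0 leqnn).
all: move=> m hm; rewrite tm1 //; have [m1 mn] := andP hm.
all: have mN : m%:R < N by rewrite ltr_nat.
all: have [||p0 [T0 [H1 H2 [rc tg H3] H4 H5]]] := link_at sg m1; rewrite ?ltr0n ?eL //.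
- have Epat : (pat L' m%:R).1 = m.+1.
    by apply: (pat_pm sg) => //; rewrite ?ltr_nat ?eL.
  by case: H3 => [E|[_ _]]; [move: Epat; rewrite E H5 => /eqP; rewrite ltn_eqF|rewrite H5].
have [[k0 a0 ak ainc] _] := gls (sub m hm).
have hk : (1 <= kap m <= kap m)%N by rewrite k0 leqnn.
have [t0 t1] := tm_lt m (kap m) (sub m hm) hk.
(* From this time up to [m] both the last segment of the path and the piece [p0] are in force, so
   their directions agree. *)
pose T := Num.max T0 (tm m (kap m)).
have Tm : T < m%:R by rewrite gt_max H1.
have TT : T0 <= T by rewrite le_max lexx.
have Ed : dir p0 = lamml m (kap m).
  rewrite -(dirT m (kap m) T (sub m hm) hk) ?H2 //; first by rewrite /dir H5.
    by rewrite le_max lexx orbT.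
  by rewrite ak rmorph1 Em.
apply: rchain_achain1; move: rc; rewrite Ed H4 H5 /base.
by rewrite -{1}(Em m m1) addrC addKr.
Qed.

End Characterization.

Lemma Freach_ext (R : realType) (D : BCdatum R) (pb p q : R -> bV D) : Freach pb p ->
  (forall t, 0 <= t <= 1 -> p t = q t) -> Freach pb q.
Proof.
case=> [p' Eq|p' p'' i fr fi] E; first by apply: fr_refl => t t01; rewrite Eq // E.
apply: (fr_step fr (i := i)); case: fi => m [fp [fm [H1 H2 H3 H4 H5]]].
by exists m, fp, fm; split=> // t t01; rewrite -E // H5.
Qed.

Theorem theorem5p2p2 (R : realType) (D : BCdatum R) (n : nat)
  (lam : nat -> bV D) (kap : nat -> nat) (lamml : nat -> nat -> bV D)
  (aml : nat -> nat -> rat) (pi : R -> bV D) :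
  (0 < n)%N ->
  (forall m, (1 <= m <= n)%N -> dominant (lam m)) ->
  (forall m, (1 <= m <= n)%N -> GLS (lam m) (kap m) (lamml m) (aml m)) ->
  concat_rel [seq lsfun (kap m) (lamml m) (aml m) | m <- iota 1 n] pi ->
  (standard [seq lam m | m <- iota 1 n] pi <->
   exists w : nat -> nat -> seq (bI D),
     [/\ forall m l, (1 <= m <= n)%N -> (1 <= l <= kap m)%N ->
           act (w m l) (lam m) = lamml m l,
         (forall m l, (1 <= m <= n)%N -> (1 <= l < kap m)%N ->
           bruhat_le (w m l.+1) (w m l)) /\
         (forall m, (1 <= m < n)%N -> bruhat_le (w m.+1 1%N) (w m (kap m))),
         forall m, (1 <= m < n)%N -> inWreorbit (lam m) (act (w m.+1 1%N) (lam m)) &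
         forall m, (1 <= m < n)%N ->
           achain 1 (lamml m (kap m)) (act (w m.+1 1%N) (lam m))]).
Proof.
move=> n0 dl gls Hpi; have Es : [seq straight l | l <- [seq lam m | m <- iota 1 n]] =
  [seq straight (lam m) | m <- iota 1 n] by rewrite -map_comp.
rewrite /standard Es; split=> [[pb [Hb fr]]|[w [w1 [w2 w2'] w3 w4]]].
  have [L gd EL] := standard_good dl n0 Hb fr.
  exact: extract_words gd Hpi EL.
have [L gd HL] := build_good dl n0 gls w1 w2 w2' w3 w4.
have [pb Hb fr] := good_standard dl n0 gd; exists pb; split=> //.
apply: Freach_ext fr _ => t.
exact: (concat_uniq (f := fun m => lsfun (kap m) (lamml m) (aml m)) n0 HL Hpi).
Qed.
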